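(* Let $W$ be an irreducible, well-generated unitary reflection group with reflection arrangement $\mathcal{A}$ and Coxeter number $h$. Let $\omega:\mathcal{A}\to\mathbb{N}$ be given by $\omega(H)=e_H$, and let $m\in\mathbb{N}$. Suppose that $\mu:\mathcal{A}\to\{0,1\}$ is such that $\mathfrak{D}(\mathcal{A},\mu)$ is free with homogeneous basis $\theta_1,\ldots,\theta_\ell$. Then $\mathfrak{D}(\mathcal{A},m\omega+\mu)$ is free with basis $$\nabla_{\theta_1}\nabla_D^{-m}(E),\ \ldots,\ \nabla_{\theta_\ell}\nabla_D^{-m}(E).$$ Moreover, $$\exp(\mathcal{A},m\omega+\mu)=\{mh+\mathrm{pdeg}(\theta_1),\ldots,mh+\mathrm{pdeg}(\theta_\ell)\}.$$
   Context: $\mathbb{N}=\{0,1,2,\ldots\}$. Multi-arrangements. Let $V\cong\mathbb{C}^\ell$, $S=S(V^* )\cong\mathbb{C}[x_1,\ldots,x_\ell]$, $\mathrm{Der}_S$ the $S$-module of $\mathbb{C}$-derivations of $S$, with basis $\partial_{x_1},\ldots,\partial_{x_\ell}$. A derivation $\theta=\sum f_i\partial_{x_i}$ is homogeneous with $\mathrm{pdeg}\,\theta=p$ if all $f_i$ are homogeneous of degree $p$ (or zero). For a finite set $\mathcal{A}$ of hyperplanes $H=\ker(\alpha_H)$ ($\alpha_H\in V^*$) through $0$ and $\nu:\mathcal{A}\to\mathbb{N}$, $\mathfrak{D}(\mathcal{A},\nu)=\{\theta\in\mathrm{Der}_S\mid\theta(\alpha_H)\in S\alpha_H^{\nu(H)}\text{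 for all }H\in\mathcal{A}\}$. If this is a free $S$-module, it has a homogeneous basis $\theta_1,\ldots,\theta_\ell$ and $\exp(\mathcal{A},\nu)$ is the multiset $\{\mathrm{pdeg}\,\theta_1,\ldots,\mathrm{pdeg}\,\theta_\ell\}$. Reflection groups. A unitary reflection group $W$ is a finite subgroup of $\mathrm{GL}(V)$ generated by reflections (elements whose fixed space is a hyperplane); it is irreducible if it preserves no proper non-trivial subspace of $V$, and then well-generated if it can be generated by $\ell=\dim V$ reflections. $\mathcal{A}$ is the set of reflecting hyperplanes and $e_H$ is the order of the pointwise stabilizer of $H\in\mathcal{A}$. The Coxeter number is $h=\frac1\ell\sum_{H\in\mathcal{A}}e_H$. The invariant ring $R=S^W=\mathbb{C}[t_1,\ldots,t_\ell]$ is polynomial on homogeneous generators of degrees $d_1\le\ldots\le d_\ell$; since $W$ is irreducible and well-generated, $d_\ell=h>d_{\ell-1}$. The objects $D$, $\nabla$, $E$. Extend $\partial_{t_1},\ldots,\partial_{t_\ell}$ to derivations of the fraction field $F$ of $S$ via $\partial_{t_i}(t_j)=\delta_{ij}$, and let $\mathrm{Der}_R=\bigoplus_iR\,\partial_{t_i}\subset\bigoplus_iF\partial_{x_i}$. The primitive vector field is $D=\partial_{t_\ell}$; up to a non-zero constant it is independent of the choice of the $t_i$ (in the paper the $t_i$ are the flat fundamental invariants of Kato–Mano–Sekiguchi). $\nabla$ is the flat connection $\nabla_\delta\big(\sum_ip_i\partial_{x_i}\big)=\sum_i\delta(p_i)\partial_{x_i}$, also for $\delta$ and $p_i$ with rational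 coefficients. $E=\frac1h\sum_ix_i\partial_{x_i}$. Let $\mathrm{Der}_S^W$ denote the $W$-invariant derivations of $S$; $\theta=\sum_i\theta(t_i)\partial_{t_i}$ exhibits $\mathrm{Der}_S^W$ as a submodule of $\mathrm{Der}_R$ (namely the logarithmic vector fields along the discriminant). The map $\nabla_D$ restricts to a bijection $\mathrm{Der}_S^W\to\mathrm{Der}_R$; $\nabla_D^{-1}:\mathrm{Der}_R\to\mathrm{Der}_S^W\subset\mathrm{Der}_R$ denotes its inverse and $\nabla_D^{-m}$ its $m$-th iterate. *)

(* Defs.v *)
From mathcomp Require Import all_boot all_order all_algebra all_fingroup all_character.
From mathcomp Require Import fraction.
From mathcomp Require Export reals complex mpoly.
Set Implicit Arguments.
Unset Strict Implicit.
Unset Printing Implicit Defensive.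
Import GRing.Theory.
Local Open Scope ring_scope.

(* V = K^l is the space of row vectors, and {mpoly K[l]} is S = S(V^* ).
   A derivation sum_i f_i d/dx_i is the row vector of its coefficients f_i,
   in S for elements of Der_S, in the fraction field F for rational ones. *)
Notation derS K l := 'rV[{mpoly K[l]}]_l.
Notation derF K l := 'rV[{fraction {mpoly K[l]}}]_l.

Section Derivations.
Variables (K : fieldType) (l : nat).
Implicit Types (f : {mpoly K[l]}) (theta eta : derS K l) (delta : derF K l).

Definition der_app theta f : {mpoly K[l]} :=
  \sum_(i < l) theta 0 i * f^`M(i).

Definition derF_app delta f : {fraction {mpoly K[l]}} :=
  \sum_(i < l) delta 0 i * tofrac f^`M(i).

Definition to_derF theta : derF K l := map_mx (@tofrac {mpoly K[l]}) theta.

(* The flat connection, on fields with polynomial coefficients; the direction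
   is polynomial for [nabla] and rational for [nablaF]. *)
Definition nabla theta eta : derS K l := \row_j der_app theta (eta 0 j).

Definition nablaF delta eta : derF K l := \row_j derF_app delta (eta 0 j).

Definition pdeg_is (p : nat) theta : Prop :=
  forall i, theta 0 i \is p.-homog.

Definition free_basis (M : derS K l -> Prop) (b : 'I_l -> derS K l) : Prop :=
  (forall i, M (b i)) /\
  (forall theta, M theta ->
     exists! c : 'rV[{mpoly K[l]}]_l, theta = \sum_i c 0 i *: b i).

Definition homog_basis (M : derS K l -> Prop) (b : 'I_l -> derS K l)
    (p : 'I_l -> nat) : Prop :=
  free_basis M b /\ (forall i, pdeg_is (p i) (b i)).

(* The multiset is a sequence up to permutation; the second clause says that
   it does not depend on the homogeneous basis. *)
Definition exponents (M : derS K l -> Prop) (s : seq nat) : Prop :=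
  (exists b p, homog_basis M b p /\ perm_eq s (codom p)) /\
  (forall b p, homog_basis M b p -> perm_eq s (codom p)).

Definition linear_poly (alpha : 'Hom('rV[K]_l, K^o)) : {mpoly K[l]} :=
  \sum_(i < l) (alpha (delta_mx 0 i) : K) *: 'X_i.

(* Any two forms alpha with the same kernel H are proportional, so that
   quantifying over all of them amounts to fixing one alpha_H. *)
Definition log_der (A : seq {vspace 'rV[K]_l}) (nu : {vspace 'rV[K]_l} -> nat)
    theta : Prop :=
  forall H alpha, H \in A -> lker alpha = H ->
    exists q, der_app theta (linear_poly alpha) = q * linear_poly alpha ^+ nu H.

End Derivations.

Section ReflectionGroups.
Variables (K : fieldType) (l : nat) (gT : finGroupType) (W : {group gT}).
Variable rW : mx_representation K W l.
Implicit Types (g : gT) (f : {mpoly K[l]}) (theta : derS K l) (delta : derF K l).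

Definition fix_space g : {vspace 'rV[K]_l} :=
  fixedSpace (linfun (mulmxr (rW g))).

Definition is_reflection g : bool := (g \in W) && ((\dim (fix_space g)).+1 == l).

Definition reflection_group : Prop :=
  mx_faithful rW /\ <<[set g | is_reflection g]>>%g = W.

Definition well_generated : Prop :=
  exists r : l.-tuple gT,
    (forall i, is_reflection (tnth r i)) /\ <<[set g in r]>>%g = W.

Definition refl_arr : seq {vspace 'rV[K]_l} :=
  undup [seq fix_space g | g <- enum [set g | is_reflection g]].

Definition stab_order (H : {vspace 'rV[K]_l}) : nat :=
  #|[set g in W | (H <= fix_space g)%VS]|.

(* For an irreducible well-generated reflection group the division is exact:
   the Coxeter number is then the largest degree. *)
Definition coxeter_number : nat := (\sum_(H <- refl_arr) stab_order H) %/ l.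

Definition euler : derS K l := \row_i ((coxeter_number%:R : K)^-1 *: 'X_i).

(* The polynomial function v |-> f (v *m rW g). *)
Definition poly_act g f : {mpoly K[l]} :=
  f \mPo [tuple \sum_(j < l) rW g j i *: 'X_j | i < l].

Definition invariant f : Prop := forall g, g \in W -> poly_act g f = f.

Definition inv_der theta : Prop :=
  forall g f, g \in W ->
    der_app theta (poly_act g f) = poly_act g (der_app theta f).

(* S^W = K[t_1, ..., t_l], with homogeneous algebraically independent
   generators listed by nondecreasing degree. *)
Definition fundamental_invariants (t : 'I_l -> {mpoly K[l]})
    (d : 'I_l -> nat) : Prop :=
  [/\ forall i, t i \is (d i).-homog,
      forall i j : 'I_l, (i <= j)%N -> (d i <= d j)%N,
      forall i, invariant (t i),
      forall f, invariant f -> exists p, f = p \mPo [tuple t i | i < l]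
    & forall p, p \mPo [tuple t i | i < l] = 0 -> p = 0].

(* dt i is the extension of d/dt_i to the fraction field of S. *)
Definition dual_derivations (t : 'I_l -> {mpoly K[l]})
    (dt : 'I_l -> derF K l) : Prop :=
  forall i j, derF_app (dt i) (t j) = (i == j)%:R.

Definition derR (dt : 'I_l -> derF K l) delta : Prop :=
  exists2 r : 'I_l -> {mpoly K[l]}, forall i, invariant (r i)
    & delta = \sum_i tofrac (r i) *: dt i.

(* nablaDinv is the inverse of the bijection nabla_D : Der_S^W -> Der_R; its
   values outside Der_R are irrelevant. *)
Definition nablaD_inverse (dt : 'I_l -> derF K l) (D : derF K l)
    (nablaDinv : derF K l -> derS K l) : Prop :=
  (forall eta, inv_der eta ->
     derR dt (nablaF D eta) /\ nablaDinv (nablaF D eta) = eta) /\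
  (forall delta, derR dt delta ->
     inv_der (nablaDinv delta) /\ nablaF D (nablaDinv delta) = delta).

(* The m-th iterate of nablaDinv at E, Der_S^W being embedded in Der_R. *)
Definition nablaDinv_iter (nablaDinv : derF K l -> derS K l) (m : nat) :
    derS K l :=
  iter m (fun eta => nablaDinv (to_derF eta)) euler.

End ReflectionGroups.

(* Main.v *)
(* Put [Xi = nabla_D^{-m}(E)] and let [J] be the matrix of the [d(Xi_j)/dx_i], so
   that [nabla_theta Xi] is the row vector [theta J].  Two facts are needed, for
   each root [alpha] of a reflecting hyperplane [H] and [e = e_H]: (a) [Xi(alpha)]
   is divisible by [alpha^(me+1)]; (b) [det J] is a nonzero constant times the
   product of the [alpha^(me)].  By (a), [theta J] lies in [D(A, m omega + mu)] if
   [theta] lies in [D(A, mu)], and (b) allows one to go back by Cramer's rule.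

   For (a), [D] has a pole of order exactly [e - 1] along [H], since otherwise
   [nabla_D] could not map [Der_S^W] onto [Der_R]; hence [nabla_D^{-1}] raises the
   order of [Xi(alpha)] by [e].  For (b), [det J] is not zero because at the point
   [t = (0, ..., 0, 1)] the Euler field is a multiple of [D], which makes the
   matrix of the fields [nabla_{d/dt_k} Xi] diagonal there.  By (a), [det J] is
   divisible by the product in (b), and the degrees agree if [l h] is the sum of
   the [e_H], where [h = d_l].

   This last identity is proved along the way: the invariant fields
   [phi_k = nabla_{d/dt_k} nabla_D^{-1}(E)] generate [Der_S^W] over [R], because
   the map sending [sum_k r_k d/dt_k = nabla_D psi] to [sum_k r_k phi_k] is
   injective and preserves the degree of [psi].  By Lagrange interpolation on
   orbits their determinant is a constant times the product of the [alpha], while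
   the Jacobian of the [t_i] is a constant times the product of the
   [alpha^(e-1)]; adding the degrees gives [l h]. *)
From HB Require Import structures.
Require Import Defs.
From mathcomp Require Import all_boot all_order all_algebra all_fingroup all_character.
From mathcomp Require boolp.
From mathcomp Require Import fraction generic_quotient cyclic ring zify.
Set Implicit Arguments.
Unset Strict Implicit.
Unset Printing Implicit Defensive.
Import Order.TTheory GRing.Theory Num.Theory.
Local Open Scope ring_scope.

Local Notation "x %:F" := (tofrac x).
Local Notation invariant := Defs.invariant.

(** * Derivations of the fraction field *)

(** The [dt k] have rational coefficients, and neither the Jacobian of the [t_i] nor the sum of the
    degrees is known in advance, so regularity cannot be read off a determinant. It is established
    locally: a fraction whose denominator is a product of linear forms is a polynomial once its
    order along each of these forms is non-negative. Both inputs come from the orbit of a linear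
    form [f]. Let [Delta] be the product of the [f - r] over the conjugates [r != f]; it is a
    product of linear forms. If [y] is fixed by the stabilizer of [f], then [Delta y] is a
    polynomial in [f] with invariant coefficients, and [Delta] is also the derivative at [f] of the
    polynomial whose roots are the conjugates. Hence a derivation that is regular on invariants maps
    [y] to a fraction whose denominator is a power of [Delta]. A trivial stabilizer of [f] admits
    every [y]. For the order along a hyperplane, [f] is chosen with [Delta] not vanishing on it and
    with stabilizer its pointwise stabilizer; an invariant Hermitian form shows that such an [f]
    exists. *)

Section Fraction.
Variable A : idomainType.
Implicit Types (u v : {fraction A}) (a b : A).

Lemma tofrac_inj : injective (@tofrac A).
Proof. by move=> a b /eqP; rewrite tofrac_eq => /eqP. Qed.

Lemma fraction_numden u : u * (\d_(repr u))%:F = (\n_(repr u))%:F.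
Proof.
suff pi_numden (x : {ratio A}) : \pi_{fraction A}%qT x * (\d_x)%:F = (\n_x)%:F.
  by rewrite -[X in X * _](reprK u) pi_numden.
apply/eqP; rewrite !piE FracField.equivfE /FracField.mulf.
by rewrite !numden_Ratio ?mulf_neq0 ?oner_eq0 ?denom_ratioP // !mulr1 mulrC.
Qed.

Lemma fraction_repr u : u = (\n_(repr u))%:F / (\d_(repr u))%:F.
Proof.
by rewrite -fraction_numden mulfK // tofrac_eq0 denom_ratioP.
Qed.

Lemma fractionP u : exists a b, b != 0 /\ u = a%:F / b%:F.
Proof.
by exists \n_(repr u), \d_(repr u); split; [exact: denom_ratioP | exact: fraction_repr].
Qed.

End Fraction.

Section FractionLift.
Variables (A : idomainType) (L : fieldType) (phi : {rmorphism A -> L}).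
Hypothesis phi_inj : injective phi.

Let lift (u : {fraction A}) : L := phi \n_(repr u) / phi \d_(repr u).

Let phi_neq0 a : a != 0 -> phi a != 0.
Proof. by rewrite -(rmorph0 phi) (inj_eq phi_inj). Qed.

Let liftE a b : b != 0 -> lift (a%:F / b%:F) = phi a / phi b.
Proof.
move=> b0; rewrite /lift; set u := a%:F / b%:F.
have d0 := denom_ratioP (repr u).
apply/eqP; rewrite eqr_div ?phi_neq0 // -!rmorphM (inj_eq phi_inj).
rewrite -tofrac_eq !tofracM -fraction_numden; set d := (\d__)%:F.
by rewrite mulrAC divfK // tofrac_eq0 // mulrC.
Qed.

Let lift_tofrac a : lift a%:F = phi a.
Proof. by rewrite -[a%:F]divr1 -tofrac1 liftE ?oner_eq0 // rmorph1 divr1. Qed.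

Let lift_additive : additive lift.
Proof.
move=> u v; have [a [b [b0 ->]]] := fractionP u.
have [c [d [d0 ->]]] := fractionP v.
have b0' := phi_neq0 b0; have d0' := phi_neq0 d0.
rewrite !liftE // -mulNr -tofracN addf_div ?tofrac_eq0 //.
rewrite -!tofracM -tofracD liftE ?mulf_neq0 // !(rmorphM, rmorphD) /=.
by rewrite -[X in _ = _ + X]mulNr addf_div // rmorphN.
Qed.

Let lift_multiplicative : multiplicative lift.
Proof.
split=> [u v|]; last by rewrite -tofrac1 lift_tofrac rmorph1.
have [a [b [b0 ->]]] := fractionP u.
have [c [d [d0 ->]]] := fractionP v.
rewrite mulf_div -!tofracM !liftE ?mulf_neq0 // !rmorphM /=.
by rewrite mulf_div.
Qed.

Lemma fraction_rmorphism :
  exists Phi : {rmorphism {fraction A} -> L}, forall a, Phi a%:F = phi a.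
Proof.
pose ma := GRing.isAdditive.Build {fraction A} L lift lift_additive.
pose mm := GRing.isMultiplicative.Build {fraction A} L lift lift_multiplicative.
pose Phi : {rmorphism {fraction A} -> L} := HB.pack lift ma mm.
by exists Phi => a; rewrite /= lift_tofrac.
Qed.

End FractionLift.

(** [B] is an [A]-module through [phi]. The twist makes both sides of an equivariance identity, such
    as [y |-> delta (g y)], derivations of the same kind. *)
Definition derivation (A B : pzRingType) (phi d : A -> B) : Prop :=
  (forall a b, d (a + b) = d a + d b) /\
  (forall a b, d (a * b) = d a * phi b + phi a * d b).

Section MPolyAlgebra.
Variables (K : fieldType) (l : nat).
Implicit Types (f g : {mpoly K[l]}).

Lemma mpoly_alg_ind (P : {mpoly K[l]} -> Prop) :
  (forall c, P c%:MP) -> (forall i, P 'X_i) ->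
  (forall f g, P f -> P g -> P (f + g)) ->
  (forall f g, P f -> P g -> P (f * g)) -> forall f, P f.
Proof.
move=> PC PX PD PM f; have PXn i k : P ('X_i ^+ k).
  by elim: k => [|k IH]; rewrite ?expr0 -?mpolyC1 // exprS; apply: PM.
rewrite (mpolyE f); apply: (big_ind P) => [||m _]; rewrite -?mpolyC0 //.
rewrite -mul_mpolyC mpolyXE_id; apply: (PM _ _ (PC _)).
by apply: (big_ind P) => // ; rewrite -mpolyC1.
Qed.

Lemma mderivXU i j : ('X_i : {mpoly K[l]})^`M(j) = (i == j)%:R.
Proof.
rewrite mderivX mnm1E; case: eqP => [->|_]; last by rewrite scale0r.
rewrite scale1r [X in 'X_[X]](_ : _ = 0%MM) ?mpolyX0 //.
by apply/mnmP => k; rewrite mnmBE mnm0E subnn.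
Qed.

Lemma derivation_mpoly (B : comNzRingType) (phi : {rmorphism {mpoly K[l]} -> B})
    (d : {mpoly K[l]} -> B) :
  derivation phi d -> (forall c, d c%:MP = 0) ->
  forall f, d f = \sum_i phi f^`M(i) * d 'X_i.
Proof.
move=> [dD dM] dC; apply: mpoly_alg_ind => [c|i|f g Df Dg|f g Df Dg].
- by rewrite dC big1 // => i _; rewrite mderivC rmorph0 mul0r.
- rewrite (bigD1 i) //= mderivXU eqxx rmorph1 mul1r big1 ?addr0 // => j ji.
  by rewrite mderivXU eq_sym (negPf ji) rmorph0 mul0r.
- rewrite dD Df Dg -big_split; apply: eq_bigr => i _ /=.
  by rewrite mderivD rmorphD mulrDl.
- rewrite dM Df Dg mulr_suml mulr_sumr -big_split; apply: eq_bigr => i _ /=.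
  rewrite mderivM rmorphD !rmorphM mulrDl mulrA; congr (_ + _).
  by rewrite mulrAC.
Qed.

Lemma rmorph_mpoly_ext (B : comNzRingType) (phi psi : {rmorphism {mpoly K[l]} -> B}) :
  (forall c, phi c%:MP = psi c%:MP) -> (forall i, phi 'X_i = psi 'X_i) ->
  phi =1 psi.
Proof.
move=> eqC eqX; apply: mpoly_alg_ind => // f g Ef Eg.
  by rewrite !rmorphD Ef Eg.
by rewrite !rmorphM Ef Eg.
Qed.

End MPolyAlgebra.

(** With [w, z, y, x] the derivatives of [f, g, n, d], the last equation is the derivative of
    [f d = n g]; so the quotient rule is independent of the representation of the fraction. *)
Lemma quotient_rule_indep (L : fieldType) (f g n d w z y x : L) :
  d != 0 -> g != 0 -> f * d = n * g -> w * d + f * x = y * g + n * z ->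
  (y * d - n * x) / d ^+ 2 = (w * g - f * z) / g ^+ 2.
Proof.
move=> d0 g0 E Ed; have Ef : f = n * g / d by rewrite -E mulfK.
have Ew : w = (y * g + n * z - f * x) / d by rewrite -Ed addrK mulfK.
by rewrite Ew Ef; field; rewrite d0 g0.
Qed.

Lemma subf_div (L : fieldType) (a b c d : L) :
  b != 0 -> d != 0 -> a / b - c / d = (a * d - c * b) / (b * d).
Proof. by move=> b0 d0; rewrite -mulNr addf_div // mulNr. Qed.

Lemma quotient_rule_sub (L : fieldType) (A B C D x y z w : L) :
  B != 0 -> D != 0 ->
  ((x * D + A * w - (z * B + C * y)) * (B * D) - (A * D - C * B) * (y * D + B * w))
    / (B * D) ^+ 2 =
  (x * B - A * y) / B ^+ 2 - (z * D - C * w) / D ^+ 2.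
Proof. by move=> B0 D0; field; rewrite B0 D0. Qed.

Lemma quotient_rule_mul (L : fieldType) (A B C D x y z w : L) :
  B != 0 -> D != 0 ->
  ((x * C + A * z) * (B * D) - A * C * (y * D + B * w)) / (B * D) ^+ 2 =
  (x * B - A * y) / B ^+ 2 * (C / D) + A / B * ((z * D - C * w) / D ^+ 2).
Proof. by move=> B0 D0; field; rewrite B0 D0. Qed.

Lemma comm_derM (L : comPzRingType) (u v a b c d e f g h : L) :
  a * v + g * f + (e * h + u * b) - (c * v + e * h + (g * f + u * d)) =
  (a - c) * v + u * (b - d).
Proof. by ring. Qed.

Section FractionDerivations.
Variables (K : fieldType) (l : nat).
Notation S := {mpoly K[l]}.
Notation F := {fraction {mpoly K[l]}}.
Implicit Types (f g : S) (u v : F) (delta : derF K l).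

Lemma derF_app_additive delta : additive (derF_app delta).
Proof.
move=> f g; rewrite /derF_app -sumrB; apply: eq_bigr => i _.
by rewrite mderivB tofracB mulrBr.
Qed.

HB.instance Definition _ delta :=
  GRing.isAdditive.Build S F (derF_app delta) (derF_app_additive delta).

Lemma derF_appM delta f g :
  derF_app delta (f * g) = derF_app delta f * g%:F + f%:F * derF_app delta g.
Proof.
rewrite /derF_app mulr_suml mulr_sumr -big_split; apply: eq_bigr => i _ /=.
by rewrite mderivM tofracD !tofracM mulrDr mulrA mulrCA.
Qed.

Lemma derF_appC delta c : derF_app delta c%:MP = 0.
Proof. by rewrite /derF_app big1 // => i _; rewrite mderivC tofrac0 mulr0. Qed.

Lemma derF_appX delta i : derF_app delta 'X_i = delta 0 i.
Proof.
rewrite /derF_app (bigD1 i) //= mderivXU eqxx tofrac1 mulr1 big1 ?addr0 // => j ji.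
by rewrite mderivXU eq_sym (negPf ji) tofrac0 mulr0.
Qed.

Definition fder delta u : F :=
  (derF_app delta \n_(repr u) * (\d_(repr u))%:F
   - (\n_(repr u))%:F * derF_app delta \d_(repr u)) / (\d_(repr u))%:F ^+ 2.

Lemma fder_frac delta f g : g != 0 ->
  fder delta (f%:F / g%:F) =
  (derF_app delta f * g%:F - f%:F * derF_app delta g) / g%:F ^+ 2.
Proof.
move=> g0; rewrite /fder; set u := f%:F / g%:F; set d := \d_ _; set n := \n_ _.
have d0 : d%:F != 0 :> F by rewrite tofrac_eq0 denom_ratioP.
have g0' : g%:F != 0 :> F by rewrite tofrac_eq0.
have E : f * d = n * g.
  by apply: tofrac_inj; rewrite !tofracM -fraction_numden /u mulrAC divfK.
have := congr1 (derF_app delta) E; rewrite !derF_appM.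
have := congr1 (@tofrac S) E; rewrite !tofracM.
move: (derF_app _ d) (derF_app _ n) (derF_app _ g) (derF_app _ f) => x y z w EF Ed.
exact: (quotient_rule_indep d0 g0' EF Ed).
Qed.

Lemma fder_tofrac delta f : fder delta f%:F = derF_app delta f.
Proof.
rewrite -[f%:F]divr1 -tofrac1 fder_frac ?oner_eq0 // tofrac1 expr1n !divr1 mulr1.
by rewrite -mpolyC1 derF_appC mulr0 subr0.
Qed.

Lemma fder_additive delta : additive (fder delta).
Proof.
move=> u v; have [a [b [b0 ->]]] := fractionP u.
have [c [d [d0 ->]]] := fractionP v.
have b0' : b%:F != 0 :> F by rewrite tofrac_eq0.
have d0' : d%:F != 0 :> F by rewrite tofrac_eq0.
rewrite (fder_frac delta a b0) (fder_frac delta c d0).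
have -> : a%:F / b%:F - c%:F / d%:F = (a * d - c * b)%:F / (b * d)%:F :> F.
  rewrite tofracB (tofracM a d) (tofracM c b) (tofracM b d).
  exact: (subf_div a%:F c%:F b0' d0').
rewrite (fder_frac delta _ (mulf_neq0 b0 d0)) raddfB /= !derF_appM.
rewrite !tofracB !tofracM.
exact: (quotient_rule_sub _ _ _ _ _ _ b0' d0').
Qed.

HB.instance Definition _ delta :=
  GRing.isAdditive.Build F F (fder delta) (fder_additive delta).

Lemma fderM delta u v : fder delta (u * v) = fder delta u * v + u * fder delta v.
Proof.
have [a [b [b0 ->]]] := fractionP u.
have [c [d [d0 ->]]] := fractionP v.
have b0' : b%:F != 0 :> F by rewrite tofrac_eq0.
have d0' : d%:F != 0 :> F by rewrite tofrac_eq0.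
rewrite (fder_frac delta a b0) (fder_frac delta c d0).
rewrite mulf_div -!tofracM (fder_frac delta _ (mulf_neq0 b0 d0)).
rewrite !derF_appM !tofracM.
exact: (quotient_rule_mul _ _ _ _ _ _ b0' d0').
Qed.

Lemma fder_derivation delta : derivation id (fder delta).
Proof. by split=> u v; rewrite ?raddfD ?fderM. Qed.

Lemma fraction_derivation_ext (d1 d2 : F -> F) :
  derivation id d1 -> derivation id d2 -> (forall f, d1 f%:F = d2 f%:F) ->
  d1 =1 d2.
Proof.
move=> [_ d1M] [_ d2M] E u; have [a [b [b0 ->]]] := fractionP u.
have b0' : b%:F != 0 :> F by rewrite tofrac_eq0.
have := E a; rewrite -[X in d1 X](divfK b0') -[X in d2 X](divfK b0') d1M d2M E.
by move/addIr/(mulIf b0').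
Qed.

Lemma derivation_comm (d1 d2 : F -> F) :
  derivation id d1 -> derivation id d2 ->
  derivation id (fun u => d1 (d2 u) - d2 (d1 u)).
Proof.
move=> [d1D d1M] [d2D d2M]; split=> u v; first by rewrite !(d1D, d2D) addrACA opprD.
rewrite d1M d2M !(d1D, d2D) !(d1M, d2M).
exact: comm_derM.
Qed.

Lemma derivationZ (w : F) (d : F -> F) :
  derivation id d -> derivation id (fun u => w * d u).
Proof.
by move=> [dD dM]; split=> u v; rewrite ?dD ?dM mulrDr // mulrA (mulrCA w).
Qed.

Lemma derivation_sum (I : finType) (d : I -> F -> F) :
  (forall i, derivation id (d i)) -> derivation id (fun u => \sum_i d i u).
Proof.
move=> dd; split=> u v.
  by rewrite -big_split; apply: eq_bigr => i _ /=; rewrite (dd i).1.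
rewrite mulr_suml mulr_sumr -big_split; apply: eq_bigr => i _ /=.
by rewrite (dd i).2.
Qed.

End FractionDerivations.

(** * Derivations determined by their values on the invariants *)

Section DualDerivations.
Variables (K : fieldType) (l : nat).
Variables (t : 'I_l -> {mpoly K[l]}) (dt : 'I_l -> derF K l).
Hypothesis dual : dual_derivations t dt.
Notation S := {mpoly K[l]}.
Notation F := {fraction {mpoly K[l]}}.
Implicit Types (f g : S) (u v : F).

Definition jac : 'M[F]_l := \matrix_(i, j) (t j)^`M(i)%:F.
Definition dtmx : 'M[F]_l := \matrix_k dt k.

Lemma dtmx_jac : dtmx *m jac = 1%:M.
Proof.
apply/matrixP => k j; rewrite mxE [RHS]mxE -dual /derF_app.
by apply: eq_bigr => i _; rewrite !mxE.
Qed.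

Lemma jac_dtmx : jac *m dtmx = 1%:M.
Proof. exact: mulmx1C dtmx_jac. Qed.

(** The Jacobian matrix of the [t j] has the inverse [dtmx], so the values on the [t j] determine
    those on the variables. [Phi] is the identity, or the action of an element of [W] on [F]. *)
Lemma derivation_dual_ext (Phi : {rmorphism F -> F}) (d1 d2 : S -> F) :
  derivation (Phi \o @tofrac S) d1 -> derivation (Phi \o @tofrac S) d2 ->
  (forall c, d1 c%:MP = 0) -> (forall c, d2 c%:MP = 0) ->
  (forall j, d1 (t j) = d2 (t j)) -> d1 =1 d2.
Proof.
move=> dd1 dd2 c1 c2 E f.
have E1 := @derivation_mpoly _ _ _ (Phi \o @tofrac S) d1 dd1 c1.
have E2 := @derivation_mpoly _ _ _ (Phi \o @tofrac S) d2 dd2 c2.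
suff EX : (\row_i d1 'X_i) = (\row_i d2 'X_i).
  rewrite E1 E2; apply: eq_bigr => i _.
  by have /matrixP/(_ 0 i) := EX; rewrite !mxE => ->.
have Phi_jac : map_mx Phi jac *m map_mx Phi dtmx = 1%:M.
  by rewrite -map_mxM jac_dtmx map_mx1.
rewrite -[LHS]mulmx1 -[RHS]mulmx1 -Phi_jac !mulmxA; congr (_ *m _).
apply/rowP => j; rewrite !mxE; have := E j; rewrite E1 E2 => EE.
rewrite [LHS](eq_bigr (fun i => (Phi \o @tofrac S) (t j)^`M(i) * d1 'X_i)).
  by rewrite EE; apply: eq_bigr => i _; rewrite !mxE mulrC.
by move=> i _; rewrite !mxE mulrC.
Qed.

Lemma fder_dual_ext (d1 d2 : F -> F) :
  derivation id d1 -> derivation id d2 ->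
  (forall c : K, d1 (c%:MP)%:F = 0) -> (forall c : K, d2 (c%:MP)%:F = 0) ->
  (forall j, d1 (t j)%:F = d2 (t j)%:F) -> d1 =1 d2.
Proof.
move=> dd1 dd2 c1 c2 E; apply: fraction_derivation_ext => // f.
apply: (@derivation_dual_ext idfun (d1 \o @tofrac S) (d2 \o @tofrac S)) => //.
  by split=> a b /=; rewrite ?tofracD ?tofracM (dd1.1, dd1.2).
by split=> a b /=; rewrite ?tofracD ?tofracM (dd2.1, dd2.2).
Qed.

Lemma fder_dual k j : fder (dt k) (t j)%:F = (k == j)%:R.
Proof. by rewrite fder_tofrac dual. Qed.

Lemma fderC delta (c : K) : fder delta (c%:MP)%:F = 0 :> F.
Proof. by rewrite fder_tofrac derF_appC. Qed.

Lemma fder_nat delta n : fder delta (n%:R : F) = 0.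
Proof. by rewrite raddfMn /= -(tofrac1 S) -mpolyC1 fderC mul0rn. Qed.

(** The commutator is a derivation which vanishes on constants and on all the [t i]. *)
Lemma fder_dual_comm j k u :
  fder (dt j) (fder (dt k) u) = fder (dt k) (fder (dt j) u).
Proof.
apply/eqP; rewrite -subr_eq0; apply/eqP.
have z0 : derivation id (fun _ : F => 0 : F).
  by split=> *; rewrite ?addr0 ?mul0r ?mulr0 ?addr0.
move: u; apply: (fder_dual_ext _ z0) => //.
- by apply: derivation_comm; apply: fder_derivation.
- by move=> c; rewrite !fderC !raddf0 addr0.
- by move=> i; rewrite !fder_dual !fder_nat subrr.
Qed.

End DualDerivations.

(** * Divisibility and orders *)

Section Divisibility.
Variable A : idomainType.
Implicit Types (c d f g p : A) (v w : {fraction A}) (P : A -> Prop).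

Definition mdvd p f := exists q, f = q * p.

Lemma mdvd0 p : mdvd p 0. Proof. by exists 0; rewrite mul0r. Qed.

Lemma mdvd_refl p : mdvd p p. Proof. by exists 1; rewrite mul1r. Qed.

Lemma mdvd_mull p f g : mdvd p g -> mdvd p (f * g).
Proof. by case=> q ->; exists (f * q); rewrite mulrA. Qed.

Lemma mdvd_mulr p f g : mdvd p f -> mdvd p (f * g).
Proof. by rewrite mulrC; apply: mdvd_mull. Qed.

Lemma mdvdD p f g : mdvd p f -> mdvd p g -> mdvd p (f + g).
Proof. by move=> [q ->] [r ->]; exists (q + r); rewrite mulrDl. Qed.

Lemma mdvd_trans p f g : mdvd p f -> mdvd f g -> mdvd p g.
Proof. by move=> [q ->] [r ->]; exists (r * q); rewrite mulrA. Qed.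

Lemma mdvd_exp p j k : (j <= k)%N -> mdvd (p ^+ j) (p ^+ k).
Proof. by move=> jk; exists (p ^+ (k - j)); rewrite -exprD subnK. Qed.

Definition mprime p : Prop :=
  [/\ p != 0, ~ mdvd p 1 & forall f g, mdvd p (f * g) -> mdvd p f \/ mdvd p g].

Definition multiplicative_set P : Prop :=
  P 1 /\ (forall c d, P c -> P d -> P (c * d)).

(** The localization of [A] at [P], inside the fraction field. It serves for the complement of a
    prime, for the products of linear forms, and for the powers of one polynomial. *)
Definition sloc P v : Prop := exists2 c, P c & exists f, v * c%:F = f%:F.

Section Localization.
Variable P : A -> Prop.
Hypothesis mP : multiplicative_set P.

Lemma sloc_tofrac f : sloc P f%:F.
Proof. by exists 1; [exact: mP.1 | exists f; rewrite tofrac1 mulr1]. Qed.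

Lemma slocM v w : sloc P v -> sloc P w -> sloc P (v * w).
Proof.
move=> [c Pc [f E]] [d Pd [g E']]; exists (c * d); first exact: mP.2.
by exists (f * g); rewrite !tofracM -E -E' mulrACA.
Qed.

Lemma slocD v w : sloc P v -> sloc P w -> sloc P (v + w).
Proof.
move=> [c Pc [f E]] [d Pd [g E']]; exists (c * d); first exact: mP.2.
exists (f * d + g * c); rewrite tofracD !tofracM -E -E' mulrDl mulrA.
by congr (_ + _); rewrite (mulrC c%:F) mulrA.
Qed.

Lemma slocN v : sloc P v -> sloc P (- v).
Proof. by move=> [c Pc [f E]]; exists c => //; exists (- f); rewrite mulNr E tofracN. Qed.

Lemma slocB v w : sloc P v -> sloc P w -> sloc P (v - w).
Proof. by move=> Pv Pw; apply: slocD (slocN Pw). Qed.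

Lemma sloc0 : sloc P 0. Proof. by rewrite -tofrac0; apply: sloc_tofrac. Qed.

Lemma sloc1 : sloc P 1. Proof. by rewrite -tofrac1; apply: sloc_tofrac. Qed.

Lemma sloc_sum (I : Type) (r : seq I) (Q : pred I) (f : I -> {fraction A}) :
  (forall i, Q i -> sloc P (f i)) -> sloc P (\sum_(i <- r | Q i) f i).
Proof. by move=> pf; apply: (big_ind (sloc P)) => //; [exact: sloc0|exact: slocD]. Qed.

Lemma sloc_prod (I : Type) (r : seq I) (Q : pred I) (f : I -> {fraction A}) :
  (forall i, Q i -> sloc P (f i)) -> sloc P (\prod_(i <- r | Q i) f i).
Proof. by move=> pf; apply: (big_ind (sloc P)) => //; [exact: sloc1|exact: slocM]. Qed.

Lemma sloc_det n (M : 'M[{fraction A}]_n) :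
  (forall i j, sloc P (M i j)) -> sloc P (\det M).
Proof.
move=> PM; apply: sloc_sum => s _; apply: slocM.
  by rewrite -tofrac1 -tofracN -tofracXn; apply: sloc_tofrac.
by apply: sloc_prod => i _.
Qed.

Lemma sloc_cancel v c : c != 0 -> P c -> sloc P (v * c%:F) -> sloc P v.
Proof.
move=> c0 Pc [d Pd [f E]]; exists (c * d); first exact: mP.2.
by exists f; rewrite -E tofracM mulrA.
Qed.

End Localization.

Section Order.
Variable p : A.
Hypothesis pp : mprime p.

Lemma mprime_neq0 : p != 0. Proof. by case: pp. Qed.

Let pF0 : p%:F != 0 :> {fraction A}. Proof. by rewrite tofrac_eq0 mprime_neq0. Qed.

Lemma nmdvd_mult : multiplicative_set (fun c => ~ mdvd p c).
Proof. by case: pp => _ p1 pM; split=> // c d nc nd /pM[]. Qed.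

Lemma nmdvd_neq0 c : ~ mdvd p c -> c != 0.
Proof. by move=> nc; apply/eqP => c0; apply: nc; rewrite c0; apply: mdvd0. Qed.

Lemma nmdvdX c k : ~ mdvd p c -> ~ mdvd p (c ^+ k).
Proof.
move=> nc; elim: k => [|k IH]; first by rewrite expr0; case: pp.
by rewrite exprS => /(let: And3 _ _ pM := pp in pM _ _)[].
Qed.

Lemma mprime_expP k f g : ~ mdvd p g -> mdvd (p ^+ k) (f * g) -> mdvd (p ^+ k) f.
Proof.
move=> ng; elim: k f => [|k IH] f; first by exists f; rewrite expr0 mulr1.
rewrite exprSr => -[q E].
have : mdvd p (f * g) by rewrite E mulrA; apply/mdvd_mull/mdvd_refl.
case: pp => p0 _ pM /pM[[r Er]|//]; have : mdvd (p ^+ k) (r * g).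
  by exists q; apply: (mulIf p0); rewrite mulrAC -Er E mulrA.
by move=> /IH [s Es]; exists s; rewrite Er Es mulrA.
Qed.

(* [v] has order at least [k] along [p]. *)
Definition ordge (k : int) v := sloc (fun c => ~ mdvd p c) (v * p%:F ^ (- k)).

Let mP := nmdvd_mult.

Lemma ordge0E v : ordge 0 v <-> sloc (fun c => ~ mdvd p c) v.
Proof. by rewrite /ordge oppr0 expr0z mulr1. Qed.

Lemma ordge_tofrac f : ordge 0 f%:F.
Proof. by apply/ordge0E; apply: (sloc_tofrac mP). Qed.

Lemma ordge0 k : ordge k 0.
Proof. by rewrite /ordge mul0r; apply: (sloc0 mP). Qed.

Lemma ordgeD k v w : ordge k v -> ordge k w -> ordge k (v + w).
Proof. by rewrite /ordge mulrDl; apply: (slocD mP). Qed.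

Lemma ordgeN k v : ordge k v -> ordge k (- v).
Proof. by rewrite /ordge mulNr; apply: slocN. Qed.

Lemma ordgeB k v w : ordge k v -> ordge k w -> ordge k (v - w).
Proof. by move=> kv kw; apply: ordgeD (ordgeN kw). Qed.

Lemma ordgeM j k v w : ordge j v -> ordge k w -> ordge (j + k) (v * w).
Proof. by rewrite /ordge opprD expfzDr // mulrACA; apply: (slocM mP). Qed.

Lemma ordge_sum k (I : Type) (r : seq I) (Q : pred I) (f : I -> {fraction A}) :
  (forall i, Q i -> ordge k (f i)) -> ordge k (\sum_(i <- r | Q i) f i).
Proof.
by move=> pf; apply: (big_ind (ordge k)) => //; [exact: ordge0|exact: ordgeD].
Qed.

Lemma ordge_exp k : ordge k (p%:F ^ k).
Proof. by rewrite /ordge -expfzDr // subrr expr0z; apply: (sloc1 mP). Qed.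

Lemma ordge_self : ordge 1 p%:F.
Proof. by have := ordge_exp 1; rewrite expr1z. Qed.

Lemma ordge_tofracM k f v : ordge k v -> ordge k (f%:F * v).
Proof. by move=> kv; rewrite -[k]add0r; apply: ordgeM kv; apply: ordge_tofrac. Qed.

Lemma ordge_shift j k v : ordge (j + k) (p%:F ^ j * v) <-> ordge k v.
Proof.
split=> [H|]; last exact/ordgeM/ordge_exp.
have := ordgeM (ordge_exp (- j)) H; rewrite mulrA -expfzDr // addrA addNr.
by rewrite expr0z mul1r add0r.
Qed.

Lemma ordge_cancel k v g : ~ mdvd p g -> ordge k (v * g%:F) -> ordge k v.
Proof.
rewrite /ordge mulrAC => ng; apply: (sloc_cancel mP) => //.
exact: nmdvd_neq0.
Qed.

Lemma ordge_tofracP (k : nat) f : ordge k f%:F <-> mdvd (p ^+ k) f.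
Proof.
split=> [[c nc [g E]]|[q ->]]; last first.
  by rewrite tofracM tofracXn; apply: ordge_tofracM; apply: ordge_exp.
apply: (mprime_expP nc); exists g; apply: tofrac_inj.
rewrite !tofracM -E tofracXn -exprnN.
by rewrite -[RHS]mulrA [c%:F * _]mulrC [RHS]mulrA divfK ?expf_neq0.
Qed.

Lemma ordge_le (j k : int) v : (j <= k)%R -> ordge k v -> ordge j v.
Proof.
rewrite -subr_ge0; case E : (k - j) => [n|//] _.
rewrite -[k](subrK j) E addrC => H.
have := ordge_tofracM (p ^+ n) H; rewrite tofracXn.
rewrite [X in ordge X _](_ : _ = n%:Z + j); last by rewrite addrC.
by move=> /ordge_shift.
Qed.

End Order.
End Divisibility.

(** * Linear forms as primes, and orders of determinants *)

Section LinearForms.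
Variables (K : fieldType) (l : nat).
Notation S := {mpoly K[l]}.
Notation F := {fraction {mpoly K[l]}}.
Implicit Types (a b : 'cV[K]_l) (u v : 'rV[K]_l) (f g : S).

Definition lin a : S := \sum_i a i 0 *: 'X_i.

Lemma linD a b : lin (a + b) = lin a + lin b.
Proof. by rewrite /lin -big_split; apply: eq_bigr => i _; rewrite mxE scalerDl. Qed.

Lemma linZ c a : lin (c *: a) = c *: lin a.
Proof. by rewrite /lin scaler_sumr; apply: eq_bigr => i _; rewrite mxE scalerA. Qed.

Lemma linB a b : lin (a - b) = lin a - lin b.
Proof. by rewrite linD -scaleN1r linZ scaleN1r. Qed.

Lemma mderiv_lin a i : (lin a)^`M(i) = (a i 0)%:MP.
Proof.
rewrite /lin raddf_sum (bigD1 i) //= mderivZ mderivXU eqxx big1 ?addr0 => [|j ji].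
  by rewrite -mul_mpolyC mulr1.
by rewrite mderivZ mderivXU (negPf ji) scaler0.
Qed.

Lemma lin_inj : injective lin.
Proof.
move=> a b E; apply/colP => i; apply/(can_inj (@mpolyCK l K)).
by rewrite -!mderiv_lin E.
Qed.

Lemma lin0 : lin 0 = 0.
Proof. by rewrite /lin big1 // => i _; rewrite mxE scale0r. Qed.

Lemma lin_delta i : lin (delta_mx i 0) = 'X_i.
Proof.
rewrite /lin (bigD1 i) //= mxE !eqxx scale1r big1 ?addr0 // => j ji.
by rewrite mxE (negPf ji) scale0r.
Qed.

Lemma lin_homog a : lin a \is 1.-homog.
Proof. by apply: rpred_sum => i _; apply: rpredZ; rewrite dhomogX /= mdeg1. Qed.

Lemma lin_eq0 a : (lin a == 0) = (a == 0).
Proof. by rewrite -(inj_eq lin_inj) lin0. Qed.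

Lemma rmorph_mpoly_cong p (phi psi : {rmorphism S -> S}) :
  (forall c, phi c%:MP = c%:MP) -> (forall c, psi c%:MP = c%:MP) ->
  (forall i, mdvd p (phi 'X_i - psi 'X_i)) ->
  forall f, mdvd p (phi f - psi f).
Proof.
move=> phiC psiC E; apply: mpoly_alg_ind => // [c|f g Ef Eg|f g Ef Eg].
- by rewrite phiC psiC subrr; apply: mdvd0.
- by rewrite !rmorphD opprD addrACA; apply: mdvdD.
- rewrite !rmorphM (_ : _ - _ = (phi f - psi f) * phi g + psi f * (phi g - psi g)).
    by apply: mdvdD; [apply: mdvd_mulr | apply: mdvd_mull].
  by rewrite mulrBl mulrBr addrA subrK.
Qed.

Definition evalv u a : K := \sum_i u 0 i * a i 0.

Lemma evalvE u a : (u *m a) 0 0 = evalv u a.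
Proof. by rewrite mxE. Qed.

Lemma exists_evalv1 a : a != 0 -> exists u, evalv u a = 1.
Proof.
move=> a0; have [i ai] : exists i, a i 0 != 0.
  apply/existsP; apply: contraNT a0; rewrite negb_exists => /forallP a0.
  by apply/eqP/colP => i; rewrite mxE; apply/eqP; have := a0 i; rewrite negbK.
exists ((a i 0)^-1 *: delta_mx 0 i); rewrite /evalv (bigD1 i) //= !mxE !eqxx mulr1.
rewrite mulVf // big1 ?addr0 // => j ji.
by rewrite !mxE (negPf ji) mulr0 mul0r.
Qed.

Section Prime.
Variables (a : 'cV[K]_l) (u : 'rV[K]_l).
Hypothesis ua1 : evalv u a = 1.

(** Restriction to the hyperplane [a = 0], realized inside [S] by composition with the projection
    along [u]. Its kernel is the ideal of [lin a], which is therefore prime. *)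
Definition restr f : S := f \mPo [tuple 'X_i - (u 0 i) *: lin a | i < l].

HB.instance Definition _ := GRing.RMorphism.copy restr
  (comp_mpoly [tuple 'X_i - (u 0 i) *: lin a | i < l]).

Lemma restrX i : restr 'X_i = 'X_i - (u 0 i) *: lin a.
Proof. by rewrite /restr comp_mpolyXU -tnth_nth tnth_mktuple. Qed.

Lemma restrC c : restr c%:MP = c%:MP.
Proof. exact: comp_mpolyC. Qed.

Lemma restrZ c f : restr (c *: f) = c *: restr f.
Proof. exact: comp_mpolyZ. Qed.

Lemma restr_lin b : restr (lin b) = lin (b - evalv u b *: a).
Proof.
rewrite linB linZ {1}/lin raddf_sum /=.
under eq_bigr do rewrite restrZ restrX scalerBr scalerA.
rewrite sumrB -scaler_suml; congr (_ - _ *: _).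
by apply: eq_bigr => i _; rewrite mulrC.
Qed.

Lemma mdvd_linE f : mdvd (lin a) f <-> restr f = 0.
Proof.
split=> [[q ->]|f0].
  by rewrite rmorphM /= restr_lin ua1 scale1r subrr lin0 mulr0.
have : mdvd (lin a) (idfun f - restr f).
  apply: rmorph_mpoly_cong => // [c|i]; first by rewrite /= restrC.
  exists (u 0 i)%:MP.
  by rewrite /= restrX opprB addrC subrK mul_mpolyC.
by rewrite f0 subr0.
Qed.

Lemma lin_neq0 : lin a != 0.
Proof.
rewrite lin_eq0; apply/eqP => a0; have := ua1; rewrite a0 /evalv big1 => [/esym/eqP|].
  by rewrite oner_eq0.
by move=> i _; rewrite mxE mulr0.
Qed.

Lemma lin_prime_dual : mprime (lin a).
Proof.
split=> [||f g]; first exact: lin_neq0.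
  by rewrite mdvd_linE rmorph1 => /eqP; rewrite oner_eq0.
rewrite !mdvd_linE rmorphM => /eqP; rewrite mulf_eq0.
by move=> /orP[]/eqP; [left|right].
Qed.

End Prime.

Lemma lin_prime a : a != 0 -> mprime (lin a).
Proof. by move=> /exists_evalv1[u /lin_prime_dual]. Qed.

Lemma mdvd_lin_dec a f : a != 0 -> mdvd (lin a) f \/ ~ mdvd (lin a) f.
Proof.
move=> /exists_evalv1[u ua]; rewrite (mdvd_linE ua).
by have [|/eqP] := eqVneq (restr a u f) 0; [left|right].
Qed.

Lemma evalvZ c u a : evalv u (c *: a) = c * evalv u a.
Proof. by rewrite -!evalvE -scalemxAr !mxE. Qed.

Lemma mdvd_lin_ker a b : a != 0 ->
  mdvd (lin a) (lin b) <-> (forall v, evalv v a = 0 -> evalv v b = 0).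
Proof.
move=> /exists_evalv1[u ua]; rewrite (mdvd_linE ua) restr_lin; split=> [|ker].
  rewrite -lin0 => /lin_inj/eqP; rewrite subr_eq0 => /eqP-> v va.
  by rewrite evalvZ va mulr0.
suff -> : b - evalv u b *: a = 0 by rewrite lin0.
apply/colP => i; rewrite mxE [RHS]mxE.
have /ker : evalv (delta_mx 0 i - a i 0 *: u) a = 0.
  rewrite -evalvE mulmxBl -scalemxAl !mxE -/(evalv u a) ua mulr1.
  rewrite (bigD1 i) //= mxE !eqxx mul1r big1 ?addr0 ?subrr // => j ji.
  by rewrite mxE (negPf ji) mul0r.
rewrite -evalvE mulmxBl -scalemxAl !mxE -/(evalv u b) => <-; congr (_ + - _).
  rewrite (bigD1 i) //= mxE !eqxx mul1r big1 ?addr0 // => j ji.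
  by rewrite mxE (negPf ji) mul0r.
by rewrite mulrC.
Qed.

Lemma lin_multiplicity a f : a != 0 -> f != 0 ->
  exists k g, f = lin a ^+ k * g /\ ~ mdvd (lin a) g.
Proof.
move=> a0; have la0 : lin a != 0 by rewrite lin_eq0.
have : (1 < msize (lin a))%N.
  have [i ai] : exists i, a i 0 != 0.
    apply/existsP; apply: contraNT a0; rewrite negb_exists => /forallP a0.
    by apply/eqP/colP => i; rewrite mxE; apply/eqP; have := a0 i; rewrite negbK.
  rewrite -(mdeg1 i); apply: msize_mdeg_lt.
  rewrite mcoeff_msupp /lin raddf_sum (bigD1 i) //= mcoeffZ mcoeffXU eqxx mulr1.
  rewrite big1 ?addr0 // => j ji.
  by rewrite mcoeffZ mcoeffXU (negPf ji) mulr0.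
move=> s1; have [n] := ubnP (msize f); elim: n f => // n IH f.
rewrite ltnS => sn f0; have [[q E]|nd] := mdvd_lin_dec f a0; last first.
  by exists 0, f; rewrite expr0 mul1r.
have q0 : q != 0 by apply: contraNneq f0 => q0; rewrite E q0 mul0r.
have [|k [g [Eg ng]]] := IH q _ q0.
  apply: leq_trans sn; rewrite E msizeM //.
  by case: (msize (lin a)) s1 => [|[|s]] // _; rewrite !addnS /= ltnS leq_addr.
by exists k.+1, g; split=> //; rewrite E Eg exprS mulrC mulrA.
Qed.

Definition kfrac : {rmorphism K -> F} := (@tofrac S) \o (@mpolyC l K).

Lemma kfracE c : kfrac c = (c%:MP)%:F. Proof. by []. Qed.

Definition derv (delta : derF K l) a : F := \sum_i delta 0 i * kfrac (a i 0).

Lemma derF_app_lin delta a : derF_app delta (lin a) = derv delta a.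
Proof. by apply: eq_bigr => i _; rewrite mderiv_lin. Qed.

(** The block matrix with rows [(1, -c)] and [(r, 1)] is factored in two ways, by eliminating [r] or
    [-c]. *)
Lemma det_matrix1 (R : comNzRingType) n (c : 'cV[R]_n) (r : 'rV[R]_n) :
  \det (1%:M + c *m r) = 1 + (r *m c) 0 0.
Proof.
pose B := block_mx 1%:M (- c) r (1%:M : 'M_1).
have E1 : B = block_mx 1%:M 0 r 1%:M *m block_mx 1%:M (- c) 0 (1%:M + r *m c).
  rewrite mulmx_block !(mul1mx, mulmx1, mul0mx, mulmx0, addr0, add0r).
  by rewrite mulmxN addrCA addNr addr0.
have E2 : B = block_mx 1%:M (- c) 0 1%:M *m block_mx (1%:M + c *m r) 0 r 1%:M.
  rewrite mulmx_block !(mul1mx, mulmx1, mul0mx, mulmx0, addr0, add0r).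
  by rewrite mulNmx addrK.
have := congr1 determinant E1; rewrite E2 !det_mulmx !det_ublock !det_lblock !det1.
by rewrite !mul1r !mulr1 det_mx11 !mxE /= => ->.
Qed.

Section Lattice.
Variables (a : 'cV[K]_l) (u : 'rV[K]_l).
Hypothesis ua1 : evalv u a = 1.

(* The linear map which scales the line spanned by [u] by [c] and is the
   identity on the kernel of [a], acting on derivations. *)
Definition scale_mx (c : F) : 'M[F]_l :=
  1%:M + ((c - 1) *: map_mx kfrac a) *m map_mx kfrac u.

Lemma det_scale_mx c : \det (scale_mx c) = c.
Proof.
rewrite det_matrix1 -scalemxAr mxE -map_mxM mxE evalvE ua1 rmorph1 mulr1.
by rewrite addrC subrK.
Qed.

Lemma mul_scale_mxE c (M : 'M[F]_l) i j :
  (M *m scale_mx c) i j =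
  (M i j - derv (row i M) a * kfrac (u 0 j)) + c * (derv (row i M) a * kfrac (u 0 j)).
Proof.
rewrite mulmxDr mulmx1 mulmxA -scalemxAr -scalemxAl !mxE big_ord1 !mxE.
rewrite [X in (c - 1) * (X * _)](_ : _ = derv (row i M) a); last first.
  by apply: eq_bigr => k _; rewrite !mxE.
by rewrite mulrBl mul1r [_ - _ in LHS]addrC addrA.
Qed.

(** Right multiplication by the scaling of the [u]-line by [alpha^(-k)] makes all entries regular
    and multiplies the determinant by [alpha^(-k)]. *)
Lemma ordge_det (k : int) (M : 'M[F]_l) :
  (forall i, ordge (lin a) k (derv (row i M) a)) ->
  (forall i j, ordge (lin a) 0 (M i j - derv (row i M) a * kfrac (u 0 j))) ->
  ordge (lin a) k (\det M).
Proof.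
have pa := lin_prime_dual ua1.
move=> Ma Mj; have : ordge (lin a) 0 (\det (M *m scale_mx ((lin a)%:F ^ (- k)))).
  rewrite ordge0E; apply: (sloc_det (nmdvd_mult pa)) => i j; rewrite -ordge0E.
  rewrite mul_scale_mxE; apply: (ordgeD pa) => //.
  rewrite -[0](addNr k); apply/(ordge_shift pa); rewrite mulrC.
  by apply: (ordge_tofracM pa).
rewrite det_mulmx det_scale_mx mulrC -[0](addNr k).
by move/(ordge_shift pa).
Qed.

End Lattice.
End LinearForms.

(** * Linear actions on polynomials *)

Section Action.
Variables (K : fieldType) (l : nat) (gT : finGroupType) (W : {group gT}).
Variable rW : mx_representation K W l.
Notation S := {mpoly K[l]}.
Implicit Types (a b : 'cV[K]_l) (u v : 'rV[K]_l) (f : S) (g h s : gT).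

Notation act := (poly_act rW).

HB.instance Definition _ g := GRing.RMorphism.copy (poly_act rW g)
  (comp_mpoly [tuple \sum_(j < l) rW g j i *: 'X_j | i < l]).

Lemma poly_act_mul g : {morph act g : f q / f * q}.
Proof. exact: rmorphM. Qed.

Lemma poly_act_add g : {morph act g : f q / f + q}.
Proof. exact: rmorphD. Qed.

Lemma poly_act_sum g (I : Type) (r : seq I) (Q : pred I) (q : I -> S) :
  act g (\sum_(i <- r | Q i) q i) = \sum_(i <- r | Q i) act g (q i).
Proof. exact: rmorph_sum. Qed.

Lemma poly_actC g c : act g c%:MP = c%:MP.
Proof. exact: comp_mpolyC. Qed.

Lemma poly_actZ g c f : act g (c *: f) = c *: act g f.
Proof. exact: comp_mpolyZ. Qed.

Lemma poly_actX g i : act g 'X_i = lin (rW g *m delta_mx i 0).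
Proof.
rewrite /poly_act comp_mpolyXU -tnth_nth tnth_mktuple.
apply: eq_bigr => j _; congr (_ *: _); rewrite mxE (bigD1 i) //= mxE !eqxx mulr1.
by rewrite big1 ?addr0 // => k ki; rewrite mxE (negPf ki) mulr0.
Qed.

Lemma poly_act_lin g b : act g (lin b) = lin (rW g *m b).
Proof.
rewrite {1}/lin raddf_sum /=; under eq_bigr do rewrite poly_actZ poly_actX -linZ.
rewrite [in RHS](_ : b = \sum_i b i 0 *: delta_mx i 0).
  rewrite mulmx_sumr; elim/big_rec2: _ => [|i y1 y2 _ ->]; first by rewrite lin0.
  by rewrite linD scalemxAr.
apply/colP => i; rewrite summxE (bigD1 i) //= !mxE !eqxx mulr1 big1 ?addr0 // => j ji.
by rewrite !mxE eq_sym (negPf ji) mulr0.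
Qed.

Lemma poly_actM g h f : g \in W -> h \in W -> act g (act h f) = act (g * h)%g f.
Proof.
move=> Wg Wh; apply: (rmorph_mpoly_ext (phi := act g \o act h)) => [c|i] /=.
  by rewrite !poly_actC.
by rewrite -lin_delta !poly_act_lin repr_mxM // mulmxA.
Qed.

Lemma poly_act1 f : act 1%g f = f.
Proof.
apply: (rmorph_mpoly_ext (psi := idfun)) => [c|i] /=; first by rewrite poly_actC.
by rewrite -lin_delta poly_act_lin repr_mx1 mul1mx.
Qed.

Lemma poly_actK g : g \in W -> cancel (act g) (act g^-1%g).
Proof. by move=> Wg f; rewrite poly_actM ?groupV // mulVg poly_act1. Qed.

Lemma poly_actKV g : g \in W -> cancel (act g^-1%g) (act g).
Proof. by move=> Wg f; rewrite poly_actM ?groupV // mulgV poly_act1. Qed.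

Lemma poly_act_inj g : g \in W -> injective (act g).
Proof. by move/poly_actK/can_inj. Qed.

Lemma poly_act_homog g d f : f \is d.-homog -> act g f \is d.-homog.
Proof.
move=> /dhomogP fd; rewrite (mpolyE f) raddf_sum /=; rewrite big_seq.
apply: rpred_sum => m mf; rewrite poly_actZ; apply: rpredZ.
have <- := fd m mf; rewrite /= mpolyXE_id rmorph_prod mdegE.
apply: (big_rec2 (fun (p : S) k => p \is k.-homog)); first exact: dhomog1.
move=> i k p _ pk; apply: dhomogM => //.
by rewrite rmorphXn /= poly_actX -[X in X.-homog]mul1n; apply: dhomogMn; apply: lin_homog.
Qed.

(** For [a != 0] and faithful [rW], this group is non-trivial exactly if [a = 0] is a reflecting
    hyperplane, which is how the two kinds of linear forms are told apart. *)
Definition fixer a := rstab rW (kermx a).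

Canonical fixer_group a := [group of fixer a].

Lemma fixerP a g :
  reflect (g \in W /\ (forall v, evalv v a = 0 -> v *m rW g = v)) (g \in fixer a).
Proof.
rewrite inE; apply: (iffP andP) => -[Wg E]; split=> //.
  move=> v va; have : (v <= kermx a)%MS.
    by apply/sub_kermxP/matrixP => i j; rewrite !ord1 evalvE va mxE.
  by move=> /submxP[x ->]; rewrite -mulmxA (eqP E).
apply/eqP/row_matrixP => i; rewrite row_mul E // -evalvE.
by rewrite -row_mul mulmx_ker !mxE.
Qed.

Lemma fixer_sub a : fixer a \subset W. Proof. exact: rstab_sub. Qed.

Lemma fixer_in a g : g \in fixer a -> g \in W.
Proof. exact: subsetP (fixer_sub a) g. Qed.

Lemma fixer_cong a g f : a != 0 -> g \in fixer a -> mdvd (lin a) (act g f - f).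
Proof.
move=> a0 /fixerP[Wg gP].
apply: (rmorph_mpoly_cong (psi := idfun)) => // [c|i]; first exact: poly_actC.
rewrite /= -lin_delta poly_act_lin -linB; apply/mdvd_lin_ker => // v va.
by rewrite -evalvE mulmxBr mulmxA gP // subrr mxE.
Qed.

(** Since [s] acts trivially modulo [lin a], the identity [z^k s(q) = z^j q] becomes
    [(z^k - z^j) q = 0] there. Thus the eigenvalue of [f] determines its order [k] modulo the order
    of [z]. *)
Lemma semi_invariant a s z f (q : S) k j : a != 0 -> z != 0 -> s \in fixer a ->
  rW s *m a = z *: a -> act s f = z ^+ j *: f ->
  f = lin a ^+ k * q -> ~ mdvd (lin a) q ->
  z ^+ k = z ^+ j /\ act s q = q.
Proof.
move=> a0 z0 sa Esa Ef E nq.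
have la0 : lin a ^+ k != 0 by rewrite expf_neq0 // lin_eq0.
have E1 : z ^+ k *: act s q = z ^+ j *: q.
  apply: (mulfI la0); rewrite -[RHS]scalerAr -E -Ef E rmorphM rmorphXn /= poly_act_lin Esa linZ.
  by rewrite exprZn -scalerAl scalerAr.
have Ek : z ^+ k = z ^+ j.
  apply/eqP; rewrite eq_sym -subr_eq0; apply/negPn/negP => zkj; apply: nq.
  rewrite -[q](scalerK zkj) -mul_mpolyC; apply: mdvd_mull.
  rewrite scalerBl -E1 -scalerBr -mul_mpolyC; apply: mdvd_mull.
  exact: fixer_cong.
by split=> //; apply: (scalerI (expf_neq0 k z0)); rewrite E1 Ek.
Qed.

End Action.

(** * The invariant Hermitian form and the cyclic stabilizers of hyperplanes *)

Section Unitary.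
Variables (K : numClosedFieldType) (l : nat) (gT : finGroupType) (W : {group gT}).
Variable rW : mx_representation K W l.
Implicit Types (a b : 'cV[K]_l) (u v w : 'rV[K]_l) (g h s : gT).

(** The standard Hermitian form averaged over [W], without the factor [1/|W|]. *)
Definition wform v w : K :=
  \sum_(h in W) \sum_i (v *m rW h) 0 i * ((w *m rW h) 0 i)^*.

Lemma wform_inv g v w : g \in W -> wform (v *m rW g) (w *m rW g) = wform v w.
Proof.
move=> Wg; rewrite /wform [RHS](reindex_inj (mulgI g)) /=.
rewrite [RHS](eq_bigl (fun h => h \in W)) => [|h]; last exact: groupMl.
by apply: eq_bigr => h Wh; rewrite -!mulmxA -repr_mxM.
Qed.

Lemma wformDl v v' w : wform (v + v') w = wform v w + wform v' w.
Proof.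
rewrite /wform -big_split; apply: eq_bigr => h _ /=; rewrite -big_split.
by apply: eq_bigr => i _; rewrite mulmxDl mxE mulrDl.
Qed.

Lemma wformZl c v w : wform (c *: v) w = c * wform v w.
Proof.
rewrite /wform mulr_sumr; apply: eq_bigr => h _ /=; rewrite mulr_sumr.
by apply: eq_bigr => i _; rewrite -scalemxAl mxE mulrA.
Qed.

Lemma wformC v w : wform w v = (wform v w)^*.
Proof.
rewrite /wform rmorph_sum; apply: eq_bigr => h _ /=; rewrite rmorph_sum.
by apply: eq_bigr => i _ /=; rewrite rmorphM /= conjCK mulrC.
Qed.

Lemma wformDr v w w' : wform v (w + w') = wform v w + wform v w'.
Proof. by rewrite !(wformC _ v) wformDl rmorphD. Qed.

Lemma wformZr c v w : wform v (c *: w) = c^* * wform v w.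
Proof. by rewrite !(wformC _ v) wformZl rmorphM. Qed.

Lemma wform_eq0 v : wform v v = 0 -> v = 0.
Proof.
have ge0 h : h \in W -> 0 <= \sum_i (v *m rW h) 0 i * ((v *m rW h) 0 i)^*.
  by move=> _; apply: sumr_ge0 => i _; rewrite -normCK exprn_ge0.
move=> /eqP; rewrite /wform psumr_eq0 // => /allP/(_ 1%g).
rewrite mem_index_enum group1 => /(_ isT).
rewrite psumr_eq0 => [|i _]; last by rewrite -normCK exprn_ge0.
move=> /allP v0; apply/rowP => i; have := v0 i; rewrite mem_index_enum => /(_ isT).
by rewrite -normCK repr_mx1 mulmx1 expf_eq0 normr_eq0 mxE => /eqP.
Qed.

Lemma wform_fixed_ortho s z u v : s \in W -> z != 1 ->
  u *m rW s = z *: u -> v *m rW s = v -> wform v u = 0.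
Proof.
move=> Ws z1 us vs; have := wform_inv v u Ws; rewrite us vs wformZr.
move=> /eqP; rewrite -subr_eq0 -[X in _ - X]mul1r -mulrBl mulf_eq0.
rewrite -(rmorph1 Num.conj) -rmorphB fmorph_eq0 subr_eq0 (negPf z1).
by move=> /eqP.
Qed.

(** On the moment curve [(1, k, k^2, ...)] each [w i] becomes a non-zero polynomial in [k], and the
    product of these has finitely many roots. *)
Lemma avoid_hyperplanes (I : finType) (P : pred I) (w : I -> 'rV[K]_l) :
  (forall i, P i -> w i != 0) -> exists c, forall i, P i -> evalv (w i) c != 0.
Proof.
move=> w0; pose p := \prod_(i | P i) rVpoly (w i).
have p0 : p != 0.
  apply/prodf_neq0 => i Pi; apply: contra (w0 i Pi) => /eqP r0.
  by rewrite -(rVpolyK (w i)) r0 linear0.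
have [k pk] : exists k : nat, ~~ root p k%:R.
  pose rs : seq K := [seq k%:R | k <- iota 0 (size p)].
  have rs_uniq : uniq rs.
    by rewrite map_inj_uniq ?iota_uniq // => i j /eqP; rewrite eqr_nat => /eqP.
  have : ~~ all (root p) rs.
    apply/negP => /(max_poly_roots p0)/(_ rs_uniq).
    by rewrite size_map size_iota ltnn.
  by rewrite -has_predC => /hasP[x /mapP[k _ ->]]; exists k.
exists (\col_i k%:R ^+ i) => i Pi.
move: pk; rewrite /root horner_prod => /prodf_neq0/(_ i Pi).
rewrite horner_poly /evalv; congr (_ != _).
by apply: eq_bigr => j _; rewrite valK mxE.
Qed.

Lemma fixer_scalar a v0 g : evalv v0 a = 1 -> g \in fixer rW a ->
  rW g *m a = evalv (v0 *m rW g) a *: a /\ forall v, v *m rW g = v + evalv v a *: (v0 *m rW g - v0).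
Proof.
move=> va /fixerP[Wg gP].
have gE v : v *m rW g = v + evalv v a *: (v0 *m rW g - v0).
  have /gP E : evalv (v - evalv v a *: v0) a = 0.
    by rewrite -evalvE mulmxBl -scalemxAl !mxE -!/(evalv _ a) va mulr1 subrr.
  apply/eqP; rewrite scalerBr addrA addrAC -subr_eq scalemxAl -mulmxBl.
  by rewrite E.
split=> //; apply/colP => i; rewrite [RHS]mxE.
have := congr1 (fun v => evalv v a) (gE (delta_mx 0 i)).
rewrite -!evalvE -mulmxA -rowE mxE => ->.
rewrite mulmxDl -scalemxAl mulmxBl !mxE -!/(evalv _ a) va.
rewrite (_ : evalv (delta_mx 0 i) a = a i 0); last first.
  by rewrite -evalvE -rowE mxE.
by rewrite mulrBr mulr1 addrC subrK mulrC.
Qed.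

(** [s] generates the pointwise stabilizer of the hyperplane, [z] is its eigenvalue other than 1,
    and [u] is the eigenvector for [z] normalized by [a(u) = 1]. *)
Record reflection_data a s u z : Prop := ReflectionData {
  rd_dual : evalv u a = 1;
  rd_fixer : s \in fixer rW a;
  rd_gen : fixer rW a = <[s]>%g;
  rd_mx : rW s = 1%:M + (z - 1) *: (a *m u);
  rd_prim : #|fixer rW a|.-primitive_root z;
  rd_neq1 : z != 1 }.

(** The fixer acts on the quotient by the hyperplane through a character [chi]. An element of its
    kernel is the identity or a transvection, and the latter has infinite order in characteristic 0.
    So [chi] is faithful and the fixer, a finite group embedded in [K^*], is cyclic. *)
Lemma fixer_reflection_data a : mx_faithful rW -> a != 0 -> fixer rW a :!=: 1%g ->
  exists s u z, reflection_data a s u z.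
Proof.
move=> faith a0 nt1; have [v0 va] := exists_evalv1 a0.
pose chi g := evalv (v0 *m rW g) a.
have chiM : {in fixer rW a &, {morph chi : g h / (g * h)%g >-> g * h}}.
  move=> g h ga ha; rewrite /chi repr_mxM ?(fixer_in ga, fixer_in ha) //.
  have [Eh _] := fixer_scalar va ha.
  by rewrite mulmxA -evalvE -mulmxA Eh -scalemxAr mxE evalvE mulrC.
have chi1 : {in fixer rW a, forall g, chi g = 1 <-> g = 1%g}.
  move=> g ga; split=> [cg|->]; last by rewrite /chi repr_mx1 mulmx1.
  have [_ gE] := fixer_scalar va ga; case/fixerP: (ga) => Wg gP.
  set w := v0 *m rW g - v0 in gE.
  have wa : evalv w a = 0.
    by rewrite -evalvE mulmxBl !mxE -!/(evalv _ a) -/(chi g) cg va subrr.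
  have gX k : v0 *m rW (g ^+ k)%g = v0 + k%:R *: w.
    elim: k => [|k IH]; first by rewrite expg0 repr_mx1 mulmx1 scale0r addr0.
    rewrite expgSr repr_mxM ?groupX // mulmxA IH mulmxDl -scalemxAl (gP w wa).
    by rewrite [v0 *m _]gE va scale1r mulrSr scalerDl scale1r -addrA [w + _]addrC.
  have := gX #[g]%g; rewrite expg_order repr_mx1 mulmx1 => /eqP.
  rewrite -subr_eq0 opprD addrA subrr add0r oppr_eq0 scaler_eq0 pnatr_eq0.
  rewrite (gtn_eqF (order_gt0 g)) => /eqP w0; apply: (mx_faithful_inj faith) => //.
  apply/row_matrixP => i; rewrite !rowE gE w0 scaler0 addr0 repr_mx1.
  by rewrite mulmx1.
have /cyclicP[s Es] : cyclic (fixer rW a) by exact: field_mul_group_cyclic chiM chi1.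
have sa : s \in fixer rW a by rewrite Es cycle_id.
have chiX k : chi (s ^+ k)%g = chi s ^+ k.
  elim: k => [|k IH]; first by rewrite expr0; apply: (chi1 _ (group1 _)).2.
  by rewrite expgS chiM ?groupX // IH exprS.
have z1 : chi s != 1.
  by apply: contra nt1 => /eqP/(chi1 s sa) s1; rewrite Es s1 cycle1.
(* The image of [s - 1] is a line; [u] is the vector [(v0 s - v0) / (chi s - 1)] on it, on which [a]
   takes the value 1. *)
pose u := v0 + (chi s - 1)^-1 *: (v0 *m rW s - v0 - (chi s - 1) *: v0).
have [_ sE] := fixer_scalar va sa.
have z1' : chi s - 1 != 0 by rewrite subr_eq0.
have uE : u = (chi s - 1)^-1 *: (v0 *m rW s - v0).
  by rewrite /u scalerBr scalerA mulVf // scale1r addrC subrK.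
exists s, u, (chi s); split=> //.
- rewrite uE -evalvE -scalemxAl mulmxBl !mxE -!/(evalv _ a) va -/(chi s).
  by rewrite mulVf.
- apply/row_matrixP => i; rewrite !rowE sE mulmxDr mulmx1 -scalemxAr mulmxA.
  congr (_ + _); rewrite uE -scalemxAr scalerA divff // scale1r.
  rewrite [delta_mx _ _ *m a](_ : _ = (evalv (delta_mx 0 i) a)%:M).
    by rewrite mul_scalar_mx.
  by apply/matrixP => x y; rewrite !ord1 evalvE mxE eqxx.
- have e0 : (0 < #|fixer rW a|)%N by apply: cardG_gt0.
  have : chi s ^+ #|fixer rW a| = 1 
    by rewrite -chiX; apply: (chi1 _ (groupX _ sa)).2; rewrite Es expg_order.
  move=> /(prim_order_exists e0)[k pk ke].
  have /(chi1 _ (groupX k sa))/eqP : chi (s ^+ k)%g = 1.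
    by rewrite chiX prim_expr_order.
  rewrite -order_dvdn orderE -Es => ek.
  by have /eqP -> : #|fixer rW a| == k by rewrite eqn_dvd ek ke.
Qed.

End Unitary.

(** * Invariant derivations *)

Section PolynomialDerivations.
Variables (K : fieldType) (l : nat).
Notation S := {mpoly K[l]}.
Implicit Types (theta : derS K l) (f g : S).

Lemma der_app_additive theta : additive (der_app theta).
Proof.
move=> f g; rewrite /der_app -sumrB; apply: eq_bigr => i _.
by rewrite mderivB mulrBr.
Qed.

HB.instance Definition _ theta :=
  GRing.isAdditive.Build S S (der_app theta) (der_app_additive theta).

Lemma der_appE theta f : (der_app theta f)%:F = derF_app (to_derF theta) f.
Proof.
rewrite /der_app rmorph_sum; apply: eq_bigr => i _ /=.
by rewrite rmorphM /= mxE.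
Qed.

Lemma der_appM theta f g : der_app theta (f * g) = der_app theta f * g + f * der_app theta g.
Proof.
apply: tofrac_inj; rewrite tofracD (tofracM _ g) (tofracM f) !der_appE.
exact: derF_appM.
Qed.

Lemma der_appC theta c : der_app theta c%:MP = 0.
Proof. by apply: tofrac_inj; rewrite der_appE derF_appC tofrac0. Qed.

Lemma der_appX theta i : der_app theta 'X_i = theta 0 i.
Proof. by apply: tofrac_inj; rewrite der_appE derF_appX mxE. Qed.

Lemma der_appZ theta c f : der_app theta (c *: f) = c *: der_app theta f.
Proof. by rewrite -!mul_mpolyC der_appM der_appC mul0r add0r. Qed.

Lemma der_appZl h theta f : der_app (h *: theta) f = h * der_app theta f.
Proof. by rewrite /der_app mulr_sumr; apply: eq_bigr => i _; rewrite mxE mulrA. Qed.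

Lemma der_app_lin theta (a : 'cV[K]_l) : der_app theta (lin a) = \sum_i theta 0 i * (a i 0)%:MP.
Proof. by rewrite /der_app; under eq_bigr do rewrite mderiv_lin. Qed.

Lemma der_app_homog theta f p d : pdeg_is p theta -> f \is d.+1.-homog ->
  der_app theta f \is (p + d).-homog.
Proof.
move=> tp fd; apply: rpred_sum => i _; apply: dhomogM => //.
apply/dhomogP => m; rewrite mcoeff_msupp mcoeff_deriv => nz.
have : (m + U_(i))%MM \in msupp f.
  by rewrite mcoeff_msupp; apply: contraNneq nz => ->; rewrite mul0rn.
by move=> /(dhomog_mf fd) /=; rewrite mdegD mdeg1 addn1 => -[].
Qed.

End PolynomialDerivations.

Section Invariants.
Variables (K : fieldType) (l : nat) (gT : finGroupType) (W : {group gT}).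
Variable rW : mx_representation K W l.
Notation S := {mpoly K[l]}.
Notation F := {fraction {mpoly K[l]}}.
Implicit Types (theta psi : derS K l) (f y : S) (g h : gT).
Notation act := (poly_act rW).

Lemma inv_derP theta :
  (forall g i, g \in W -> der_app theta (act g 'X_i) = act g (theta 0 i)) ->
  inv_der rW theta.
Proof.
move=> E g f Wg.
have d1 : derivation (act g) (fun f => der_app theta (act g f)).
  split=> a b; first by rewrite poly_act_add raddfD.
    by rewrite poly_act_mul der_appM.
have d2 : derivation (act g) (fun f => act g (der_app theta f)).
  split=> a b; first by rewrite raddfD poly_act_add.
    by rewrite der_appM poly_act_add !poly_act_mul.
rewrite (derivation_mpoly d1) => [|c]; last by rewrite poly_actC der_appC.
rewrite [RHS](derivation_mpoly d2) => [|c]; last by rewrite der_appC rmorph0.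
by apply: eq_bigr => i _ /=; rewrite (E g i Wg) der_appX.
Qed.

Definition trace f : S := \sum_(g in W) act g f.

Lemma invariant_trace f : invariant rW (trace f).
Proof.
move=> g Wg; rewrite /trace poly_act_sum [RHS](reindex_inj (mulgI g)) /=.
apply: eq_big => [h|h Wh]; first by rewrite groupMl.
by rewrite (poly_actM rW _ Wg Wh).
Qed.

Definition trace_der psi : derS K l :=
  \row_i \sum_(g in W) act g (der_app psi (act g^-1%g 'X_i)).

Lemma trace_derE psi f :
  der_app (trace_der psi) f = \sum_(g in W) act g (der_app psi (act g^-1%g f)).
Proof.
have d : derivation idfun (fun f => \sum_(g in W) act g (der_app psi (act g^-1%g f))).
  split=> a b /=.
    rewrite -big_split; apply: eq_bigr => g _ /=.
    by rewrite poly_act_add raddfD poly_act_add.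
  rewrite mulr_suml mulr_sumr -big_split; apply: eq_bigr => g Wg /=.
  by rewrite poly_act_mul der_appM poly_act_add !poly_act_mul !(poly_actKV rW Wg).
rewrite (derivation_mpoly d) => [|c]; last first.
  by rewrite big1 // => g _; rewrite poly_actC der_appC rmorph0.
by apply: eq_bigr => i _; rewrite mxE mulrC.
Qed.

Lemma inv_der_trace psi : inv_der rW (trace_der psi).
Proof.
move=> g f Wg; rewrite !trace_derE poly_act_sum [LHS](reindex_inj (mulgI g)) /=.
apply: eq_big => [h|h]; first exact: groupMl.
rewrite (groupMl _ Wg) => Wh; have Wgh : (g * h)^-1%g \in W by rewrite groupV groupM.
by rewrite (poly_actM rW _ Wgh Wg) (poly_actM rW _ Wg Wh) invMg -mulgA mulVg mulg1.
Qed.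

(** * Interpolation over the orbit of a polynomial *)

Section Lagrange.
Variable f : S.

Definition orb : seq S := undup [seq act g f | g <- enum W].

Lemma mem_orb r : reflect (exists2 g, g \in W & r = act g f) (r \in orb).
Proof.
rewrite mem_undup; apply: (iffP mapP) => -[g]; first by rewrite mem_enum; exists g.
by move=> Wg ->; exists g => //; rewrite mem_enum.
Qed.

Lemma orb_self : f \in orb.
Proof. by apply/mem_orb; exists 1%g; rewrite ?group1 ?poly_act1. Qed.

Lemma orb_uniq : uniq orb. Proof. exact: undup_uniq. Qed.

Lemma perm_orb g : g \in W -> perm_eq (map (act g) orb) orb.
Proof.
move=> Wg; apply: uniq_perm; rewrite ?map_inj_uniq ?orb_uniq //.
  exact: (poly_act_inj Wg).
move=> r; apply/mapP/mem_orb => [[_ /mem_orb[h Wh ->] ->]|[h Wh ->]].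
  by exists (g * h)%g; [exact: groupM | exact: poly_actM].
have Wgh : (g^-1 * h)%g \in W by rewrite groupM ?groupV.
exists (act (g^-1 * h)%g f); first by apply/mem_orb; exists (g^-1 * h)%g.
by rewrite (poly_actM rW _ Wg Wgh) mulKVg.
Qed.

Definition cofactor_poly : {poly S} := \prod_(r <- orb | r != f) ('X - r%:P).

Definition orb_diff : S := \prod_(r <- orb | r != f) (f - r).

(** Applying [g] to the coefficients replaces the omitted root [f] by [g f]; the root [f] is then
    present unless [g] fixes [f]. *)
Lemma cofactor_poly_act g : g \in W ->
  (map_poly (act g) cofactor_poly).[f] = if act g f == f then orb_diff else 0.
Proof.
move=> Wg; rewrite rmorph_prod horner_prod /=.
under eq_bigr do rewrite rmorphB /= map_polyX map_polyC hornerXsubC.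
case: eqP => [gf|/eqP gf].
  rewrite /orb_diff -[RHS](perm_big _ (perm_orb Wg)) big_map /=.
  by apply: eq_bigl => r; rewrite -{2}gf (inj_eq (poly_act_inj Wg)).
have r0 : act g^-1%g f \in orb by apply/mem_orb; exists g^-1%g; rewrite ?groupV.
have nr : act g^-1%g f != f by apply: contra gf => /eqP E; rewrite -{1}E poly_actKV.
by rewrite (big_rem _ r0) /= nr poly_actKV // subrr mul0r.
Qed.

(* Lagrange interpolation at the points of the orbit of [f]. *)
Lemma sum_cofactor_poly g : g \in W ->
  \sum_(k < size cofactor_poly) f ^+ k * act g cofactor_poly`_k =
  if act g f == f then orb_diff else 0.
Proof.
move=> Wg; rewrite -cofactor_poly_act // (@horner_coef_wide _ (size cofactor_poly)).
  by apply: eq_bigr => k _; rewrite coef_map mulrC.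
exact: size_poly.
Qed.

Definition stab_size : nat := #|[pred g in W | act g f == f]|.

(** The interpolation identity for [g], multiplied by [g y], is summed over [W]. Up to the factor
    [orb_diff], [y] becomes a polynomial in [f] with invariant coefficients. *)
Lemma lagrange_trace y : (forall g, g \in W -> act g f = f -> act g y = y) ->
  \sum_(k < size cofactor_poly) f ^+ k * trace (cofactor_poly`_k * y) =
  (orb_diff * y) *+ stab_size.
Proof.
move=> yP; rewrite /trace; under eq_bigr do rewrite mulr_sumr.
rewrite exchange_big /=.
transitivity (\sum_(g in W) if act g f == f then orb_diff * y else 0).
  apply: eq_bigr => g Wg.
  under eq_bigr do rewrite poly_act_mul mulrA.
  rewrite -mulr_suml sum_cofactor_poly //.
  by case: eqP => [/(yP g Wg)->|_] //; rewrite mul0r.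
by rewrite -big_mkcondr /= sumr_const.
Qed.

(** The same summation for a field commuting with the stabilizer of [f]; up to [orb_diff], it puts
    [psi] into the [S]-span of invariant fields. *)
Lemma lagrange_trace_der psi :
  (forall g, g \in W -> act g f = f ->
     forall y, der_app psi (act g y) = act g (der_app psi y)) ->
  \sum_(k < size cofactor_poly) f ^+ k *: trace_der (cofactor_poly`_k *: psi) =
  (orb_diff *+ stab_size) *: psi.
Proof.
move=> psiP; apply/rowP => i; rewrite summxE [RHS]mxE.
under eq_bigr do rewrite !mxE mulr_sumr.
rewrite exchange_big /=.
transitivity (\sum_(g in W) if act g f == f then orb_diff * psi 0 i else 0).
  apply: eq_bigr => g Wg.
  under eq_bigr do rewrite der_appZl poly_act_mul mulrA.
  rewrite -mulr_suml sum_cofactor_poly //.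
  case: eqP => [gf|_]; last by rewrite mul0r.
  by rewrite -psiP // poly_actKV // der_appX.
by rewrite -big_mkcondr /= sumr_const mulrnAl.
Qed.

Lemma cofactor_poly_homog k : f \is 1.-homog -> (k < size cofactor_poly)%N ->
  cofactor_poly`_k \is (size cofactor_poly - k.+1).-homog.
Proof.
move=> f1; rewrite /cofactor_poly -big_filter.
have : all (fun r : S => r \is 1.-homog) (filter (fun r => r != f) orb).
  apply/allP => r; rewrite mem_filter => /andP[_ /mem_orb[g _ ->]].
  exact: poly_act_homog.
elim: (filter _ _) k => [|r s IH] k /=.
  rewrite big_nil size_poly1 ltnS leqn0 => _ /eqP ->.
  by rewrite coef1 eqxx; apply: dhomog1.
move=> /andP[r1 sP]; rewrite big_cons size_Mmonic ?monic_prod_XsubC //; last first.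
  by rewrite polyXsubC_eq0.
rewrite size_XsubC addSn add1n -!pred_Sn => kN.
rewrite mulrBl coefB coefXM coefCM subSS; apply: rpredB.
  case: k kN => [|k] kN; first exact: dhomog0.
  by apply: IH => //.
have [ks|sk] := ltnP k (size (\prod_(j <- s) ('X - j%:P))); last first.
  by rewrite nth_default // mulr0; apply: dhomog0.
rewrite -(subnSK ks) -add1n; apply: dhomogM => //.
exact: IH.
Qed.

Definition orb_poly : {poly S} := \prod_(r <- orb) ('X - r%:P).

Lemma orb_polyE : orb_poly = ('X - f%:P) * cofactor_poly.
Proof. by rewrite /orb_poly (bigD1_seq f) ?orb_self ?orb_uniq. Qed.

Lemma orb_poly_root : orb_poly.[f] = 0.
Proof. by rewrite orb_polyE hornerM hornerXsubC subrr mul0r. Qed.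

Lemma orb_poly_deriv : orb_poly^`().[f] = orb_diff.
Proof.
rewrite orb_polyE derivM derivXsubC mul1r hornerD hornerM hornerXsubC subrr mul0r.
rewrite addr0 horner_prod; apply: eq_bigr => r _; exact: hornerXsubC.
Qed.

Lemma orb_poly_inv k : invariant rW orb_poly`_k.
Proof.
move=> g Wg; rewrite -coef_map rmorph_prod /=.
under eq_bigr do rewrite rmorphB /= map_polyX map_polyC.
by rewrite /orb_poly -[in RHS](perm_big _ (perm_orb Wg)) big_map.
Qed.

End Lagrange.

Section Integrality.
Variables (delta : derF K l) (P : S -> Prop).
Hypothesis delta_inv : forall r, invariant rW r -> exists z, derF_app delta r = z%:F.
Hypothesis mP : multiplicative_set P.
Hypothesis char0 : forall n, n.+1%:R != 0 :> K.

(** In the chain rule for [delta(p(f))], the difference in question is obtained by applying [delta]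
    to the coefficients of [p] only. *)
Lemma derF_app_horner (p : {poly S}) f :
  (forall k, sloc P (derF_app delta p`_k)) ->
  sloc P (derF_app delta p.[f] - p^`().[f]%:F * derF_app delta f).
Proof.
elim/poly_ind: p => [|p c IH] pP.
  by rewrite deriv0 !horner0 raddf0 tofrac0 mul0r subr0; apply: (sloc0 mP).
have pP' k : sloc P (derF_app delta p`_k).
  by have := pP k.+1; rewrite coefD coefMX coefC addr0.
have cP : sloc P (derF_app delta c).
  by have := pP 0; rewrite coefD coefMX coefC add0r.
rewrite derivD derivM derivX derivC mulr1 addr0 !hornerE raddfD /= derF_appM.
rewrite tofracD tofracM.
have E (L : comPzRingType) (A B C D x d : L) :
  A * x + B * d + C - (D * x + B) * d = (A - D * d) * x + C by ring.
rewrite E; apply: (slocD mP) => //.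
by apply: (slocM mP); [exact: IH | exact: sloc_tofrac].
Qed.

(** [f] is a root of [orb_poly f], whose coefficients are invariant and whose derivative at [f] is
    [orb_diff f]; this bounds the denominator of [delta f]. By interpolation [orb_diff f] times [y]
    is a polynomial in [f] with invariant coefficients. *)
Lemma derF_app_integral f y : P (orb_diff f) -> orb_diff f != 0 ->
  (forall g, g \in W -> act g f = f -> act g y = y) ->
  sloc P (derF_app delta y).
Proof.
move=> PD D0 yP.
have invP r : invariant rW r -> sloc P (derF_app delta r).
  by move=> /delta_inv[z ->]; apply: sloc_tofrac.
have fP : sloc P (derF_app delta f).
  apply: (sloc_cancel mP D0 PD).
  have := @derF_app_horner (orb_poly f) f (fun k => invP _ (@orb_poly_inv f k)).
  by rewrite orb_poly_root orb_poly_deriv raddf0 sub0r => /slocN; rewrite opprK mulrC.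
have DyP z : (forall g, g \in W -> act g f = f -> act g z = z) ->
    sloc P (derF_app delta (orb_diff f * z)).
  move=> zP; have n0 : (stab_size f)%:R != 0 :> K.
    case E : (stab_size f) => [|n]; last exact: char0.
    have := fintype.card0_eq E 1%g.
    by rewrite !inE group1 poly_act1 eqxx.
  have -> : orb_diff f * z = ((stab_size f)%:R^-1 : K) *:
      \sum_(k < size (cofactor_poly f)) f ^+ k * trace ((cofactor_poly f)`_k * z).
    by rewrite lagrange_trace // -scaler_nat scalerA mulVf ?scale1r.
  rewrite -mul_mpolyC derF_appM derF_appC mul0r add0r.
  apply: (slocM mP); first exact: sloc_tofrac.
  rewrite raddf_sum; apply: (sloc_sum mP) => k _ /=; rewrite derF_appM.
  apply: (slocD mP); apply: (slocM mP); try exact: sloc_tofrac; last first.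
    by apply: invP; apply: invariant_trace.
  elim: (k : nat) => [|j IH].
    by rewrite expr0 -mpolyC1 derF_appC; apply: (sloc0 mP).
  rewrite exprS derF_appM.
  by apply: (slocD mP); apply: (slocM mP) => //; apply: sloc_tofrac.
(* With [Delta = orb_diff f], [Delta delta(y)] is [delta(Delta y) - delta(Delta) y]; [DyP] covers
   both terms, the second one with 1 in place of [y]. *)
apply: (sloc_cancel mP D0 PD).
have := DyP y yP; rewrite derF_appM => H.
have := DyP 1 (fun g _ _ => rmorph1 _); rewrite mulr1 => H1.
rewrite mulrC -[X in sloc P X](addKr (derF_app delta (orb_diff f) * y%:F)).
by rewrite addrC; apply: (slocB mP) => //; apply: (slocM mP) => //; apply: sloc_tofrac.
Qed.

End Integrality.
End Invariants.

Lemma mulr_swap4 (A : comPzRingType) (u b x c : A) :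
  b * (u * x) * c = u * c * x * b.
Proof. by ring. Qed.

Lemma mulr_swap5 (A : comPzRingType) (u q b x c : A) :
  u * q * (b * x) * c = u * c * q * x * b.
Proof. by ring. Qed.

Lemma mulr_swap5b (A : comPzRingType) (u p b q x : A) :
  u * (p * b * q) * x = p * (u * q * (b * x)).
Proof. by ring. Qed.

(** * Products of linear forms as denominators *)

Section LinearProducts.
Variables (K : fieldType) (l : nat).
Notation S := {mpoly K[l]}.
Notation F := {fraction {mpoly K[l]}}.
Implicit Types (a b : 'cV[K]_l) (f g w : S) (u : F) (s : seq 'cV[K]_l).

Definition lin_product f : Prop :=
  exists2 s : seq 'cV[K]_l, (forall b, b \in s -> b != 0) & f = \prod_(b <- s) lin b.

Lemma lin_product_mult : multiplicative_set lin_product.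
Proof.
split; first by exists [::]; rewrite ?big_nil.
move=> f g [s sP ->] [r rP ->]; exists (s ++ r); last by rewrite big_cat.
by move=> b; rewrite mem_cat => /orP[/sP|/rP].
Qed.

Lemma lin_product_exp f k : lin_product f -> lin_product (f ^+ k).
Proof.
have [P1 PM] := lin_product_mult; move=> Pf.
by elim: k => [|k IH]; rewrite ?expr0 // exprS; apply: PM.
Qed.

Lemma lin_product_clear s u f : (forall b, b \in s -> b != 0 /\ ordge (lin b) 0 u) ->
  u * (\prod_(b <- s) lin b)%:F = f%:F -> exists z, u = z%:F.
Proof.
elim: s f => [|b s IH] f sP; first by rewrite big_nil tofrac1 mulr1; exists f.
rewrite big_cons tofracM mulrCA => E.
have [b0 /ordge0E[c nc [g Eg]]] := sP b (mem_head _ _).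
have [p0 _ pM] := lin_prime b0.
have : mdvd (lin b) (f * c).
  exists (g * \prod_(b <- s) lin b); apply: tofrac_inj.
  rewrite (tofracM f) -E !tofracM -Eg.
  exact: mulr_swap4.
case/pM=> // -[q Eq]; apply: (IH q) => [d sd|].
  by apply: sP; rewrite inE sd orbT.
have pF0 : (lin b)%:F != 0 :> F by rewrite tofrac_eq0.
by apply: (mulfI pF0); rewrite E Eq tofracM mulrC.
Qed.

(** Each prime on the right divides [g w] but not [g], so it can be cancelled from [w], until [g] is
    a unit. *)
Lemma lin_product_unit s g w : (forall b, b \in s -> b != 0 /\ ~ mdvd (lin b) g) ->
  g * w = \prod_(b <- s) lin b -> exists2 c, c != 0 & g = c%:MP.
Proof.
elim: s w => [|b s IH] w sP.
  rewrite big_nil mulrC => gw1; have : g \is a GRing.unit.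
    by apply/unitrP; exists w; rewrite [g * w]mulrC gw1.
  move=> /andP[/eqP gE]; rewrite unitfE => g0.
  by exists g@_0%MM.
rewrite big_cons => E; have [b0 nb] := sP b (mem_head _ _).
have [p0 _ pM] := lin_prime b0.
have : mdvd (lin b) (g * w) by rewrite E; apply/mdvd_mulr/mdvd_refl.
case/pM=> // -[q Eq]; apply: (IH q) => [d sd|].
  by apply: sP; rewrite inE sd orbT.
by apply: (mulIf p0); rewrite -mulrA -Eq E mulrC.
Qed.

Lemma lin_product_dvd s (k : 'cV[K]_l -> nat) f : uniq s ->
  (forall b, b \in s -> b != 0 /\ mdvd (lin b ^+ k b) f) ->
  (forall a b, a \in s -> b \in s -> a != b -> ~ mdvd (lin a) (lin b)) ->
  mdvd (\prod_(b <- s) lin b ^+ k b) f.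
Proof.
elim: s f => [|b s IH] f us sP cop; first by exists f; rewrite big_nil mulr1.
move: us => /= /andP[bs us].
have [d sd||q Eq] := IH f us.
- by apply: sP; rewrite inE sd orbT.
- by move=> x y xs ys; apply: cop; rewrite inE ?xs ?ys orbT.
have [b0 bf] := sP b (mem_head _ _).
have [r Er] : mdvd (lin b ^+ k b) q.
  apply: (mprime_expP (lin_prime b0) (g := \prod_(b <- s) lin b ^+ k b)); last by rewrite -Eq.
  rewrite big_seq; elim/big_ind: _ => [|x y nx ny|d sd].
  - exact: (nmdvd_mult (lin_prime b0)).1.
  - exact: (nmdvd_mult (lin_prime b0)).2.
  - apply: (nmdvdX (lin_prime b0)); apply: cop; rewrite ?mem_head ?inE ?sd ?orbT //.
    by apply: contraNneq bs => ->.
by exists r; rewrite big_cons Eq Er mulrA.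
Qed.

End LinearProducts.

(** * Linear forms in general position with respect to [W] *)

Section GenericForms.
Variables (K : numClosedFieldType) (l : nat) (gT : finGroupType) (W : {group gT}).
Variable rW : mx_representation K W l.
Hypothesis faith : mx_faithful rW.
Notation S := {mpoly K[l]}.
Notation F := {fraction {mpoly K[l]}}.
Implicit Types (a b : 'cV[K]_l) (u v w : 'rV[K]_l) (f y : S) (g h s : gT).
Notation act := (poly_act rW).

Lemma natr_neq0 (k : nat) : k.+1%:R != 0 :> K.
Proof. by rewrite pnatr_eq0. Qed.

Lemma evalv_mx m (M : 'M[K]_(m, l)) c i : evalv (row i M) c = (M *m c) i 0.
Proof. by rewrite -evalvE -row_mul mxE. Qed.

Lemma nz_row_mul m (M : 'M[K]_(m, l)) c : evalv (nz_row M) c != 0 -> M *m c != 0.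
Proof.
apply: contraNneq => Mc0; rewrite /nz_row; case: pickP => [i _|_].
  by rewrite evalv_mx Mc0 mxE.
by rewrite -evalvE mul0mx mxE.
Qed.

Lemma mx1B_fix g : mx_faithful rW -> g \in W -> 1%:M - rW g = 0 -> g = 1%g.
Proof.
move=> ff Wg /eqP; rewrite subr_eq0 => /eqP E.
by apply: (mx_faithful_inj ff) => //; rewrite repr_mx1.
Qed.

(** For [g != 1] the condition [(1 - rW g) b = 0] confines [b] to a hyperplane, given by any
    non-zero row of [1 - rW g]. *)
Lemma exists_regular_form : exists b, forall g, g \in W ->
  act g (lin b) = lin b -> g = 1%g.
Proof.
have [|b bP] := @avoid_hyperplanes _ _ _ [pred g in W | g != 1%g]
    (fun g => nz_row (1%:M - rW g)).
  move=> g /andP[Wg g1]; rewrite nz_row_eq0; apply: contra g1 => /eqP E.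
  exact/eqP/(mx1B_fix faith).
exists b => g Wg; rewrite poly_act_lin => /lin_inj E.
apply/eqP/negPn/negP => g1; have /bP/nz_row_mul : [pred g in W | g != 1%g] g.
  by rewrite /= Wg.
by rewrite mulmxBl mul1mx E subrr eqxx.
Qed.

Lemma ker_sub_form a b g : a != 0 -> g \in W ->
  kermx a *m ((1%:M - rW g) *m b) != 0 ->
  ~ mdvd (lin a) (lin b - act g (lin b)).
Proof.
move=> a0 Wg nz; rewrite poly_act_lin -linB => /mdvd_lin_ker E.
case/negP: nz; apply/eqP/colP => i; rewrite -evalv_mx [RHS]mxE mulmxBl mul1mx.
by apply: (E a0); rewrite evalv_mx mulmx_ker mxE.
Qed.

(* In the reflection case, [W] preserves a Hermitian form for which the line
   spanned by [u] is orthogonal to the hyperplane; hence [g] cannot move the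
   points of the hyperplane along this line. *)
Lemma exists_generic_form a : a != 0 -> exists b,
  (forall g, g \in fixer rW a -> act g (lin b) = lin b) /\
  (forall g, g \in W -> g \notin fixer rW a -> ~ mdvd (lin a) (lin b - act g (lin b))).
Proof.
move=> a0; pose P := [pred g in W | g \notin fixer rW a].
have sep g : P g -> kermx a *m (1%:M - rW g) != 0.
  move=> /andP[Wg]; apply: contra => /eqP E; rewrite inE Wg /=.
  by rewrite eq_sym -subr_eq0 -{1}[kermx a]mulmx1 -mulmxBr E.
(* The form is sought as [pr c] with [c] generic: [pr] has to enforce invariance under the fixer,
   without destroying what separates the other elements on the hyperplane. *)
suff [pr [prfix prsep]] : exists pr : 'M[K]_l,
    (forall g, g \in fixer rW a -> rW g *m pr = pr) /\
    (forall g, P g -> kermx a *m (1%:M - rW g) *m pr != 0).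
  have [g Pg|c cP] := @avoid_hyperplanes _ _ _ P
    (fun g => nz_row (kermx a *m (1%:M - rW g) *m pr)).
    by rewrite nz_row_eq0 prsep.
  exists (pr *m c); split=> [g ga|g Wg ga].
    by rewrite poly_act_lin mulmxA prfix.
  apply: ker_sub_form => //; rewrite !mulmxA; apply: nz_row_mul; apply: cP.
  exact/andP.
have [triv|nt] := eqVneq (fixer rW a) 1%g.
  exists 1%:M; split=> [g|g /sep]; last by rewrite mulmx1.
  by rewrite triv => /set1P ->; rewrite repr_mx1 mulmx1.
have [s [u [z rd]]] := fixer_reflection_data faith a0 nt.
have [ua sa gen sE _ z1] := rd.
have Ws := fixer_in sa.
have us : u *m rW s = z *: u.
  rewrite sE mulmxDr mulmx1 -scalemxAr mulmxA [u *m a](_ : _ = 1%:M).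
    by rewrite mul1mx scalerBl scale1r addrC subrK.
  by apply/matrixP => i j; rewrite !ord1 evalvE ua mxE.
(* The projection onto the hyperplane along [u]; the forms [pr c] are those that vanish at [u]. *)
pose pr : 'M[K]_l := 1%:M - a *m u.
have spr : rW s *m pr = pr.
  rewrite /pr mulmxBr mulmx1 sE mulmxDl mul1mx -scalemxAl.
  rewrite mulmxA -(mulmxA a u a) [u *m a](_ : _ = 1%:M).
    by rewrite mulmx1 opprD addrACA addrN addr0.
  by apply/matrixP => i j; rewrite !ord1 evalvE ua mxE.
exists pr; split=> [g|g Pg].
  rewrite gen => /cycleP[k ->]; elim: k => [|k IH].
    by rewrite expg0 repr_mx1 mul1mx.
  by rewrite expgS repr_mxM ?groupX // -mulmxA IH.
have /andP[Wg _] := Pg; apply: contra (sep g Pg) => /eqP E.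
apply/eqP/row_matrixP => i; rewrite row0 row_mul.
set v := row i (kermx a).
have va : evalv v a = 0 by rewrite evalv_mx mulmx_ker mxE.
have : v *m (1%:M - rW g) *m pr = 0 by rewrite /v -!row_mul E row0.
rewrite [v *m _]mulmxBr [v *m 1%:M]mulmx1; set x := v - _; rewrite /pr mulmxBr mulmx1 mulmxA.
rewrite [x *m a](_ : _ = (evalv x a)%:M); last first.
  by apply/matrixP => p q; rewrite !ord1 evalvE mxE.
rewrite mul_scalar_mx; move: (evalv x a) => c /eqP; rewrite subr_eq0 => /eqP xE.
have vg : v *m rW g = v + (- c) *: u.
  by rewrite scaleNr -xE /x opprB addrC subrK.
have vs : v *m rW s = v by case/fixerP: sa => _; apply.
have vu : wform rW v u = 0 by apply: wform_fixed_ortho Ws z1 us vs.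
(* As [v] is orthogonal to [u], comparing the norms of [v] and of [v g = v - c u] gives
   [|c|^2 <u, u> = 0]. *)
have := wform_inv rW v v Wg; rewrite vg wformDl !wformDr !wformZl !wformZr.
have uv : wform rW u v = 0 by rewrite wformC vu rmorph0.
rewrite uv vu !mulr0 addr0 add0r.
move=> /eqP; rewrite -subr_eq0 addrAC subrr add0r mulf_eq0 mulf_eq0.
rewrite conjC_eq0 oppr_eq0 orbA orbb => /orP[/eqP c0|/eqP/wform_eq0 u0].
  by rewrite xE c0 scale0r.
have := ua; rewrite u0 -evalvE mul0mx mxE => /eqP.
by rewrite eq_sym oner_eq0.
Qed.

Lemma orb_diff_form b (P : S -> Prop) : multiplicative_set P ->
  (forall g, g \in W -> act g (lin b) != lin b -> P (lin b - act g (lin b))) ->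
  P (orb_diff rW (lin b)).
Proof.
move=> [P1 PM] bP; rewrite /orb_diff big_seq_cond; apply: big_ind => //.
by move=> r /andP[/mem_orb[g Wg ->] ne]; apply: bP.
Qed.

Lemma orb_diff_neq0 f : orb_diff rW f != 0.
Proof.
rewrite /orb_diff prodf_seq_neq0; apply/allP => r _; apply/implyP => rf.
by rewrite subr_eq0 eq_sym.
Qed.

Lemma generic_form_orb_diff a : a != 0 -> exists b,
  [/\ forall g, g \in W -> (act g (lin b) = lin b) <-> (g \in fixer rW a)
    & ~ mdvd (lin a) (orb_diff rW (lin b))].
Proof.
move=> a0; have [b [bfix bsep]] := exists_generic_form a0.
have stab g : g \in W -> (act g (lin b) = lin b) <-> (g \in fixer rW a).
  move=> Wg; split=> [E|]; last exact: bfix.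
  by apply/negPn/negP => /(bsep g Wg); rewrite E subrr; apply; apply: mdvd0.
exists b; split=> //.
apply: (orb_diff_form (P := fun c => ~ mdvd (lin a) c)).
  exact: (nmdvd_mult (lin_prime a0)).
move=> g Wg gb; apply: bsep => //; apply: contra gb => ga.
by apply/eqP/stab.
Qed.

Lemma regular_form_orb_diff : exists b,
  (forall g, g \in W -> act g (lin b) = lin b -> g = 1%g) /\
  lin_product (orb_diff rW (lin b)).
Proof.
have [b bP] := exists_regular_form; exists b; split=> //.
apply: orb_diff_form; first exact: lin_product_mult.
move=> g Wg ne; exists [:: b - rW g *m b]; last first.
  by rewrite big_seq1 linB poly_act_lin.
by move=> c; rewrite inE => /eqP ->; rewrite -lin_eq0 linB -poly_act_lin subr_eq0 eq_sym.
Qed.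

Section Integrality.
Variable delta : derF K l.
Hypothesis delta_inv : forall r, invariant rW r -> exists z, derF_app delta r = z%:F.

(** Interpolation with the generic form of [a], in the localization at [lin a]. Off the reflecting
    hyperplanes the fixer is trivial, and no [y] is excluded. *)
Lemma ordge_derF a y : a != 0 ->
  (forall g, g \in fixer rW a -> act g y = y) ->
  ordge (lin a) 0 (derF_app delta y).
Proof.
move=> a0 yP; have [b [stab nd]] := generic_form_orb_diff a0.
apply/ordge0E; apply: (@derF_app_integral _ _ _ _ rW delta _ delta_inv
  (nmdvd_mult (lin_prime a0)) natr_neq0 (lin b)) => //.
- exact: orb_diff_neq0.
- by move=> g Wg /stab-/(_ Wg)/yP.
Qed.

Lemma lin_product_derF y : sloc (@lin_product K l) (derF_app delta y).
Proof.
have [b [stab nd]] := regular_form_orb_diff.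
apply: (@derF_app_integral _ _ _ _ rW delta _ delta_inv
  (@lin_product_mult K l) natr_neq0 (lin b)) => //.
- exact: orb_diff_neq0.
- by move=> g Wg /stab-/(_ Wg) ->; rewrite poly_act1.
Qed.

End Integrality.
End GenericForms.

(** * The reflection arrangement *)

Section Roots.
Variables (K : fieldType) (l : nat) (gT : finGroupType) (W : {group gT}).
Variable rW : mx_representation K W l.
Notation S := {mpoly K[l]}.
Notation F := {fraction {mpoly K[l]}}.
Implicit Types (a b : 'cV[K]_l) (f g w : S) (u : F).

(** One linear form for each reflecting hyperplane, up to scalars; stability of the list under [W]
    is not demanded. *)
Record root_system (roots : seq 'cV[K]_l) : Prop := RootSystem {
  root_neq0 : forall a, a \in roots -> a != 0;
  root_fixer : forall a, a \in roots -> fixer rW a :!=: 1%g;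
  root_cover : forall b, b != 0 -> fixer rW b :!=: 1%g ->
    exists2 a, a \in roots & mdvd (lin b) (lin a);
  root_uniq : uniq roots;
  root_coprime : forall a b, a \in roots -> b \in roots -> a != b ->
    ~ mdvd (lin a) (lin b) }.

Variable roots : seq 'cV[K]_l.
Hypothesis rs : root_system roots.

Definition roots_prod : S := \prod_(a <- roots) lin a.

Definition regular_off u := sloc (fun c => exists k, c = roots_prod ^+ k) u.

Lemma roots_prod_mult : multiplicative_set (fun c => exists k, c = roots_prod ^+ k).
Proof.
split; first by exists 0; rewrite expr0.
by move=> c d [j ->] [k ->]; exists (j + k)%N; rewrite exprD.
Qed.

(** The factors of the denominator are treated one at a time: one with non-trivial fixer divides
    [roots_prod] and is absorbed by a further power of it, any other cancels against the
    numerator. *)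
Lemma regular_offP u : sloc (@lin_product K l) u ->
  (forall b, b != 0 -> fixer rW b :=: 1%g -> ordge (lin b) 0 u) -> regular_off u.
Proof.
move=> [_ [s s0 ->] [f E]] uP.
suff [k [g Eg]] : exists k g, u * (roots_prod ^+ k)%:F = g%:F.
  by exists (roots_prod ^+ k); [exists k | exists g].
suff gen k : u * (roots_prod ^+ k)%:F * (\prod_(b <- s) lin b)%:F = f%:F ->
    exists k g, u * (roots_prod ^+ k)%:F = g%:F.
  by apply: (gen 0%N); rewrite expr0 tofrac1 mulr1.
elim: s s0 f k {E} => [|b s IH] s0 f k; first by rewrite big_nil tofrac1 mulr1; exists k, f.
have s0' d : d \in s -> d != 0 by move=> sd; apply: s0; rewrite inE sd orbT.
have b0 := s0 b (mem_head _ _).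
rewrite big_cons => E; have [triv|nt] := eqVneq (fixer rW b) 1%g; last first.
  have [a ra [q Eq]] := root_cover rs b0 nt.
  have [p Ep] : mdvd (lin b) roots_prod.
    rewrite /roots_prod (big_rem a) //= Eq -mulrA mulrCA.
    by apply/mdvd_mulr/mdvd_refl.
  apply: (IH s0' (p * f) k.+1); rewrite exprS {1}Ep !tofracM -E !tofracM.
  exact: mulr_swap5b.
have /ordge0E[c nc [g Eg]] := uP b b0 triv.
have [p0 _ pM] := lin_prime b0.
have : mdvd (lin b) (f * c).
  exists (g * roots_prod ^+ k * \prod_(b <- s) lin b); apply: tofrac_inj.
  rewrite (tofracM f) -E !tofracM -Eg.
  exact: mulr_swap5.
case/pM=> // -[q Eq]; apply: (IH s0' q k).
have pF0 : (lin b)%:F != 0 :> F by rewrite tofrac_eq0.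
by apply: (mulfI pF0); rewrite -(tofracM _ q) [lin b * q]mulrC -Eq -E tofracM mulrCA.
Qed.

Lemma regular_off_integral u : regular_off u ->
  (forall a, a \in roots -> ordge (lin a) 0 u) -> exists z, u = z%:F.
Proof.
move=> [_ [k ->] [f E]] uP; elim: k f E => [|k IH] f.
  by rewrite expr0 tofrac1 mulr1; exists f.
rewrite exprSr tofracM mulrA => E.
have [||z Ez] := lin_product_clear (s := roots) (u := u * (roots_prod ^+ k)%:F) (f := f).
- move=> b rb; have b0 := root_neq0 rs rb; split=> //; rewrite mulrC.
  by apply: (ordge_tofracM (lin_prime b0)); apply: uP.
- by [].
exact: IH Ez.
Qed.

End Roots.

Section Hyperplanes.
Variables (K : fieldType) (l : nat).
Implicit Types (a b : 'cV[K]_l) (H : {vspace 'rV[K]_l}) (v : 'rV[K]_l).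

Definition is_form H a : Prop := forall v, (v \in H) = (evalv v a == 0).

Lemma is_form_dvd H a b : a != 0 -> is_form H a -> is_form H b ->
  mdvd (lin a) (lin b).
Proof.
move=> a0 Ha Hb; apply/mdvd_lin_ker => // v /eqP va.
by apply/eqP; rewrite -Hb Ha.
Qed.

(** The complementary projection [th] has kernel [H] and image a line; a coordinate that does not
    vanish on this line, composed with [th], is the form. *)
Lemma hyperplane_form H : (\dim H).+1 = l -> exists2 a, a != 0 & is_form H a.
Proof.
move=> dimH; pose th := (\1 - projv H)%VF.
have thE v : th v = v - projv H v by rewrite add_lfunE opp_lfunE id_lfunE.
have ker v : (v \in H) = (th v == 0).
  rewrite thE subr_eq0; apply/idP/eqP => [/projv_id //|->]; exact: memv_proj.
have dim1 : \dim (limg th) = 1%N.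
  have := limg_ker_dim th fullv.
  rewrite capfv dimvf /dim /= mul1n (_ : lker th = H) => [E|].
    by apply/eqP; rewrite -(eqn_add2l (\dim H)) E addn1 dimH.
  by apply/vspaceP => v; rewrite memv_ker ker.
have w0 : vpick (limg th) != 0 by rewrite vpick0 -dimv_eq0 dim1.
set w := vpick _ in w0.
have limgE : limg th = <[w]>%VS.
  apply/esym/eqP; rewrite eqEdim dim1 dim_vline w0 andbT -memvE.
  exact: memv_pick.
have [j wj] : exists j, w 0 j != 0.
  apply/existsP; apply: contraNT w0; rewrite negb_exists => /forallP E.
  by apply/eqP/rowP => i; rewrite mxE; apply/eqP; have := E i; rewrite negbK.
exists (\col_i th (delta_mx 0 i) 0 j).
  apply/eqP => E; have /memv_imgP[v _ vE] : w \in limg th by apply: memv_pick.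
  case/negP: wj; rewrite vE (row_sum_delta v) linear_sum summxE big1 // => i _.
  by rewrite linearZ mxE; have /colP/(_ i) := E; rewrite !mxE => ->; rewrite mulr0.
move=> v; have -> : evalv v (\col_i th (delta_mx 0 i) 0 j) = th v 0 j.
  rewrite {2}(row_sum_delta v) linear_sum summxE; apply: eq_bigr => i _.
  by rewrite linearZ !mxE.
have : th v \in <[w]>%VS by rewrite -limgE memv_img ?memvf.
move=> /vlineP[c cE]; rewrite ker cE mxE scaler_eq0 (negPf w0) orbF.
by rewrite mulf_eq0 (negPf wj) orbF.
Qed.

End Hyperplanes.

Section ReflectionArrangement.
Variables (K : numClosedFieldType) (l : nat) (gT : finGroupType) (W : {group gT}).
Variable rW : mx_representation K W l.
Hypothesis faith : mx_faithful rW.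
Implicit Types (a b : 'cV[K]_l) (H : {vspace 'rV[K]_l}) (v : 'rV[K]_l) (g : gT).

Lemma mem_fix_space g v : (v \in fix_space rW g) = (v *m rW g == v).
Proof. by apply/fixedSpaceP/eqP; rewrite lfunE. Qed.

Lemma fixer_fix_space H a g : is_form H a ->
  (g \in fixer rW a) = (g \in W) && (H <= fix_space rW g)%VS.
Proof.
move=> Ha; apply/fixerP/andP => -[Wg E]; split=> //.
  by apply/subvP => v; rewrite Ha mem_fix_space => /eqP/E ->.
move=> v /eqP; rewrite -Ha => /(subvP E); rewrite mem_fix_space.
by move/eqP.
Qed.

Lemma stab_orderE H a : is_form H a -> stab_order rW H = #|fixer rW a|.
Proof.
move=> Ha; apply: eq_card => g.
by rewrite inE (fixer_fix_space _ Ha).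
Qed.

Lemma refl_arrP H : reflect (exists2 g, is_reflection rW g & H = fix_space rW g)
  (H \in refl_arr rW).
Proof.
rewrite mem_undup; apply: (iffP mapP) => -[g gr ->]; exists g => //.
  by move: gr; rewrite mem_enum inE.
by rewrite mem_enum inE.
Qed.

Lemma refl_arr_form H : H \in refl_arr rW ->
  exists a, [/\ a != 0, is_form H a & fixer rW a :!=: 1%g].
Proof.
move=> /refl_arrP[g /andP[Wg /eqP dimg] ->].
have [a a0 Ha] := hyperplane_form dimg; exists a; split=> //.
have ga : g \in fixer rW a by rewrite (fixer_fix_space _ Ha) Wg subvv.
apply/eqP => triv; move: ga; rewrite triv => /set1P g1.
have [u ua] := exists_evalv1 a0; have := Ha u.
by rewrite ua oner_eq0 mem_fix_space g1 repr_mx1 mulmx1 eqxx.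
Qed.

Lemma fixer_refl_arr a : a != 0 -> fixer rW a :!=: 1%g ->
  exists2 H, H \in refl_arr rW & is_form H a.
Proof.
move=> a0 nt; have [g ga g1] : exists2 g, g \in fixer rW a & g != 1%g.
  by apply/trivgPn.
have [v0 va] := exists_evalv1 a0.
have [_ gE] := fixer_scalar va ga.
set w := v0 *m rW g - v0 in gE.
have Wg := fixer_in ga.
have w0 : w != 0.
  apply: contra g1 => /eqP w0; apply/eqP/(mx_faithful_inj faith) => //.
  apply/row_matrixP => i; rewrite !rowE gE w0 scaler0 addr0 repr_mx1.
  by rewrite mulmx1.
have Ha : is_form (fix_space rW g) a.
  move=> v; rewrite mem_fix_space gE -subr_eq0 addrAC subrr add0r scaler_eq0.
  by rewrite (negPf w0) orbF.
exists (fix_space rW g) => //; apply/refl_arrP; exists g => //.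
rewrite /is_reflection Wg /=.
pose phi := linfun (mulmxr a : 'rV[K]_l -> 'rV[K]_1).
have phiE v : phi v = v *m a by rewrite lfunE.
have := limg_ker_dim phi fullv.
rewrite capfv (_ : lker phi = fix_space rW g); last first.
  apply/vspaceP => v; rewrite memv_ker phiE Ha -evalvE.
  apply/eqP/eqP => [->|E]; first by rewrite mxE.
  by apply/matrixP => i j; rewrite !ord1 E mxE.
rewrite (_ : \dim (limg phi) = 1%N); first by rewrite addn1 dimvf /dim /= mul1n => ->.
apply/eqP; rewrite eqn_leq lt0n dimv_eq0; apply/andP; split.
  by apply: leq_trans (dimvS (subvf _)) _; rewrite dimvf.
apply/eqP => E; have : phi v0 \in limg phi by rewrite memv_img ?memvf.
rewrite E memv0 phiE => /eqP/matrixP/(_ 0 0)/eqP.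
by rewrite evalvE va mxE oner_eq0.
Qed.

Lemma exists_root_system : exists roots,
  [/\ root_system rW roots,
      (\sum_(a <- roots) #|fixer rW a| = \sum_(H <- refl_arr rW) stab_order rW H)%N,
      forall a, a \in roots -> exists2 H, H \in refl_arr rW & is_form H a
    & forall H, H \in refl_arr rW -> exists2 a, a \in roots & is_form H a].
Proof.
have [form formP] : exists form : {vspace 'rV[K]_l} -> 'cV[K]_l,
    forall H, H \in refl_arr rW ->
      [/\ form H != 0, is_form H (form H) & fixer rW (form H) :!=: 1%g].
  elim: (refl_arr rW) (@refl_arr_form) => [|H A IH] AP; first by exists (fun _ => 0).
  have [|form fP] := IH; first by move=> H' H'A; apply: AP; rewrite inE H'A orbT.
  have [a aP] := AP H (mem_head _ _).
  exists (fun H' => if H' == H then a else form H') => H' /=.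
  have [-> _|HH] := eqVneq H' H.
    exact: aP.
  by rewrite inE (negPf HH) => /fP.
have form_inj : {in refl_arr rW &, injective form}.
  move=> H H' /formP[_ HP _] /formP[_ HP' _] E.
  by apply/vspaceP => v; rewrite HP HP' E.
exists (map form (refl_arr rW)); split.
- split.
  + by move=> _ /mapP[H /formP[a0 _ _] ->].
  + by move=> _ /mapP[H /formP[_ _ a1] ->].
  + move=> b b0 /(fixer_refl_arr b0)[H HA Hb].
    exists (form H); first exact: map_f.
    by have [_ Hf _] := formP H HA; apply: is_form_dvd Hb Hf.
  + by rewrite map_inj_in_uniq // undup_uniq.
  + move=> _ _ /mapP[H HA ->] /mapP[H' HA' ->] ne.
    have [a0 HP _] := formP H HA; have [a0' HP' _] := formP H' HA'.
    move=> /(mdvd_lin_ker _ a0) E; case/negP: ne; apply/eqP; congr form.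
    have [g /andP[_ /eqP dg] Eg] := refl_arrP _ HA.
    have [g' /andP[_ /eqP dg'] Eg'] := refl_arrP _ HA'.
    apply/eqP; rewrite eqEdim; apply/andP; split.
      by apply/subvP => v; rewrite HP HP' => /eqP/E ->.
    by rewrite -ltnS Eg Eg' dg dg'.
- rewrite big_map big_seq [RHS]big_seq; apply: eq_bigr => H HA.
  by have [_ HP _] := formP H HA; rewrite (stab_orderE HP).
- by move=> _ /mapP[H HA ->]; exists H => //; have [] := formP H HA.
- by move=> H HA; exists (form H); [exact: map_f | have [] := formP H HA].
Qed.

Lemma linear_poly_lin (alpha : 'Hom('rV[K]_l, K^o)) :
  exists a, [/\ linear_poly alpha = lin a & is_form (lker alpha) a].
Proof.
exists (\col_i (alpha (delta_mx 0 i) : K)); split.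
  by apply: eq_bigr => i _; rewrite mxE.
move=> v; rewrite memv_ker {1}(row_sum_delta v) linear_sum /evalv.
by congr (_ == 0); apply: eq_bigr => i _; rewrite linearZ mxE.
Qed.

Lemma is_form_hom H a : is_form H a -> exists alpha : 'Hom('rV[K]_l, K^o),
  lker alpha = H /\ linear_poly alpha = lin a.
Proof.
move=> Ha; pose phi (v : 'rV[K]_l) : K^o := evalv v a.
have phi_lin : linear phi.
  by move=> c u v; rewrite /phi -!evalvE mulmxDl -scalemxAl !mxE.
pose mphi := GRing.isLinear.Build K 'rV[K]_l K^o _ phi phi_lin.
pose Phi : {linear 'rV[K]_l -> K^o} := HB.pack phi mphi.
have PhiE v : linfun Phi v = evalv v a by rewrite lfunE.
exists (linfun Phi); split.
  by apply/vspaceP => v; rewrite memv_ker PhiE Ha.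
apply: eq_bigr => i _; rewrite PhiE; congr (_ *: _).
by rewrite -evalvE -rowE mxE.
Qed.

End ReflectionArrangement.

(** * Homogeneity and the Euler field *)

Section Euler.
Variables (K : numClosedFieldType) (l : nat).
Notation S := {mpoly K[l]}.
Notation F := {fraction {mpoly K[l]}}.
Implicit Types (f g : S) (u v : F) (c : K).

Definition eulerS : derS K l := \row_i 'X_i.

Lemma der_app_eulerX (m : 'X_{1..l}) :
  der_app eulerS 'X_[m] = (mdeg m)%:R *: ('X_[m] : S).
Proof.
rewrite /der_app mdegE natr_sum scaler_suml; apply: eq_bigr => i _.
rewrite mxE mderivX -scalerAr; have [->|mi] := eqVneq (m i) 0%N; first by rewrite !scale0r.
congr (_ *: _); rewrite -mpolyXD addmC submK //.
by rewrite lep1mP.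
Qed.

Lemma der_app_euler f :
  der_app eulerS f = \sum_(m <- msupp f) (f@_m * (mdeg m)%:R) *: 'X_[m].
Proof.
rewrite {1}(mpolyE f) raddf_sum /=; apply: eq_bigr => m _.
by rewrite der_appZ der_app_eulerX scalerA.
Qed.

Lemma euler_homog k f : reflect (der_app eulerS f = k%:R *: f) (f \is k.-homog).
Proof.
apply: (iffP idP) => [fk|E].
  rewrite der_app_euler [in RHS](mpolyE f) scaler_sumr big_seq [RHS]big_seq.
  apply: eq_bigr => m mf; rewrite scalerA mulrC.
  by have /= -> := dhomog_mf fk mf.
apply/dhomogP => m mf /=; have := congr1 (mcoeff m) E.
rewrite der_app_euler raddf_sum mcoeffZ (bigD1_seq m) ?msupp_uniq //=.
rewrite mcoeffZ mcoeffX eqxx mulr1 big1 ?addr0 => [|m' m'm]; last first.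
  by rewrite mcoeffZ mcoeffX (negPf m'm) mulr0.
rewrite mulrC => /mulIf; rewrite -mcoeff_msupp => /(_ mf)/eqP.
by rewrite eqr_nat => /eqP.
Qed.

Definition eulerF : F -> F := fder (to_derF eulerS).

(* Homogeneity of degree [c], expressed by Euler's identity so as to make sense
   for fractions. *)
Definition eigen c u : Prop := eulerF u = kfrac K l c * u.

Lemma eulerF_tofrac f : eulerF f%:F = (der_app eulerS f)%:F.
Proof. by rewrite /eulerF fder_tofrac der_appE. Qed.

Lemma eigen_tofrac (k : nat) f : eigen k%:R f%:F <-> f \is k.-homog.
Proof.
rewrite /eigen eulerF_tofrac kfracE -tofracM mul_mpolyC.
by split=> [E|/euler_homog -> //]; apply/euler_homog/tofrac_inj.
Qed.

Lemma eigen_linX a (k : nat) : eigen k%:R (lin a ^+ k)%:F.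
Proof. by apply/eigen_tofrac; rewrite -[k in k.-homog]mul1n; apply/dhomogMn/lin_homog. Qed.

Lemma eigenM c c' u v : eigen c u -> eigen c' v -> eigen (c + c') (u * v).
Proof.
rewrite /eigen /eulerF fderM => -> ->; rewrite (rmorphD (kfrac K l)) mulrDl.
by rewrite -mulrA; congr (_ + _); rewrite mulrCA.
Qed.

Lemma eigenD c u v : eigen c u -> eigen c v -> eigen c (u + v).
Proof. by rewrite /eigen /eulerF raddfD /= => -> ->; rewrite mulrDr. Qed.

Lemma eigen0 c : eigen c 0.
Proof. by rewrite /eigen /eulerF raddf0 mulr0. Qed.

Lemma eigen_const c : eigen 0 (kfrac K l c).
Proof. by rewrite /eigen /eulerF kfracE fderC rmorph0 mul0r. Qed.

Lemma eigen1 : eigen 0 1.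
Proof. by rewrite -(rmorph1 (kfrac K l)); apply: eigen_const. Qed.

Lemma eigenZ c c' u : eigen c u -> eigen c (kfrac K l c' * u).
Proof. by move=> cu; rewrite -[c]add0r; apply: eigenM cu; apply: eigen_const. Qed.

Lemma eigen_sum c (I : Type) (r : seq I) (P : pred I) (u : I -> F) :
  (forall i, P i -> eigen c (u i)) -> eigen c (\sum_(i <- r | P i) u i).
Proof. by move=> cu; apply: big_ind => //; [exact: eigen0 | exact: eigenD]. Qed.

Lemma eigen_prod (I : Type) (r : seq I) (P : pred I) (c : I -> K) (u : I -> F) :
  (forall i, P i -> eigen (c i) (u i)) ->
  eigen (\sum_(i <- r | P i) c i) (\prod_(i <- r | P i) u i).
Proof.
move=> cu; apply: (big_rec2 (fun c u => eigen c u)) => [|i c' u' Pi]; first exact: eigen1.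
by apply: eigenM; apply: cu.
Qed.

Lemma eigen_det k (M : 'M[F]_k) (c c' : 'I_k -> K) :
  (forall i j, eigen (c i + c' j) (M i j)) ->
  eigen (\sum_i c i + \sum_j c' j) (\det M).
Proof.
move=> cM; apply: eigen_sum => s _.
rewrite -(rmorph1 (kfrac K l)) -rmorphN -rmorphXn; apply: eigenZ.
have -> : \sum_j c' j = \sum_i c' (s i) by rewrite [LHS](reindex_inj (@perm_inj _ s)).
by rewrite -big_split; apply: eigen_prod => i _; apply: cM.
Qed.

Lemma eigen_uniq c c' u : u != 0 -> eigen c u -> eigen c' u -> c = c'.
Proof.
move=> u0; rewrite /eigen => -> /(mulIf u0); rewrite !kfracE.
by move=> /tofrac_inj/(can_inj (@mpolyCK l K)).
Qed.

Lemma eigen_cancel c c' u v : u != 0 -> eigen c u -> eigen (c + c') (u * v) -> eigen c' v.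
Proof.
rewrite /eigen /eulerF fderM => u0 ->; rewrite (rmorphD (kfrac K l)) mulrDl.
by rewrite -[X in X + _ = _]mulrA => /addrI; rewrite [X in _ = X -> _]mulrCA => /(mulfI u0).
Qed.

Lemma eigen0_const f : eigen 0 f%:F -> exists c, f = c%:MP.
Proof.
rewrite -[0]/(0%:R) => /eigen_tofrac/dhomogP f0; exists f@_0%MM.
apply: msize1_polyC; rewrite msizeE; apply/bigmax_leqP_seq => m mf _.
by have /= -> := f0 m mf.
Qed.

End Euler.

(** * Differentiation with respect to the fundamental invariants *)

Section Dual.
Variables (K : numClosedFieldType) (l : nat) (gT : finGroupType) (W : {group gT}).
Variable rW : mx_representation K W l.
Variables (t : 'I_l -> {mpoly K[l]}) (d : 'I_l -> nat) (dt : 'I_l -> derF K l).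
Hypothesis FI : fundamental_invariants rW t d.
Hypothesis dual : dual_derivations t dt.
Notation S := {mpoly K[l]}.
Notation F := {fraction {mpoly K[l]}}.
Implicit Types (f p q : S) (u v : F) (c : K) (g : gT).
Notation act := (poly_act rW).
Notation "p \oT" := (p \mPo [tuple t i | i < l]) (at level 2, format "p \oT").

Lemma comp_tX i : ('X_i : S) \oT = t i.
Proof. by rewrite comp_mpolyXU -tnth_nth tnth_mktuple. Qed.

Lemma t_homog i : t i \is (d i).-homog. Proof. by case: FI. Qed.

Lemma t_inv i : invariant rW (t i). Proof. by case: FI. Qed.

Lemma comp_t_inv p : invariant rW p \oT.
Proof.
move=> g Wg; pose T := [tuple t i | i < l].
apply: (rmorph_mpoly_ext (phi := act g \o comp_mpoly T) (psi := comp_mpoly T)) => [c|i] /=.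
  by rewrite comp_mpolyC poly_actC.
by rewrite comp_tX; apply: t_inv.
Qed.

Lemma comp_t_inj p q : p \oT = q \oT -> p = q.
Proof.
case: FI => _ _ _ _ inj E; apply/eqP; rewrite -subr_eq0; apply/eqP/inj.
by rewrite comp_mpolyB E subrr.
Qed.

Lemma invariant_comp_t f : invariant rW f -> exists p, f = p \oT.
Proof. by case: FI => _ _ _ gen _ /gen. Qed.

Lemma derF_app_comp delta p :
  derF_app delta p \oT = \sum_i (p^`M(i) \oT)%:F * derF_app delta (t i).
Proof.
pose T := [tuple t i | i < l]; pose phi : {rmorphism S -> F} := (@tofrac S) \o comp_mpoly T.
have dd : derivation phi (fun p => derF_app delta p \oT).
  split=> a b; first by rewrite comp_mpolyD raddfD.
  by rewrite (rmorphM (comp_mpoly T)) derF_appM.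
rewrite (derivation_mpoly dd) => [|c]; last by rewrite comp_mpolyC derF_appC.
by apply: eq_bigr => i _; rewrite comp_tX.
Qed.

Lemma dt_comp k p : derF_app (dt k) p \oT = (p^`M(k) \oT)%:F.
Proof.
rewrite derF_app_comp (bigD1 k) //= dual eqxx mulr1 big1 ?addr0 // => i ik.
by rewrite dual eq_sym (negPf ik) mulr0.
Qed.

Lemma dt_invariant k f : invariant rW f ->
  exists2 r, invariant rW r & derF_app (dt k) f = r%:F.
Proof.
move=> /invariant_comp_t[p ->]; exists p^`M(k) \oT; last exact: dt_comp.
exact: comp_t_inv.
Qed.

Lemma dt_integral k f : invariant rW f -> exists z, derF_app (dt k) f = z%:F.
Proof. by move=> /(dt_invariant k)[r _]; exists r. Qed.

Lemma fraction_action g : g \in W ->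
  exists Phi : {rmorphism F -> F}, forall f, Phi f%:F = (act g f)%:F.
Proof.
move=> Wg; pose phi : {rmorphism S -> F} := (@tofrac S) \o act g.
apply: (@fraction_rmorphism _ _ phi) => x y /tofrac_inj.
exact: poly_act_inj.
Qed.

Lemma dt_equivariant k g (Phi : {rmorphism F -> F}) y : g \in W ->
  (forall f, Phi f%:F = (act g f)%:F) ->
  derF_app (dt k) (act g y) = Phi (derF_app (dt k) y).
Proof.
move=> Wg PhiE; move: y.
apply: (derivation_dual_ext dual (Phi := Phi)) => [||c|c|j].
- split=> a b; first by rewrite poly_act_add raddfD.
  by rewrite poly_act_mul derF_appM /= !PhiE.
- split=> a b; first by rewrite raddfD (rmorphD Phi).
  by rewrite derF_appM (rmorphD Phi) !(rmorphM Phi).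
- by rewrite poly_actC derF_appC.
- by rewrite derF_appC (rmorph0 Phi).
- by rewrite (t_inv j Wg) dual (rmorph_nat Phi).
Qed.

(** Both sides are derivations with value [d_j t_j] at each [t_j]. *)
Lemma eulerF_dt u : eulerF u = \sum_k (d k)%:R * (t k)%:F * fder (dt k) u.
Proof.
move: u; apply: (fder_dual_ext dual) => [||c|c|j].
- exact: fder_derivation.
- apply: derivation_sum => k; apply: derivationZ; exact: fder_derivation.
- exact: fderC.
- by rewrite big1 // => k _; rewrite fderC mulr0.
- have /eigen_tofrac := t_homog j; rewrite /eigen => ->.
  rewrite (bigD1 j) //= fder_dual // eqxx mulr1 big1 => [|k kj]; last first.
    by rewrite fder_dual // (negPf kj) mulr0.
  by rewrite addr0 -kfracE (rmorph_nat (kfrac K l)).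
Qed.

Lemma eulerF_dt_comm k u :
  eulerF (fder (dt k) u) = fder (dt k) (eulerF u) - (d k)%:R * fder (dt k) u.
Proof.
suff E v : fder (dt k) (eulerF v) - eulerF (fder (dt k) v) = (d k)%:R * fder (dt k) v.
  by rewrite -E opprB addrC subrK.
move: v; apply: (fder_dual_ext dual) => [||c|c|j].
- by apply: derivation_comm; apply: fder_derivation.
- by apply: derivationZ; apply: fder_derivation.
- by rewrite /eulerF !fderC !raddf0 addr0.
- by rewrite fderC mulr0.
- rewrite fder_dual // /eulerF fder_nat subr0.
  have /eigen_tofrac := t_homog j; rewrite /eigen /eulerF => ->.
  rewrite fderM kfracE fderC mul0r add0r fder_dual // -kfracE (rmorph_nat (kfrac K l)).
  by case: eqP => [->|_] //; rewrite !mulr0.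
Qed.

Lemma eigen_dt k c u : eigen c u -> eigen (c - (d k)%:R) (fder (dt k) u).
Proof.
rewrite /eigen eulerF_dt_comm => ->; rewrite fderM kfracE fderC mul0r add0r -kfracE.
by rewrite (rmorphB (kfrac K l)) (rmorph_nat (kfrac K l)) mulrBl.
Qed.

End Dual.

(** * Orders along a reflecting hyperplane *)

Lemma mulr_swap4b (A : comPzRingType) (r x p b : A) :
  r * (x * (p * b)) = p * (r * x * b).
Proof. by ring. Qed.

Section ConstantFields.
Variables (K : fieldType) (l : nat) (gT : finGroupType) (W : {group gT}).
Variable rW : mx_representation K W l.
Notation act := (poly_act rW).

Definition const_field (w : 'rV[K]_l) : derS K l := map_mx (@mpolyC l K) w.

Lemma der_const_field g w c : w *m rW g = c *: w -> forall y,
  der_app (const_field w) (act g y) = c *: act g (der_app (const_field w) y).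
Proof.
move=> wg y.
have d1 : derivation (act g) (fun y => der_app (const_field w) (act g y)).
  split=> f q; first by rewrite poly_act_add raddfD.
  by rewrite poly_act_mul der_appM.
have d2 : derivation (act g) (fun y => c *: act g (der_app (const_field w) y)).
  split=> f q; first by rewrite raddfD poly_act_add scalerDr.
  by rewrite der_appM poly_act_add !poly_act_mul scalerDr -scalerAl -scalerAr.
rewrite (derivation_mpoly d1) => [|k]; last by rewrite poly_actC der_appC.
rewrite [RHS](derivation_mpoly d2) => [|k]; last by rewrite der_appC rmorph0 scaler0.
apply: eq_bigr => i _ /=; congr (_ * _).
rewrite poly_actX der_app_lin der_appX mxE poly_actC -mul_mpolyC -mpolyCM.
have /rowP/(_ i) := wg; rewrite [RHS]mxE => <-; rewrite mxE rmorph_sum.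
apply: eq_bigr => j _; rewrite mxE -mpolyCM; congr (_ * _)%:MP.
by rewrite -colE mxE.
Qed.

End ConstantFields.

Section LocalAnalysis.
Variables (K : numClosedFieldType) (l : nat) (gT : finGroupType) (W : {group gT}).
Variable rW : mx_representation K W l.
Variables (t : 'I_l -> {mpoly K[l]}) (d : 'I_l -> nat) (dt : 'I_l -> derF K l).
Hypothesis faith : mx_faithful rW.
Hypothesis FI : fundamental_invariants rW t d.
Hypothesis dual : dual_derivations t dt.
Notation S := {mpoly K[l]}.
Notation F := {fraction {mpoly K[l]}}.
Notation act := (poly_act rW).
Variables (a : 'cV[K]_l) (s : gT) (u : 'rV[K]_l) (z : K).
Hypothesis rd : reflection_data rW a s u z.
Notation alpha := (lin a).
Notation e := #|fixer rW a|.
Implicit Types (f q y : S) (chi : derF K l) (theta : derS K l).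

Let ua : evalv u a = 1. Proof. by case: rd. Qed.
Let sa : s \in fixer rW a. Proof. by case: rd. Qed.
Let Ws : s \in W. Proof. exact: fixer_in sa. Qed.
Let prim : e.-primitive_root z. Proof. by case: rd. Qed.

Lemma rd_neq0 : a != 0.
Proof. by rewrite -lin_eq0; apply: lin_neq0 ua. Qed.

Let a0 := rd_neq0.
Let pa := lin_prime a0.

Lemma rd_card_gt1 : (1 < e)%N.
Proof.
case: rd => _ _ _ _ pz; apply: contraNltn => e1.
have : e = 1%N by apply/eqP; rewrite eqn_leq e1 cardG_gt0.
by move=> E; move: pz; rewrite E => /prim_expr_order; rewrite expr1 => ->.
Qed.

Lemma rd_z_neq0 : z != 0.
Proof.
apply/eqP => z0; have := prim_expr_order prim.
rewrite z0 expr0n (gtn_eqF (cardG_gt0 (fixer_group rW a))) => /eqP.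
by rewrite eq_sym oner_eq0.
Qed.

Lemma rd_fixer_inv f : act s f = f -> forall g, g \in fixer rW a -> act g f = f.
Proof.
move=> sf g; case: rd => _ _ -> _ _ _ /cycleP[k ->].
elim: k => [|k IH]; first by rewrite expg0 poly_act1.
by rewrite expgS -(poly_actM rW f Ws (groupX k Ws)) IH.
Qed.

Lemma rd_mul_a : rW s *m a = z *: a.
Proof.
case: rd => _ _ _ -> _ _; rewrite mulmxDl mul1mx -scalemxAl -mulmxA.
rewrite [u *m a](_ : _ = 1%:M); last by apply/matrixP => i j; rewrite !ord1 evalvE ua mxE.
by rewrite mulmx1 scalerBl scale1r addrC subrK.
Qed.

Lemma rd_u_mul : u *m rW s = z *: u.
Proof.
case: rd => _ _ _ -> _ _; rewrite mulmxDr mulmx1 -scalemxAr mulmxA.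
rewrite [u *m a](_ : _ = 1%:M); last by apply/matrixP => i j; rewrite !ord1 evalvE ua mxE.
by rewrite mul1mx scalerBl scale1r addrC subrK.
Qed.

Lemma rd_act_alpha : act s alpha = z *: alpha.
Proof. by rewrite poly_act_lin rd_mul_a linZ. Qed.

Lemma rd_alphaX_inv k : act s (alpha ^+ (k * e)) = alpha ^+ (k * e).
Proof.
rewrite rmorphXn /= rd_act_alpha exprZn mulnC [z ^+ _]exprM (prim_expr_order prim).
by rewrite expr1n scale1r.
Qed.

(** By [semi_invariant] the order of [f] is 1 modulo [e]. Being at least [m e], it is at least
    [m e + 1], and the excess is a multiple of [e]; as [alpha^e] is fixed by [s], so is the
    quotient. *)
Lemma semi_order m f : act s f = z *: f -> mdvd (alpha ^+ (m * e)) f ->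
  exists q, f = alpha ^+ (m * e).+1 * q /\ act s q = q.
Proof.
move=> sf df; have [->|f0] := eqVneq f 0.
  by exists 0; rewrite mulr0 rmorph0.
have [k [q [E nq]]] := lin_multiplicity a0 f0.
have [zk sq] := semi_invariant (j := 1%N) a0 rd_z_neq0 sa rd_mul_a sf E nq.
have mk : (m * e <= k)%N.
  rewrite leqNgt; apply/negP => km; apply: nq; have [r Er] := df.
  exists (r * alpha ^+ (m * e - k.+1)); apply: (mulfI (expf_neq0 k (mprime_neq0 pa))).
  rewrite -E Er -{1}(subnK km) exprD [alpha ^+ k.+1]exprSr.
  exact: mulr_swap4b.
have km1 : k = 1 %[mod e] by apply/eqP; rewrite -(eq_prim_root_expr prim) zk.
have {}mk : ((m * e).+1 <= k)%N.
  rewrite ltn_neqAle mk andbT; apply/eqP => kE.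
  move: km1; rewrite -kE modnMl modn_small ?rd_card_gt1 //.
have kE : k = (m * e + (k - (m * e).+1 + 1))%N.
  by rewrite addn1 -subSn // subSS subnKC // ltnW.
have /eqP : (k - (m * e).+1 + 1 = 0 + 1 %[mod e])%N by rewrite -km1 [in RHS]kE modnMDl.
rewrite eqn_modDr mod0n => /dvdnP[r rE].
exists (alpha ^+ (k - (m * e).+1) * q); split.
  by rewrite mulrA -exprD subnKC.
by rewrite poly_act_mul sq rE rd_alphaX_inv.
Qed.

Lemma semi_order_pred f : act s f = z ^+ e.-1 *: f -> mdvd (alpha ^+ e.-1) f.
Proof.
move=> sf; have [->|f0] := eqVneq f 0; first exact: mdvd0.
have [k [q [E nq]]] := lin_multiplicity a0 f0.
have [zk _] := semi_invariant a0 rd_z_neq0 sa rd_mul_a sf E nq.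
have : k = e.-1 %[mod e] by apply/eqP; rewrite -(eq_prim_root_expr prim) zk.
rewrite [(e.-1 %% e)%N]modn_small ?prednK ?cardG_gt0 // => km.
by rewrite E -km; apply/mdvd_mulr/mdvd_exp/leq_mod.
Qed.

(** The part of the coordinate [x_j] that vanishes at [u]. Together with [alpha] these [s]-invariant
    forms recover all coordinates. *)
Definition flat_form j : 'cV[K]_l := delta_mx j 0 - u 0 j *: a.

Lemma act_flat_form j : act s (lin (flat_form j)) = lin (flat_form j).
Proof.
rewrite poly_act_lin mulmxBr -scalemxAr rd_mul_a scalerA; congr lin.
case: rd => _ _ _ -> _ _; rewrite mulmxDl mul1mx -scalemxAl -mulmxA.
rewrite [u *m _](_ : _ = (u 0 j)%:M); last first.
  by apply/matrixP => p r; rewrite !ord1 -colE !mxE eqxx.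
rewrite mul_mx_scalar scalerA -addrA -scalerBl mulrBl mul1r mulrC.
by rewrite addrAC subrr add0r scaleNr.
Qed.

Lemma derv_flat_form chi j :
  derv chi (flat_form j) = chi 0 j - derv chi a * kfrac K l (u 0 j).
Proof.
rewrite /derv; under eq_bigr do rewrite !mxE rmorphB rmorphM mulrBr.
rewrite sumrB mulr_suml (bigD1 j) //= !eqxx rmorph1 mulr1 big1 ?addr0 => [|i ij].
  by congr (_ - _); apply: eq_bigr => i _; rewrite -mulrA; congr (_ * _); rewrite mulrC.
by rewrite (negPf ij) rmorph0 mulr0.
Qed.

Lemma rd_ordge_dt k y : act s y = y -> ordge alpha 0 (derF_app (dt k) y).
Proof.
move=> sy; apply: (ordge_derF faith (dt_integral FI dual k) a0).
exact: rd_fixer_inv.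
Qed.

Lemma derF_appXn delta f k :
  derF_app delta (f ^+ k.+1) = k.+1%:R * f%:F ^+ k * derF_app delta f.
Proof.
elim: k => [|k IH]; first by rewrite !expr1 expr0 !mul1r.
rewrite exprS derF_appM IH -tofracXn [f ^+ k.+1]exprS tofracM tofracXn.
rewrite [k.+2%:R]mulrS exprS.
by move: (derF_app delta f) => x; rewrite !mulrDl mul1r mulrC; congr (_ + _);
  rewrite !mulrA [f%:F * _]mulrC.
Qed.

Lemma kfrac_unit (c : K) : c != 0 -> ~ mdvd alpha c%:MP.
Proof.
move=> c0 [q E]; case: pa => _ + _; apply; exists (c^-1%:MP * q).
by rewrite -mulrA -E -mpolyCM mulVf.
Qed.

(** As [alpha^e] is fixed by [s], its derivative [e alpha^(e-1) dt_k(alpha)] is regular along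
    [alpha]. *)
Lemma rd_ordge_dt_alpha k : ordge alpha (1 - e%:Z) (derF_app (dt k) alpha).
Proof.
have : ordge alpha 0 (derF_app (dt k) (alpha ^+ e)).
  by apply: rd_ordge_dt; have := rd_alphaX_inv 1; rewrite mul1n.
rewrite -[e]prednK ?cardG_gt0 // derF_appXn -[_.+1%:R](rmorph_nat (kfrac K l)).
rewrite -mulrA mulrC => /(ordge_cancel pa (kfrac_unit (natr_neq0 _ _))).
rewrite exprnP (_ : 0 = e.-1%:Z + - e.-1%:Z); last by rewrite subrr.
move=> /(ordge_shift pa); congr ordge.
by rewrite -[e.-1.+1]addn1 PoszD opprD addrCA subrr addr0.
Qed.

Lemma rd_ordge_dt_semi k m q : act s q = q ->
  ordge alpha (m.+1%:Z - e%:Z) (derF_app (dt k) (alpha ^+ m.+1 * q)).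
Proof.
move=> sq; rewrite derF_appM derF_appXn; apply: (ordgeD pa).
  rewrite mulrC; apply: (ordge_tofracM pa).
  rewrite -mulrA -(rmorph_nat (@tofrac S)); apply: (ordge_tofracM pa).
  rewrite (_ : _ - _ = m%:Z + (1 - e%:Z)); last by rewrite -addn1 PoszD addrA.
  by rewrite exprnP; apply/(ordge_shift pa); apply: rd_ordge_dt_alpha.
rewrite tofracXn exprnP; have := rd_ordge_dt k sq.
move=> /(ordge_shift pa m.+1) H; apply: (ordge_le pa) H.
by rewrite addr0 gerBl.
Qed.

(** Under [s] the derivative of [y] along [u] has the eigenvalue [z^(-1) = z^(e-1)], so its order is
    [e - 1] modulo [e]. *)
Lemma dvd_der_const_field y : act s y = y ->
  mdvd (alpha ^+ e.-1) (der_app (const_field u) y).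
Proof.
move=> sy; apply: semi_order_pred; have := der_const_field rd_u_mul y; rewrite sy => E.
rewrite [in RHS]E scalerA -exprSr prednK ?cardG_gt0 //.
by rewrite (prim_expr_order prim) scale1r.
Qed.

(** In the direction [u], the pole of [chi] of order at most [e - 1] is compensated by the zero of
    the derivative of [y]; in the flat directions [chi] is regular. *)
Lemma ordge_pairing chi y : act s y = y -> ordge alpha (1 - e%:Z) (derv chi a) ->
  (forall j, ordge alpha 0 (derv chi (flat_form j))) ->
  ordge alpha 0 (derF_app chi y).
Proof.
move=> sy ca cj.
have -> : derF_app chi y = \sum_j derv chi (flat_form j) * y^`M(j)%:F
    + derv chi a * (der_app (const_field u) y)%:F.
  rewrite /derF_app /der_app rmorph_sum mulr_sumr -big_split; apply: eq_bigr => j _ /=.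
  by rewrite derv_flat_form mulrBl mxE tofracM mulrA -kfracE subrK.
apply: (ordgeD pa).
  apply: (ordge_sum pa) => j _; rewrite -[0]addr0; apply: (ordgeM pa) => //.
  exact: (ordge_tofrac pa).
rewrite (_ : 0 = (1 - e%:Z) + e.-1%:Z).
  by apply: (ordgeM pa ca); apply/(ordge_tofracP pa); apply: dvd_der_const_field.
by rewrite -[in e%:Z](prednK (cardG_gt0 (fixer_group rW a))) -addn1 PoszD opprD addrCA
  subrr addr0 addNr.
Qed.

Lemma inv_der_alpha theta : inv_der rW theta ->
  act s (der_app theta alpha) = z *: der_app theta alpha.
Proof. by move=> ti; rewrite -ti // rd_act_alpha der_appZ. Qed.

Lemma inv_der_order theta : inv_der rW theta ->
  exists q, der_app theta alpha = alpha * q /\ act s q = q.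
Proof.
move=> /inv_der_alpha/(semi_order (m := 0)); rewrite mul0n expr0 expr1.
by apply; exists (der_app theta alpha); rewrite mulr1.
Qed.

Lemma inv_der_flat theta j : inv_der rW theta ->
  act s (der_app theta (lin (flat_form j))) = der_app theta (lin (flat_form j)).
Proof. by move=> ti; rewrite -ti // act_flat_form. Qed.

End LocalAnalysis.

Section Nabla.
Variables (K : fieldType) (l : nat).
Implicit Types (chi delta : derF K l) (theta eta : derS K l) (a : 'cV[K]_l).

Lemma derv_nablaF delta eta a :
  derv (nablaF delta eta) a = derF_app delta (der_app eta (lin a)).
Proof.
rewrite der_app_lin raddf_sum; apply: eq_bigr => i _ /=.
by rewrite derF_appM derF_appC mulr0 addr0 mxE.
Qed.

Lemma derv_to_derF theta a : derv (to_derF theta) a = (der_app theta (lin a))%:F.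
Proof. by rewrite -derF_app_lin der_appE. Qed.

Definition jac_field eta : 'M[{mpoly K[l]}]_l := \matrix_(i, j) (eta 0 j)^`M(i).

Lemma nabla_jac_field delta eta :
  nablaF delta eta = delta *m map_mx (@tofrac {mpoly K[l]}) (jac_field eta).
Proof. by apply/rowP => j; rewrite !mxE; apply: eq_bigr => i _; rewrite !mxE. Qed.

End Nabla.

(** * Regularity of [nabla] in the directions of the invariants *)

Section GlobalAnalysis.
Variables (K : numClosedFieldType) (l : nat) (gT : finGroupType) (W : {group gT}).
Variable rW : mx_representation K W l.
Variables (t : 'I_l -> {mpoly K[l]}) (d : 'I_l -> nat) (dt : 'I_l -> derF K l).
Hypothesis faith : mx_faithful rW.
Hypothesis FI : fundamental_invariants rW t d.
Hypothesis dual : dual_derivations t dt.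
Variable roots : seq 'cV[K]_l.
Hypothesis rs : root_system rW roots.
Notation S := {mpoly K[l]}.
Notation F := {fraction {mpoly K[l]}}.
Notation act := (poly_act rW).
Implicit Types (f q y : S) (delta chi : derF K l) (theta eta psi : derS K l) (g : gT).
Implicit Types (a b : 'cV[K]_l).

Notation regular := (regular_off roots).
Let mR := @roots_prod_mult K l roots.

Lemma exists_reflection_data a : a \in roots -> exists s u z, reflection_data rW a s u z.
Proof.
by move=> ra; apply: fixer_reflection_data (root_neq0 rs ra) (root_fixer rs ra).
Qed.

Lemma regular_dt k y : regular (derF_app (dt k) y).
Proof.
apply: (regular_offP rs) => [|b b0 triv].
  exact: (lin_product_derF faith (dt_integral FI dual k)).
apply: (ordge_derF faith (dt_integral FI dual k) b0) => g.
by rewrite triv => /set1P ->; rewrite poly_act1.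
Qed.

Lemma regular_nabla_pairing k psi y :
  regular (derF_app (nablaF (dt k) psi) y).
Proof.
apply: (sloc_sum mR) => j _; rewrite mxE; apply: (slocM mR); first exact: regular_dt.
exact: (sloc_tofrac mR).
Qed.

Lemma nabla_equivariant k psi g (Phi : {rmorphism F -> F}) y : g \in W ->
  inv_der rW psi -> (forall f, Phi f%:F = (act g f)%:F) ->
  derF_app (nablaF (dt k) psi) (act g y) = Phi (derF_app (nablaF (dt k) psi) y).
Proof.
move=> Wg psi_inv PhiE; set chi := nablaF _ _.
pose phi : {rmorphism S -> F} := Phi \o (@tofrac S).
have d1 : derivation phi (fun y => derF_app chi (act g y)).
  split=> f q; first by rewrite poly_act_add raddfD.
  by rewrite poly_act_mul derF_appM /= !PhiE.
have d2 : derivation phi (fun y => Phi (derF_app chi y)).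
  split=> f q; first by rewrite raddfD (rmorphD Phi).
  by rewrite derF_appM (rmorphD Phi) !(rmorphM Phi).
rewrite (derivation_mpoly d1) => [|c]; last by rewrite poly_actC derF_appC.
rewrite [RHS](derivation_mpoly d2) => [|c]; last by rewrite derF_appC (rmorph0 Phi).
apply: eq_bigr => i _; congr (_ * _).
rewrite poly_actX derF_app_lin derv_nablaF -poly_actX psi_inv // der_appX.
by rewrite (dt_equivariant FI dual k _ Wg PhiE) derF_appX mxE.
Qed.

(** Since [psi(alpha)] is divisible by [alpha], the derivative [nabla_{dt k} psi] has a pole of
    order at most [e - 1], in the direction [u] only; paired with an invariant it is regular by
    [ordge_pairing]. *)
Lemma nabla_derR k psi i : inv_der rW psi ->
  exists2 r, invariant rW r & derF_app (nablaF (dt k) psi) (t i) = r%:F.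
Proof.
move=> psi_inv.
have [||r rE] := @regular_off_integral _ _ _ _ _ _ rs (derF_app (nablaF (dt k) psi) (t i)).
- exact: regular_nabla_pairing.
- move=> a ra; have [s [u [z rd]]] := exists_reflection_data ra.
  have Ws := fixer_in (rd_fixer rd).
  apply: (ordge_pairing rd); first exact: (t_inv FI).
    rewrite derv_nablaF; have [q [-> sq]] := inv_der_order rd psi_inv.
    by have := rd_ordge_dt_semi faith FI dual rd k 0 sq; rewrite expr1.
  move=> j; rewrite derv_nablaF; apply: (rd_ordge_dt faith FI dual rd).
  exact: (inv_der_flat rd).
exists r => // g Wg; have [Phi PhiE] := fraction_action rW Wg.
apply: tofrac_inj; rewrite -PhiE -rE -(nabla_equivariant _ _ Wg psi_inv PhiE).
by rewrite (t_inv FI).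
Qed.

(** By [semi_order] the order of [eta(alpha)] is even [(m + 1) e + 1], while differentiation by
    [dt k] costs at most [e]; so no pole arises in any direction. *)
Lemma nabla_inv_der k m eta : inv_der rW eta ->
  (forall a, a \in roots ->
     mdvd (lin a ^+ (m.+1 * #|fixer rW a|)) (der_app eta (lin a))) ->
  exists2 phi, inv_der rW phi & nablaF (dt k) eta = to_derF phi.
Proof.
move=> eta_inv eta_ord; pose chi := nablaF (dt k) eta.
have chi_int j : exists z, chi 0 j = z%:F.
  apply: (regular_off_integral rs); first by rewrite mxE; apply: regular_dt.
  move=> a ra; have [s [u [z rd]]] := exists_reflection_data ra.
  have pa := lin_prime (root_neq0 rs ra).
  have := derv_flat_form a u chi j => /eqP; rewrite -subr_eq opprK => /eqP <-.
  apply: (ordgeD pa).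
    rewrite derv_nablaF; apply: (rd_ordge_dt faith FI dual rd).
    exact: (inv_der_flat rd).
  rewrite mulrC; apply: (ordge_tofracM pa); rewrite derv_nablaF.
  have [q [-> sq]] := semi_order rd (inv_der_alpha rd eta_inv) (eta_ord a ra).
  apply: (ordge_le pa) (rd_ordge_dt_semi faith FI dual rd k _ sq).
  by rewrite subr_ge0 lez_nat mulSn -addnS leq_addr.
have [phi0 phiE] := fin_all_exists chi_int.
pose phi : derS K l := \row_j phi0 j.
have phiE' : chi = to_derF phi by apply/rowP => j; rewrite !mxE -phiE mxE.
exists phi => //; apply: inv_derP => g i Wg.
have [Phi PhiE] := fraction_action rW Wg; apply: tofrac_inj.
rewrite der_appE -phiE' (nabla_equivariant _ _ Wg eta_inv PhiE) -PhiE.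
by rewrite derF_appX -/chi phiE mxE.
Qed.

Lemma derF_dt_expansion delta : delta = \sum_i derF_app delta (t i) *: dt i.
Proof.
rewrite -[LHS]mulmx1 -(jac_dtmx dual) mulmxA; apply/rowP => j.
rewrite !mxE summxE; apply: eq_bigr => i _; rewrite !mxE; congr (_ * _).
by apply: eq_bigr => k _; rewrite mxE.
Qed.

Lemma derR_dt k : derR rW dt (dt k).
Proof.
exists (fun i => (k == i)%:R) => [i g _|]; first by rewrite rmorph_nat.
by rewrite {1}(derF_dt_expansion (dt k)); apply: eq_bigr => i _; rewrite dual rmorph_nat.
Qed.

Lemma invariant_der_t eta i : inv_der rW eta -> invariant rW (der_app eta (t i)).
Proof. by move=> eta_inv g Wg; rewrite -eta_inv // (t_inv FI). Qed.

Lemma derR_inv_der eta : inv_der rW eta -> derR rW dt (to_derF eta).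
Proof.
move=> eta_inv; exists (fun i => der_app eta (t i)) => [i|]; first exact: invariant_der_t.
by rewrite {1}(derF_dt_expansion (to_derF eta)); apply: eq_bigr => i _; rewrite der_appE.
Qed.

Definition jacS : 'M[S]_l := \matrix_(i, j) (t j)^`M(i).

Lemma jacE : jac t = map_mx (@tofrac S) jacS.
Proof. by apply/matrixP => i j; rewrite !mxE. Qed.

(** The combination of the rows with coefficients [u] consists of the derivatives of the [t j] along
    [u], which are divisible by [alpha^(e-1)]. Scaling this direction by [alpha^(1-e)] keeps the
    matrix regular. *)
Lemma det_jacS_dvd a : a \in roots -> mdvd (lin a ^+ #|fixer rW a|.-1) (\det jacS).
Proof.
move=> ra; have [s [u [z rd]]] := exists_reflection_data ra.
have pa := lin_prime (root_neq0 rs ra); have ua := rd_dual rd.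
set e1 := _.-1; apply/(ordge_tofracP pa).
rewrite -det_map_mx -jacE.
have : ordge (lin a) 0 (\det (scale_mx a u ((lin a)%:F ^ (- e1%:Z)) *m jac t)).
  apply/ordge0E/(sloc_det (nmdvd_mult pa)) => i j; rewrite -ordge0E.
  rewrite mulmxDl mul1mx -!scalemxAl -mulmxA !mxE big_ord1 !mxE.
  rewrite (eq_bigr (fun k => ((u 0 k)%:MP * (t j)^`M(k))%:F)); last first.
    by move=> k _; rewrite !mxE tofracM.
  rewrite -rmorph_sum /=; set c := \sum_k _.
  have cE : c = der_app (const_field u) (t j).
    by apply: eq_bigr => k _; rewrite mxE.
  apply: (ordgeD pa); first exact: (ordge_tofrac pa).
  rewrite mulrCA; apply: (ordge_tofracM pa); rewrite mulrBl mul1r.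
  apply: (ordgeB pa); last exact: (ordge_tofrac pa).
  rewrite -[0](addNr e1%:Z); apply/(ordge_shift pa)/(ordge_tofracP pa).
  rewrite cE; apply: (dvd_der_const_field rd).
  by apply: (t_inv FI); apply: fixer_in (rd_fixer rd).
rewrite det_mulmx det_scale_mx // -{1}[0](addNr e1%:Z).
by move/(ordge_shift pa).
Qed.

End GlobalAnalysis.

Lemma mulr_swap4c (A : comPzRingType) (x y b q : A) :
  x * y * b * q = y * (x * q * b).
Proof. by ring. Qed.

(** * The pole of the primitive vector field *)

Section PrimitiveField.
Variables (K : numClosedFieldType) (n : nat) (gT : finGroupType) (W : {group gT}).
Notation l := n.+1.
Variable rW : mx_representation K W l.
Variables (t : 'I_l -> {mpoly K[l]}) (d : 'I_l -> nat) (dt : 'I_l -> derF K l).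
Variable nablaDinv : derF K l -> derS K l.
Hypothesis faith : mx_faithful rW.
Hypothesis FI : fundamental_invariants rW t d.
Hypothesis dual : dual_derivations t dt.
Notation D := (dt ord_max).
Notation h := (d ord_max).
Hypothesis nD : nablaD_inverse rW dt D nablaDinv.
Variable roots : seq 'cV[K]_l.
Hypothesis rs : root_system rW roots.
Notation S := {mpoly K[l]}.
Notation F := {fraction {mpoly K[l]}}.
Notation act := (poly_act rW).
Implicit Types (f q y : S) (delta chi : derF K l) (theta eta psi : derS K l) (g : gT).
Implicit Types (a b : 'cV[K]_l).

Lemma nablaD_inj eta eta' : inv_der rW eta -> inv_der rW eta' ->
  nablaF D eta = nablaF D eta' -> eta = eta'.
Proof.
case: nD => nD1 _ eta_inv eta_inv' E.
by rewrite -(nD1 _ eta_inv).2 E (nD1 _ eta_inv').2.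
Qed.

Lemma nablaD_surj delta : derR rW dt delta ->
  exists2 eta, inv_der rW eta & nablaF D eta = delta.
Proof. by case: nD => _ nD2 /nD2[? ?]; exists (nablaDinv delta). Qed.

(* Otherwise [D] would not lower the order along the hyperplane of [a] enough
   for [nablaD] to reach all the [dt i], whose determinant has order [1 - e]. *)
Lemma primitive_pole a s u z : a \in roots -> reflection_data rW a s u z ->
  ~ ordge (lin a) (2%:Z - #|fixer rW a|%:Z) (derF_app D (lin a)).
Proof.
move=> ra rd; set e := #|_| => Da.
have pa := lin_prime (root_neq0 rs ra); have ua := rd_dual rd.
have e1 : (1 < e)%N := rd_card_gt1 rd.
have det_dt : ordge (lin a) (2%:Z - e%:Z) (\det (dtmx dt)).
  apply: (ordge_det ua) => [i|i j].
    have [eta eta_inv Eeta] := nablaD_surj (derR_dt rW dual i).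
    rewrite rowK -Eeta derv_nablaF; have [q [-> sq]] := inv_der_order rd eta_inv.
    rewrite derF_appM; apply: (ordgeD pa).
      by rewrite mulrC; apply: (ordge_tofracM pa).
    apply: (ordge_le pa (k := 1 + 0)); first by move: e1; lia.
    by apply: (ordgeM pa (ordge_self pa)); apply: (rd_ordge_dt faith FI dual rd).
  rewrite mxE rowK -derv_flat_form -derF_app_lin.
  by apply: (rd_ordge_dt faith FI dual rd); apply: (act_flat_form rd).
have /(ordge_tofracP pa) det_J := det_jacS_dvd faith FI rs ra.
(* The product of the two determinants is 1, yet its order would be at least
   [(2 - e) + (e - 1) = 1]. *)
have := ordgeM pa det_dt det_J.
rewrite -det_map_mx -jacE -det_mulmx dtmx_jac // det1 -tofrac1.
rewrite -/e (_ : _ + _ = 1%:Z); last first.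
  by move: e1; rewrite -subn1; lia.
by move/(ordge_tofracP pa 1%N); rewrite expr1; case: pa.
Qed.

(** Let [eta'(alpha) = alpha^k q] with [q] prime to [alpha]. If [k <= (m + 1) e], then in [D(alpha^k
    q) = k alpha^(k-1) q D(alpha) + alpha^k D(q)] the order [m e + 1] of the left side forces
    [D(alpha)] to have order at least [2 - e], against [primitive_pole]. *)
Lemma nablaD_order m eta eta' a : a \in roots -> inv_der rW eta' ->
  nablaF D eta' = to_derF eta ->
  mdvd (lin a ^+ (m * #|fixer rW a|).+1) (der_app eta (lin a)) ->
  mdvd (lin a ^+ (m.+1 * #|fixer rW a|).+1) (der_app eta' (lin a)).
Proof.
move=> ra eta_inv Eeta; have [s [u [z rd]]] := exists_reflection_data faith rs ra.
have a0 := root_neq0 rs ra; have pa := lin_prime a0; have e1 := rd_card_gt1 rd.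
have : derF_app D (der_app eta' (lin a)) = (der_app eta (lin a))%:F.
  by rewrite -derv_nablaF Eeta derv_to_derF.
move: (der_app eta (lin a)) (der_app eta' (lin a)) (inv_der_alpha rd eta_inv).
move=> f f' sf Df /(ordge_tofracP pa); rewrite -Df.
have [->|f0] := eqVneq f' 0; first by move=> _; apply: mdvd0.
have [k [q [E nq]]] := lin_multiplicity a0 f0.
have [_ sq] := semi_invariant (j := 1%N) a0 (rd_z_neq0 rd) (rd_fixer rd) (rd_mul_a rd) sf E nq.
case: (ltnP (m.+1 * #|fixer rW a|) k) => [mk|km] ordD.
  by rewrite E; apply/mdvd_mulr/mdvd_exp.
(* The order [k = 0] is excluded because an invariant field maps [alpha] to a multiple of
   [alpha]. *)
case: k => [|k] in E km *.
  rewrite expr0 mul1r in E; case: nq; rewrite -E.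
  have [|r [-> _]] := semi_order (m := 0%N) rd sf.
    by exists f'; rewrite mul0n expr0 mulr1.
  by rewrite mul0n expr1; apply/mdvd_mulr/mdvd_refl.
case: (primitive_pole ra rd).
move: ordD; rewrite E derF_appM derF_appXn tofracXn.
rewrite [_ + _](_ : _ = (lin a)%:F ^ k%:Z * (k.+1%:R * q%:F * derF_app D (lin a)
   + (lin a)%:F * derF_app D q)); last first.
  rewrite -exprnP exprS mulrDr; congr (_ + _); first exact: mulr_swap4c.
  by rewrite mulrA [_ ^+ k * _]mulrC.
set e := #|_| in km e1 *; rewrite (_ : Posz _ = k%:Z + ((m * e).+1%:Z - k%:Z)); last first.
  by rewrite addrC subrK.
move=> /(ordge_shift pa) H.
have {}H : ordge (lin a) (2%:Z - e%:Z) (k.+1%:R * q%:F * derF_app D (lin a)).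
  rewrite -[X in ordge _ _ X](addrK ((lin a)%:F * derF_app D q)).
  apply: (ordgeB pa).
    apply: (ordge_le pa) H.
    by move: km; rewrite mulSn; lia.
  apply: (ordge_le pa (k := 1 + 0)).
    by move: e1; lia.
  by apply: (ordgeM pa (ordge_self pa)); apply: (rd_ordge_dt faith FI dual rd).
move: H; rewrite mulrC => H.
apply: (ordge_cancel pa nq); apply: (ordge_cancel pa (kfrac_unit rd (natr_neq0 K k))).
by rewrite -kfracE (rmorph_nat (kfrac K l)) -mulrA [_ * k.+1%:R]mulrC.
Qed.

End PrimitiveField.

(** * Iterates of the inverse of the primitive derivation *)

Section PrimitiveSequence.
Variables (K : numClosedFieldType) (n : nat) (gT : finGroupType) (W : {group gT}).
Notation l := n.+1.
Variable rW : mx_representation K W l.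
Variables (t : 'I_l -> {mpoly K[l]}) (d : 'I_l -> nat) (dt : 'I_l -> derF K l).
Variable nablaDinv : derF K l -> derS K l.
Hypothesis faith : mx_faithful rW.
Hypothesis FI : fundamental_invariants rW t d.
Hypothesis dual : dual_derivations t dt.
Notation D := (dt ord_max).
Notation h := (d ord_max).
Hypothesis nD : nablaD_inverse rW dt D nablaDinv.
Variable roots : seq 'cV[K]_l.
Hypothesis rs : root_system rW roots.
Notation S := {mpoly K[l]}.
Notation F := {fraction {mpoly K[l]}}.
Notation act := (poly_act rW).
Notation eulerS := (eulerS K l).
Notation "p \oT" := (p \mPo [tuple t i | i < l]) (at level 2, format "p \oT").
Implicit Types (f q y : S) (delta chi : derF K l) (theta eta psi phi : derS K l) (g : gT).
Implicit Types (a b : 'cV[K]_l).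

Lemma der_app_eulerS_lin b : der_app eulerS (lin b) = lin b.
Proof. by have /euler_homog -> := lin_homog b; rewrite scale1r. Qed.

Lemma inv_der_euler : inv_der rW eulerS.
Proof.
by apply: inv_derP => g i Wg; rewrite poly_actX der_app_eulerS_lin mxE poly_actX.
Qed.

Lemma inv_der0 : inv_der rW (0 : derS K l).
Proof.
move=> g f Wg; have z y : der_app (0 : derS K l) y = 0.
  by apply: big1 => i _; rewrite mxE mul0r.
by rewrite !z rmorph0.
Qed.

Lemma nablaF0 delta : nablaF delta (0 : derS K l) = 0.
Proof. by apply/rowP => j; rewrite !mxE raddf0. Qed.

(** Applying the operator [eulerS - (c + h)] to the coefficients of [eta] gives another invariant
    field. The relation [[eulerS, D] = -h D] shows that [nabla_D] annihilates it, so it is 0 by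
    injectivity of [nabla_D]. *)
Lemma eigen_lift (c : K) eta : inv_der rW eta ->
  (forall j, eigen c (derF_app D (eta 0 j))) ->
  forall j, eigen (c + h%:R) (eta 0 j)%:F.
Proof.
move=> eta_inv eta_c; pose L f : S := der_app eulerS f - (c + h%:R) *: f.
pose eta' : derS K l := \row_j L (eta 0 j).
have LD f f' : L (f + f') = L f + L f'.
  by rewrite /L raddfD scalerDr /= opprD addrACA.
have LZ f k : L (f * k%:MP) = L f * k%:MP.
  by rewrite /L der_appM der_appC mulr0 addr0 mulrBl scalerAl.
have L_act f g : g \in W -> L (act g f) = act g (L f).
  by move=> Wg; rewrite /L inv_der_euler // rmorphB /= poly_actZ.
have eta'_lin b : der_app eta' (lin b) = L (der_app eta (lin b)).
  rewrite !der_app_lin (big_morph L LD (id1 := 0)).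
    by apply: eq_bigr => i _; rewrite mxE LZ.
  by rewrite /L raddf0 scaler0 subr0.
have eta'_inv : inv_der rW eta'.
  apply: inv_derP => g i Wg; rewrite poly_actX eta'_lin -poly_actX eta_inv //.
  by rewrite der_appX L_act // mxE.
suff eta'0 : eta' = 0.
  move=> j; rewrite /eigen eulerF_tofrac kfracE -tofracM mul_mpolyC; congr tofrac.
  by apply/eqP; rewrite -subr_eq0; apply/eqP; have /rowP/(_ j) := eta'0; rewrite !mxE.
apply: (nablaD_inj nD eta'_inv inv_der0); rewrite nablaF0.
apply/rowP => j; rewrite !mxE /L raddfB /= -mul_mpolyC derF_appM derF_appC mul0r add0r.
rewrite -!fder_tofrac -eulerF_tofrac.
have := eulerF_dt_comm FI dual ord_max (eta 0 j)%:F; rewrite fder_tofrac.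
have := eta_c j; rewrite /eigen => -> /eqP; rewrite eq_sym subr_eq => /eqP ->.
by rewrite -kfracE (rmorphD (kfrac K l)) (rmorph_nat (kfrac K l)) mulrDl subrr.
Qed.

Variables (Xi : nat -> derS K l) (c0 : K).
Hypothesis c0_neq0 : c0 != 0.
Hypothesis Xi0 : Xi 0 = c0%:MP *: eulerS.
Hypothesis Xi_inv : forall m, inv_der rW (Xi m.+1).
Hypothesis XiS : forall m, nablaF D (Xi m.+1) = to_derF (Xi m).

Lemma Xi_order m a : a \in roots ->
  mdvd (lin a ^+ (m * #|fixer rW a|).+1) (der_app (Xi m) (lin a)).
Proof.
move=> ra; elim: m => [|m IH]; last exact: (nablaD_order faith FI dual nD rs ra (Xi_inv m) (XiS m)).
by rewrite mul0n expr1 Xi0 der_appZl der_app_eulerS_lin; apply/mdvd_mull/mdvd_refl.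
Qed.

Lemma Xi_eigen m j : eigen ((m * h).+1%:R) (Xi m 0 j)%:F.
Proof.
elim: m j => [|m IH] j.
  rewrite mul0n Xi0 !mxE tofracM -kfracE; apply: eigenZ; apply/eigen_tofrac.
  by rewrite -lin_delta; apply: lin_homog.
rewrite (_ : _%:R = (m * h).+1%:R + h%:R); last by rewrite -natrD addSn mulSn addnC.
apply: eigen_lift => // i; have /rowP/(_ i) := XiS m; rewrite !mxE => ->.
exact: IH.
Qed.

Lemma Xi_nabla_exists m k :
  exists2 phi, inv_der rW phi & nablaF (dt k) (Xi m.+1) = to_derF phi.
Proof.
apply: (nabla_inv_der faith FI dual rs k (m := m)) => // a ra.
by apply: mdvd_trans (Xi_order m.+1 ra); apply/mdvd_exp/leqnSn.
Qed.

(** The [dt k] commute, and [nabla_D] maps [Xi m.+1] to [Xi m]. *)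
Lemma Xi_nabla_comm m k phi : nablaF (dt k) (Xi m.+1) = to_derF phi ->
  nablaF D phi = nablaF (dt k) (Xi m).
Proof.
move=> E; apply/rowP => j; rewrite !mxE; have /rowP/(_ j) := E; rewrite !mxE => Ej.
rewrite -!fder_tofrac -Ej -fder_tofrac (fder_dual_comm dual); congr fder.
by have /rowP/(_ j) := XiS m; rewrite !mxE -fder_tofrac.
Qed.

Lemma Xi_nabla_eigen m k phi j : nablaF (dt k) (Xi m.+1) = to_derF phi ->
  eigen ((m.+1 * h).+1%:R - (d k)%:R) (phi 0 j)%:F.
Proof.
move=> /rowP/(_ j); rewrite !mxE => <-; rewrite -fder_tofrac.
by apply: (eigen_dt FI dual); apply: Xi_eigen.
Qed.

Definition max_point (i : 'I_l) : K := (i == ord_max)%:R.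

Lemma h_gt0 : (0 < h)%N.
Proof.
rewrite lt0n; apply/eqP => h0; have := t_homog FI ord_max; rewrite h0.
move=> /eigen_tofrac/eigen0_const[c E].
have := @comp_t_inj _ _ _ _ _ _ _ FI 'X_ord_max c%:MP.
rewrite comp_tX comp_mpolyC => /(_ E) /(congr1 (mcoeff U_(ord_max))).
rewrite mcoeffXU eqxx mcoeffC mnm1_eq0 mulr0 => /eqP.
by rewrite oner_eq0.
Qed.

Lemma d_le_h i : (d i <= h)%N.
Proof. by case: FI => _ + _ _ _; apply; rewrite -ltnS ltn_ord. Qed.

(* Modulo [t_k] for [k < l] the Euler field is [h t_l D], so that there the
   matrix of the [nabla_{dt j} (Xi m)] is diagonal, by induction on [m]. *)
Lemma Xi_nabla_matrix m : exists2 c : 'I_l -> K, forall j, c j != 0 &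
  forall j i, exists2 p, derF_app (nablaF (dt j) (Xi m)) (t i) = (p \oT)%:F
    & p.@[max_point] = c j * (j == i)%:R.
Proof.
elim: m => [|m [c c_neq0 IH]].
  exists (fun _ => c0) => // j i; exists (c0 * (j == i)%:R)%:MP; last exact: mevalC.
  rewrite comp_mpolyC -kfracE rmorphM rmorph_nat -dual.
  rewrite /derF_app mulr_sumr; apply: eq_bigr => k _; rewrite mxE Xi0 !mxE.
  by rewrite derF_appM derF_appC mul0r add0r derF_appX mulrA.
(* The degree of the coefficients of [nabla_{dt j} (Xi m.+1)]; it is positive because [d j <= h]. *)
pose kap j : K := (m.+1 * h).+1%:R - (d j)%:R.
have kap_neq0 j : kap j != 0.
  rewrite /kap -natrB ?pnatr_eq0; last by rewrite mulSn; move: (d_le_h j); lia.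
  by rewrite -lt0n mulSn; move: (d_le_h j); lia.
exists (fun j => h%:R / kap j * c j) => [j|j i].
  by rewrite !mulf_neq0 ?invr_eq0 ?pnatr_eq0 -?lt0n ?h_gt0.
have [phi phi_inv Ephi] := Xi_nabla_exists m j.
have [p Ep] := invariant_comp_t FI (invariant_der_t FI i phi_inv).
exists p; first by rewrite Ephi -der_appE Ep.
(* Terms with a factor [t_k] drop out at [max_point] only if their cofactors are polynomials in the
   invariants. *)
have qP k : exists q, derF_app (nablaF (dt k) phi) (t i) = (q \oT)%:F.
  have [r r_inv ->] := nabla_derR faith FI dual rs k i phi_inv.
  by have [q ->] := invariant_comp_t FI r_inv; exists q.
have [q qE] := fin_all_exists qP.
have [p' p'E p'max] := IH j i.
have qmax : q ord_max = p'.
  apply: (comp_t_inj FI); apply: tofrac_inj; rewrite -qE -p'E.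
  by rewrite (Xi_nabla_comm Ephi).
(* Euler's identity [kap_j phi = sum_k d_k t_k nabla_{dt k} phi], paired with [t i] and written in
   the polynomial ring of the invariants. *)
have main : kap j *: p = \sum_k (d k)%:R *: ('X_k * q k).
  apply: (comp_t_inj FI); apply: tofrac_inj.
  rewrite comp_mpolyZ -Ep -mul_mpolyC tofracM der_appE -kfracE.
  rewrite (rmorph_sum (comp_mpoly _)) rmorph_sum /=.
  transitivity (\sum_k (d k)%:R * (t k)%:F * derF_app (nablaF (dt k) phi) (t i)); last first.
    apply: eq_bigr => k _; rewrite qE comp_mpolyZ (rmorphM (comp_mpoly _)) /= comp_tX.
    by rewrite -mul_mpolyC !tofracM -kfracE (rmorph_nat (kfrac K l)) mulrA.
  rewrite /derF_app mulr_sumr; under [RHS]eq_bigr do rewrite mulr_sumr.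
  rewrite exchange_big /=; apply: eq_bigr => x _; rewrite mxE.
  have := Xi_nabla_eigen x Ephi; rewrite /eigen -/(kap j) (eulerF_dt FI dual) mulrA => <-.
  rewrite mulr_suml; apply: eq_bigr => k _; rewrite mxE fder_tofrac.
  by rewrite !mulrA.
(* Only the last term survives; there [nabla_D phi] is [nabla_{dt j} (Xi m)], whence the factor
   [h / kap j]. *)
have := congr1 (meval max_point) main; rewrite mevalZ raddf_sum /=.
rewrite (bigD1 ord_max) //= big1 ?addr0 => [|k kmax]; last first.
  by rewrite mevalZ mevalM mevalXU /max_point (negPf kmax) mul0r mulr0.
rewrite mevalZ mevalM mevalXU /max_point eqxx mul1r qmax -/max_point p'max => E.
apply: (mulfI (kap_neq0 j)); rewrite E.
by rewrite -!mulrA [RHS]mulrCA mulVKf.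
Qed.

Lemma det_jac_Xi_neq0 m : \det (jac_field (Xi m)) != 0.
Proof.
have [c c_neq0 pP] := Xi_nabla_matrix m.
have {pP} [p pP] := fin_all_exists (fun j => fin_all_exists (fun i =>
  let: ex_intro2 p E V := pP j i in ex_intro (fun p => _ /\ _) p (conj E V))).
pose P : 'M[S]_l := \matrix_(j, i) p j i.
pose T := [tuple t i | i < l].
have PE : map_mx (@tofrac S) (map_mx (comp_mpoly T) P) =
    dtmx dt *m map_mx (@tofrac S) (jac_field (Xi m)) *m jac t.
  apply/matrixP => j i; rewrite !mxE -(pP j i).1 /derF_app nabla_jac_field.
  apply: eq_bigr => k _; congr (_ * _); last by rewrite mxE.
  by rewrite !mxE; apply: eq_bigr => x _; rewrite !mxE.
have : \det P != 0.
  apply/eqP => P0; have := congr1 (meval max_point) P0; rewrite raddf0 /= -det_map_mx.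
  rewrite (_ : map_mx _ P = diag_mx (\row_j c j)).
    by rewrite det_diag => /eqP/prodf_eq0[j _]; rewrite mxE (negPf (c_neq0 j)).
  apply/matrixP => j i; rewrite !mxE /= (pP j i).2.
  by case: eqP => [->|_]; rewrite ?mulr1n ?mulr1 ?mulr0n ?mulr0.
apply: contra => /eqP J0; apply/eqP/(comp_t_inj FI)/tofrac_inj.
rewrite comp_mpoly0 tofrac0 -[X in X%:F]det_map_mx -[LHS]det_map_mx PE.
by rewrite !det_mulmx det_map_mx J0 rmorph0 mulr0 mul0r.
Qed.

End PrimitiveSequence.

(** * The Coxeter number *)

Section GradedBasis.
Variables (K : numClosedFieldType) (n : nat) (gT : finGroupType) (W : {group gT}).
Notation l := n.+1.
Variable rW : mx_representation K W l.
Variables (t : 'I_l -> {mpoly K[l]}) (d : 'I_l -> nat) (dt : 'I_l -> derF K l).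
Variable nablaDinv : derF K l -> derS K l.
Hypothesis faith : mx_faithful rW.
Hypothesis FI : fundamental_invariants rW t d.
Hypothesis dual : dual_derivations t dt.
Notation D := (dt ord_max).
Notation h := (d ord_max).
Hypothesis nD : nablaD_inverse rW dt D nablaDinv.
Notation S := {mpoly K[l]}.
Notation F := {fraction {mpoly K[l]}}.
Notation act := (poly_act rW).
Implicit Types (f q y : S) (delta chi : derF K l) (theta eta psi : derS K l) (g : gT).
Implicit Types (a b : 'cV[K]_l).

Variable phi : 'I_l -> derS K l.
Hypothesis phi_inv : forall k, inv_der rW (phi k).
Hypothesis phi_eigen : forall k j, eigen (h.+1%:R - (d k)%:R) (phi k 0 j)%:F.

Definition field_mx : 'M[S]_l := \matrix_(k, j) phi k 0 j.

Hypothesis det_phi : \det field_mx != 0.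

Definition der_span psi : Prop := exists r : 'I_l -> S, psi = \sum_i r i *: phi i.

Lemma der_span0 : der_span 0.
Proof. by exists (fun _ => 0); rewrite big1 // => i _; rewrite scale0r. Qed.

Lemma der_spanD psi psi' : der_span psi -> der_span psi' -> der_span (psi + psi').
Proof.
move=> [r ->] [r' ->]; exists (fun i => r i + r' i); rewrite -big_split.
by apply: eq_bigr => i _; rewrite scalerDl.
Qed.

Lemma der_spanZ f psi : der_span psi -> der_span (f *: psi).
Proof.
move=> [r ->]; exists (fun i => f * r i); rewrite scaler_sumr.
by apply: eq_bigr => i _; rewrite scalerA.
Qed.

Lemma der_span_sum (I : Type) (s : seq I) (P : pred I) (psi : I -> derS K l) :
  (forall i, P i -> der_span (psi i)) -> der_span (\sum_(i <- s | P i) psi i).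
Proof. by move=> psiP; apply: big_ind => //; [exact: der_span0 | exact: der_spanD]. Qed.

Lemma phi_free (r : 'I_l -> S) : \sum_i r i *: phi i = 0 -> forall i, r i = 0.
Proof.
move=> E i; pose v : 'rV[S]_l := \row_i r i.
have : v *m field_mx = 0.
  rewrite -E; apply/rowP => j; rewrite mxE summxE.
  by apply: eq_bigr => k _; rewrite !mxE.
move=> /(congr1 (mulmx^~ (\adj field_mx))); rewrite -mulmxA mul_mx_adj mul0mx.
rewrite mul_mx_scalar => /rowP/(_ i)/eqP; rewrite !mxE mulf_eq0 (negPf det_phi).
by move=> /eqP.
Qed.

Lemma inv_derD eta eta' : inv_der rW eta -> inv_der rW eta' -> inv_der rW (eta + eta').
Proof.
move=> eta_inv eta'_inv; apply: inv_derP => g i Wg.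
rewrite poly_actX der_app_lin mxE poly_act_add.
have := eta_inv g 'X_i Wg; have := eta'_inv g 'X_i Wg.
rewrite poly_actX !der_app_lin !der_appX => <- <-; rewrite -big_split.
by apply: eq_bigr => k _; rewrite mxE mulrDl.
Qed.

Lemma inv_derZ f eta : invariant rW f -> inv_der rW eta -> inv_der rW (f *: eta).
Proof.
move=> f_inv eta_inv g y Wg.
by rewrite !der_appZl eta_inv // poly_act_mul f_inv.
Qed.

Lemma inv_der_sum (I : Type) (s : seq I) (P : pred I) (eta : I -> derS K l) :
  (forall i, P i -> inv_der rW (eta i)) -> inv_der rW (\sum_(i <- s | P i) eta i).
Proof. by move=> etaP; apply: big_ind => //; [exact: inv_der0 | exact: inv_derD]. Qed.

Lemma const_invariant c : invariant rW c%:MP.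
Proof. by move=> g _; apply: poly_actC. Qed.

Lemma eigen_mderiv c f j : eigen c f%:F -> eigen (c - 1) (f^`M(j))%:F.
Proof.
rewrite /eigen !eulerF_tofrac !kfracE -!tofracM => /tofrac_inj E; congr tofrac.
have := congr1 (mderiv j) E; rewrite mderiv_mulC mpolyCB mulrBl mpolyC1 mul1r => <-.
rewrite /der_app raddf_sum /=.
under [X in _ = X - _]eq_bigr do rewrite mderivM mxE mderivXU mderiv_comm.
have deltaE : \sum_i (i == j)%:R * f^`M(i) = f^`M(j).
  rewrite (bigD1 j) //= eqxx mul1r big1 ?addr0 // => i ij.
  by rewrite (negPf ij) mul0r.
rewrite big_split /= deltaE addrAC subrr add0r; apply: eq_bigr => i _.
by rewrite mxE.
Qed.

Definition graded p psi : Prop :=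
  inv_der rW psi /\ forall j, eigen (p%:R : K) (psi 0 j)%:F.

Lemma nablaF_add delta eta eta' :
  nablaF delta (eta + eta') = nablaF delta eta + nablaF delta eta'.
Proof. by apply/rowP => j; rewrite !mxE raddfD. Qed.

Lemma nablaF_const delta c eta :
  nablaF delta (c%:MP *: eta) = (c%:MP)%:F *: nablaF delta eta.
Proof. by apply/rowP => j; rewrite !mxE derF_appM derF_appC mul0r add0r. Qed.

Lemma nablaF_sum delta (I : Type) (s : seq I) (P : pred I) (eta : I -> derS K l) :
  nablaF delta (\sum_(i <- s | P i) eta i) = \sum_(i <- s | P i) nablaF delta (eta i).
Proof.
apply: (big_morph (nablaF delta)); first exact: nablaF_add.
exact: nablaF0.
Qed.

Lemma graded_step p psi : graded p psi -> exists psi', graded p psi' /\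
  exists r, psi' = \sum_i r i *: phi i /\ nablaF D psi = \sum_i (r i)%:F *: dt i.
Proof.
move=> [psi_inv psi_p]; case: nD => /(_ _ psi_inv)[[r r_inv E] _] _.
exists (\sum_i r i *: phi i); split; last by exists r.
split=> [|j]; first by apply: inv_der_sum => i _; apply: inv_derZ.
rewrite summxE rmorph_sum; apply: eigen_sum => i _ /=; rewrite mxE tofracM.
(* The degree [p - h + d_i - 1] of [r i], which is [nabla_D psi] applied to [t i], plus the degree
   [h + 1 - d_i] of [phi i]. *)
rewrite (_ : p%:R = (p%:R - h%:R + ((d i)%:R - 1)) + (h.+1%:R - (d i)%:R)).
  apply: eigenM => //; have -> : (r i)%:F = derF_app (nablaF D psi) (t i).
    rewrite E /derF_app; under [RHS]eq_bigr do rewrite summxE mulr_suml.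
    rewrite exchange_big (bigD1 i) //=.
    under eq_bigr do rewrite mxE -mulrA; rewrite -mulr_sumr -/(derF_app (dt i) (t i)).
    rewrite dual eqxx mulr1 big1 ?addr0 // => k ki.
    under eq_bigr do rewrite mxE -mulrA; rewrite -mulr_sumr -/(derF_app (dt k) (t i)).
    by rewrite dual (negPf ki) mulr0.
  apply: eigen_sum => k _; rewrite mxE; apply: eigenM.
    by rewrite -fder_tofrac; apply: (eigen_dt FI dual).
  by apply: eigen_mderiv; apply/eigen_tofrac/(t_homog FI).
by rewrite -[h.+1]addn1 natrD; ring.
Qed.

(* The map sending [psi] to [sum_i r_i phi_i], where [nablaD psi] is
   [sum_i r_i d/dt_i], is injective and preserves the degree; as the invariant
   derivations of a given degree form a finite-dimensional space, it is also
   surjective on them. *)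
Lemma graded_span p psi : graded p psi -> der_span psi.
Proof.
have step x : exists y : derS K l, graded p x -> graded p y /\
    exists r, y = \sum_i r i *: phi i /\ nablaF D x = \sum_i (r i)%:F *: dt i.
  case: (boolp.EM (graded p x)) => [gx|ngx]; last by exists 0.
  by have [x' x'P] := graded_step gx; exists x'.
have [L LP] := boolp.choice step.
(* Only the iterates of [L] at [psi] are used, so linearity of [L] need not be established. They lie
   in a finite-dimensional space and satisfy a linear relation. *)
move=> psi_p; pose Psi k := iter k L psi.
have Psi_p k : graded p (Psi k) by elim: k => //= k /LP[].
pose comb N (c : nat -> K) j := \sum_(k < N) (c k)%:MP *: Psi (k + j)%N.
(* Injectivity along the iterates: as the [phi i] are free, a relation among the [Psi k.+1] carries
   over to the [nabla_D (Psi k)], hence to the [Psi k]. *)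
have comb_shift N c : comb N c 1%N = 0 -> comb N c 0%N = 0.
  move=> E; have [r rP] : exists r : nat -> 'I_l -> S, forall k,
      Psi k.+1 = \sum_i r k i *: phi i /\ nablaF D (Psi k) = \sum_i (r k i)%:F *: dt i.
    have [r rP] := boolp.choice (fun k => (LP _ (Psi_p k)).2).
    by exists r.
  have r0 i : \sum_(k < N) (c k)%:MP * r k i = 0.
    move: i; apply: (@phi_free (fun i => \sum_(k < N) (c k)%:MP * r k i)).
    rewrite -[RHS]E /comb.
    under [LHS]eq_bigr do rewrite scaler_suml.
    rewrite exchange_big /=; apply: eq_bigr => k _; rewrite addn1 (rP k).1 scaler_sumr.
    by apply: eq_bigr => i _; rewrite scalerA.
  apply: (nablaD_inj nD) (@inv_der0 _ _ _ _ rW) _.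
    apply: inv_der_sum => k _; apply: inv_derZ; first exact: const_invariant.
    by case: (Psi_p (k + 0)%N).
  rewrite nablaF0 /comb nablaF_sum.
  under eq_bigr do rewrite nablaF_const addn0 (rP _).2 scaler_sumr.
  rewrite exchange_big /= big1 // => i _.
  under eq_bigr do rewrite scalerA -tofracM.
  by rewrite -scaler_suml -rmorph_sum r0 rmorph0 scale0r.
(* Leading zero coefficients are removed by [comb_shift]; once the coefficient of [Psi 0 = psi] is
   non-zero, [psi] is a combination of later iterates, which lie in the span by construction. *)
have dep N c : (exists2 k, (k < N)%N & c k != 0) -> comb N c 0%N = 0 -> der_span psi.
  elim: N c => [|N IH] c [k kN ck]; first by [].
  rewrite /comb big_ord_recl /= => E.
  have [c0|c0] := eqVneq (c 0%N) 0.
    case: k kN ck => [|k] kN ck; first by rewrite c0 eqxx in ck.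
    apply: (IH (fun k => c k.+1)); first by exists k.
    apply: comb_shift; rewrite -[RHS]E c0 mpolyC0 scale0r add0r.
    by apply: eq_bigr => i _; rewrite /bump /= addn1 addn0.
  have -> : psi = (- (c 0%N)^-1)%:MP *:
      (\sum_(i < N) (c (bump 0 i))%:MP *: Psi (bump 0 i + 0)%N).
    move/eqP: E; rewrite addrC addr_eq0 => /eqP ->; rewrite scalerN mpolyCN scaleNr opprK.
    by rewrite scalerA -mpolyCM mulVf // mpolyC1 scale1r.
  apply: der_spanZ; apply: der_span_sum => i _; apply: der_spanZ; rewrite /bump /= addn0.
  by have [_ [r [-> _]]] := LP _ (Psi_p i); exists r.
(* The columns are indexed by component and monomial of degree at most [p]; one row more than
   columns yields a non-zero left kernel vector. *)
pose I : finType := ('I_l * 'X_{1..l < p.+1})%type.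
pose ev (x : 'I_#|I|) : 'I_l * 'X_{1..l < p.+1} := enum_val x.
pose A : 'M[K]_(#|I|.+1, #|I|) :=
  \matrix_(k, x) (Psi k 0 (ev x).1)@_((ev x).2).
have nzA : nz_row (kermx A) != 0.
  rewrite nz_row_eq0 kermx_eq0; apply/negP => /eqP rA.
  by have := rank_leq_col A; rewrite rA ltnn.
set v := nz_row _ in nzA.
have vA : v *m A = 0.
  by apply/sub_kermxP; rewrite /v; apply: nz_row_sub.
apply: (dep #|I|.+1 (fun k => v 0 (inord k))).
  have [k vk] : exists k, v 0 k != 0.
    apply/existsP; apply: contraNT nzA; rewrite negb_exists => /forallP vk.
    by apply/eqP/rowP => k; rewrite mxE; apply/eqP; have := vk k; rewrite negbK.
  by exists k => //; rewrite inord_val.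
apply/rowP => j; rewrite summxE [RHS]mxE; apply/mpolyP => m.
rewrite mcoeff0 raddf_sum /=; have [mp|mp] := ltnP (mdeg m) p.+1; last first.
  apply: big1 => k _; rewrite mxE mcoeffCM addn0.
  have /eigen_tofrac kp := (Psi_p k).2 j.
  by rewrite (dhomog_nemf_coeff kp) ?mulr0 // (gtn_eqF mp).
have /rowP/(_ (enum_rank ((j, BMultinom mp) : I))) := vA.
rewrite !mxE => E; rewrite -[RHS]E; apply: eq_bigr => k _.
by rewrite !mxE /ev mcoeffCM addn0 enum_rankK inord_val.
Qed.

End GradedBasis.

Lemma mulr_swap6 (A : comPzRingType) (q b q' x : A) :
  q * b * (q' * b * x) = q * q' * x * (b * b).
Proof. by ring. Qed.

Lemma scale_row_eq (A : comPzRingType) (e x p q : A) :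
  e + (x - 1) * p * q = e - p * q + p * (x * q).
Proof. by ring. Qed.

(** * The determinants of the Jacobian and of the invariant fields *)

Section CoxeterNumber.
Variables (K : numClosedFieldType) (n : nat) (gT : finGroupType) (W : {group gT}).
Notation l := n.+1.
Variable rW : mx_representation K W l.
Variables (t : 'I_l -> {mpoly K[l]}) (d : 'I_l -> nat) (dt : 'I_l -> derF K l).
Variable nablaDinv : derF K l -> derS K l.
Hypothesis faith : mx_faithful rW.
Hypothesis FI : fundamental_invariants rW t d.
Hypothesis dual : dual_derivations t dt.
Notation D := (dt ord_max).
Notation h := (d ord_max).
Hypothesis nD : nablaD_inverse rW dt D nablaDinv.
Variable roots : seq 'cV[K]_l.
Hypothesis rs : root_system rW roots.
Notation S := {mpoly K[l]}.
Notation F := {fraction {mpoly K[l]}}.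
Notation act := (poly_act rW).
Implicit Types (f q y : S) (delta chi : derF K l) (theta eta psi : derS K l) (g : gT).
Implicit Types (a b : 'cV[K]_l).

(** One divisibility is [det_jacS_dvd]. Conversely [det dtmx] has order at least [1 - e] along each
    root and no other poles, so [P det dtmx] is a polynomial, inverse to the quotient [v]. *)
Lemma det_jacS_roots : exists2 c, c != 0 &
  \det (jacS t) = c%:MP * \prod_(a <- roots) lin a ^+ #|fixer rW a|.-1.
Proof.
set P := \prod_(a <- roots) _.
have [v Ev] : mdvd P (\det (jacS t)).
  apply: lin_product_dvd (root_uniq rs) _ (root_coprime rs) => a ra.
  by split; [exact: (root_neq0 rs ra) | exact: (det_jacS_dvd faith FI rs)].
have [w Ew] : exists w, P%:F * \det (dtmx dt) = w%:F.
  have mR := @roots_prod_mult K l roots.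
  apply: (regular_off_integral rs).
    apply: (slocM mR); first exact: (sloc_tofrac mR).
    apply: (sloc_det mR) => i j; rewrite !mxE -derF_appX.
    exact: (regular_dt faith FI dual rs).
  move=> a ra; have [s [u [z rd]]] := exists_reflection_data faith rs ra.
  have pa := lin_prime (root_neq0 rs ra).
  rewrite (_ : 0 = #|fixer rW a|.-1%:Z + (1 - #|fixer rW a|%:Z)); last first.
    by move: (rd_card_gt1 rd); rewrite -subn1; lia.
  apply: (ordgeM pa).
    by apply/(ordge_tofracP pa); rewrite /P (big_rem a) //=; apply/mdvd_mulr/mdvd_refl.
  apply: (ordge_det (rd_dual rd)) => [i|i j].
    by rewrite rowK -derF_app_lin; apply: (rd_ordge_dt_alpha faith FI dual rd).
  rewrite mxE rowK -derv_flat_form -derF_app_lin.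
  by apply: (rd_ordge_dt faith FI dual rd); apply: (act_flat_form rd).
have P0 : P != 0.
  rewrite prodf_seq_neq0; apply/allP => a ra; apply/implyP => _.
  by rewrite expf_neq0 // lin_eq0 (root_neq0 rs ra).
have vw : v * w = 1.
  apply: (mulIf P0); rewrite mulrAC -Ev mul1r; apply: tofrac_inj.
  by rewrite tofracM -Ew mulrCA -det_map_mx -jacE -det_mulmx jac_dtmx // det1 mulr1.
have [||c c0 Ec] := @lin_product_unit _ _ [::] v w; rewrite ?big_nil //.
by exists c => //; rewrite Ev Ec.
Qed.

Variable phi : 'I_l -> derS K l.
Hypothesis phi_inv : forall k, inv_der rW (phi k).
Hypothesis phi_eigen : forall k j, eigen (h.+1%:R - (d k)%:R) (phi k 0 j)%:F.
Hypothesis det_phi : \det (field_mx phi) != 0.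

Lemma trace_der_homog p psi : pdeg_is p psi -> pdeg_is p (trace_der rW psi).
Proof.
move=> psi_p i; rewrite mxE; apply: rpred_sum => g Wg; apply: poly_act_homog.
rewrite -[p]addn0; apply: der_app_homog => //.
by rewrite poly_actX; apply: lin_homog.
Qed.

(** Interpolation writes the field as an [S]-combination of homogeneous invariant fields, to which
    [graded_span] applies. *)
Lemma orb_diff_span b p psi : pdeg_is p psi ->
  (forall g, g \in W -> act g (lin b) = lin b ->
     forall y, der_app psi (act g y) = act g (der_app psi y)) ->
  der_span phi (orb_diff rW (lin b) *: psi).
Proof.
move=> psi_p psi_inv; set f := lin b.
have N0 : (stab_size rW f)%:R != 0 :> K.
  case E : (stab_size rW f) => [|k]; last exact: natr_neq0.
  have := fintype.card0_eq E 1%g.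
  by rewrite !inE group1 poly_act1 eqxx.
have -> : orb_diff rW f *: psi =
    ((stab_size rW f)%:R^-1)%:MP *: ((orb_diff rW f *+ stab_size rW f) *: psi).
  by rewrite scalerA mul_mpolyC -scaler_nat scalerA mulVf // scale1r.
rewrite -lagrange_trace_der //; apply: der_spanZ; apply: der_span_sum => k _; apply: der_spanZ.
apply: (graded_span FI dual nD phi_inv phi_eigen det_phi
  (p := (size (cofactor_poly rW f) - k.+1 + p)%N)).
split=> [|j]; first exact: inv_der_trace.
apply/eigen_tofrac; apply: trace_der_homog => i; rewrite mxE; apply: dhomogM => //.
exact: (cofactor_poly_homog (lin_homog b)).
Qed.

Lemma span_det_dvd (c : S) (T : 'M[S]_l) : (forall i, der_span phi (c *: row i T)) ->
  mdvd (\det (field_mx phi)) (c ^+ l * \det T).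
Proof.
move=> cT; have [r rE] := fin_all_exists cT.
pose Y : 'M[S]_l := \matrix_(i, k) r i k.
exists (\det Y); rewrite -det_mulmx -detZ; congr (\det _).
apply/row_matrixP => i; rewrite rowE -scalemxAr -rowE rE row_mul.
apply/rowP => j; rewrite summxE mxE; apply: eq_bigr => k _.
by rewrite !mxE.
Qed.

(** With the generic form of [b], whose stabilizer is trivial, all constant fields are admissible.
    So the determinant divides a power of an [orb_diff] that is prime to [lin b]. *)
Lemma det_field_mx_ndvd b : b != 0 -> fixer rW b :=: 1%g ->
  ~ mdvd (lin b) (\det (field_mx phi)).
Proof.
move=> b0 triv dv; have [b' [stab nd]] := generic_form_orb_diff faith b0.
apply: (nmdvdX (lin_prime b0) (k := l) nd).
apply: (mdvd_trans dv); rewrite -[X in mdvd _ X]mulr1 -(det1 S l).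
apply: span_det_dvd => i; apply: (@orb_diff_span b' 0) => [j|g Wg gb y].
  by rewrite !mxE; apply: rpredMn; apply: dhomog1.
have : g \in fixer rW b by apply/stab.
by rewrite triv => /set1P ->; rewrite !poly_act1.
Qed.

(** The constant fields tangent to the hyperplane and the field [lin b u] commute with the
    stabilizer generated by [s]. They span the rows of a matrix of determinant [lin b], so
    [det field_mx] divides [lin b] times a polynomial prime to [lin b]. *)
Lemma det_field_mx_nsqr b s u z : reflection_data rW b s u z ->
  ~ mdvd (lin b ^+ 2) (\det (field_mx phi)).
Proof.
move=> rd dv; have b0 := rd_neq0 rd; have ub := rd_dual rd.
have pb := lin_prime b0; have [b' [stab nd]] := generic_form_orb_diff faith b0.
pose bS : 'cV[S]_l := map_mx (@mpolyC l K) b.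
pose uS : 'rV[S]_l := const_field u.
pose T : 'M[S]_l := 1%:M + ((lin b - 1) *: bS) *m uS.
have detT : \det T = lin b.
  rewrite det_matrix1 -scalemxAr mxE -map_mxM mxE evalvE ub rmorph1 mulr1.
  by rewrite addrC subrK.
have stab_sub g : g \in W -> act g (lin b') = lin b' -> g \in fixer rW b.
  by move=> Wg /stab; apply.
have const_pdeg w : pdeg_is 0 (const_field w : derS K l).
  by move=> j; rewrite mxE -[_%:MP]mulr1 mul_mpolyC; apply: rpredZ; apply: dhomog1.
have : mdvd (lin b ^+ 2) (orb_diff rW (lin b') ^+ l * lin b).
  apply: mdvd_trans dv _; rewrite -detT; apply: span_det_dvd => i.
  (* The vector [e_i - b_i u] lies in the hyperplane. *)
  have -> : row i T = const_field (delta_mx 0 i - b i 0 *: u) + bS i 0 *: (lin b *: uS).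
    apply/rowP => j; rewrite !mxE big_ord1 !mxE.
    rewrite mpolyCB mpolyCM (rmorph_nat (@mpolyC l K)) [j == i]eq_sym.
    exact: scale_row_eq.
  rewrite scalerDr; apply: der_spanD.
    apply: (orb_diff_span (const_pdeg _)) => g Wg gb y.
    have /fixerP[_ gP] := stab_sub g Wg gb.
    rewrite (@der_const_field _ _ _ _ rW g _ 1) ?scale1r //.
    apply: gP; rewrite -evalvE mulmxBl -scalemxAl !mxE -!/(evalv _ b) ub mulr1.
    by rewrite -evalvE -rowE mxE subrr.
  rewrite scalerA mulrC -scalerA; apply: der_spanZ.
  apply: (@orb_diff_span _ 1).
    move=> j; rewrite mxE; apply: (@dhomogM _ _ _ 1 _ 0); first exact: lin_homog.
    exact: const_pdeg.
  have Ws := fixer_in (rd_fixer rd).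
  have us_s y : der_app (lin b *: uS) (act s y) = act s (der_app (lin b *: uS) y).
    rewrite !der_appZl poly_act_mul (rd_act_alpha rd) (der_const_field (rd_u_mul rd)).
    by rewrite -scalerAr -scalerAl.
  move=> g Wg gb y; have := stab_sub g Wg gb.
  rewrite (rd_gen rd) => /cycleP[k ->]; elim: k y => [|k IH] y.
    by rewrite expg0 !poly_act1.
  by rewrite expgS -!(poly_actM rW _ Ws (groupX k Ws)) us_s IH.
rewrite expr2 => -[q]; rewrite mulrA => /(mulIf (mprime_neq0 pb)) E.
by apply: (nmdvdX pb (k := l) nd); rewrite E; apply/mdvd_mull/mdvd_refl.
Qed.

Lemma det_field_mx_dvd a : a \in roots -> mdvd (lin a) (\det (field_mx phi)).
Proof.
move=> ra; have [s [u [z rd]]] := exists_reflection_data faith rs ra.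
have pa := lin_prime (root_neq0 rs ra).
rewrite -[lin a]expr1; apply/(ordge_tofracP pa); rewrite -det_map_mx.
have rowE' i : row i (map_mx (@tofrac S) (field_mx phi)) = to_derF (phi i).
  by apply/rowP => j; rewrite !mxE.
apply: (ordge_det (rd_dual rd)) => [i|i j].
  rewrite rowE' derv_to_derF; have [q [-> _]] := inv_der_order rd (phi_inv i).
  apply/(ordge_tofracP pa); rewrite expr1; exact/mdvd_mulr/mdvd_refl.
rewrite [X in ordge _ _ X](_ : _ = derv (to_derF (phi i)) (flat_form a u j)).
  by rewrite derv_to_derF; apply: (ordge_tofrac pa).
by rewrite derv_flat_form rowE' !mxE.
Qed.

(** The regular form shows that the determinant divides a product of linear forms. None of these
    divides the quotient [g]: off the arrangement by [det_field_mx_ndvd], on it because the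
    determinant has no square factor there. *)
Lemma det_field_mx_roots : exists2 c, c != 0 &
  \det (field_mx phi) = c%:MP * \prod_(a <- roots) lin a.
Proof.
have [g Eg] : mdvd (\prod_(a <- roots) lin a) (\det (field_mx phi)).
  apply: (lin_product_dvd (k := fun _ => 1%N) (root_uniq rs) _ (root_coprime rs)) => a ra.
  by split; [exact: (root_neq0 rs ra) | exact: det_field_mx_dvd].
have [b [stab prodD]] := regular_form_orb_diff faith.
have [s s0 Es] := lin_product_exp l prodD.
have [w Ew] : mdvd (\det (field_mx phi)) (orb_diff rW (lin b) ^+ l).
  rewrite -[X in mdvd _ X]mulr1 -(det1 S l).
  apply: span_det_dvd => i; apply: (@orb_diff_span b 0) => [j|g' Wg gb y].
    by rewrite !mxE; apply: rpredMn; apply: dhomog1.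
  by rewrite (stab g' Wg gb) !poly_act1.
have [b' sb'||c c0 Ec] := @lin_product_unit _ _ s g ((\prod_(a <- roots) lin a) * w).
- have b'0 := s0 b' sb'; split=> // -[q Eq].
  have [triv|nt] := eqVneq (fixer rW b') 1%g.
    apply: (det_field_mx_ndvd b'0 triv).
    by rewrite Eg Eq; apply/mdvd_mulr/mdvd_mull/mdvd_refl.
  have [s1 [u [z rd]]] := fixer_reflection_data faith b'0 nt.
  apply: (det_field_mx_nsqr rd); have [a ra [q' Eq']] := root_cover rs b'0 nt.
  exists (q * q' * \prod_(j <- rem a roots) lin j).
  by rewrite Eg (big_rem a) //= Eq Eq' expr2; exact: mulr_swap6.
- by rewrite -Es Ew Eg mulrA mulrC.
by exists c => //; rewrite Eg Ec.
Qed.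

(** The degrees give [sum_k (h + 1 - d_k) = |roots|] and [sum_k (d_k - 1) = sum_a (e_a - 1)]; the
    [d_k] cancel on addition. *)
Lemma coxeter_sum : (l * h = \sum_(a <- roots) #|fixer rW a|)%N.
Proof.
have [c c0 Ec] := det_field_mx_roots; have [c' c'0 Ec'] := det_jacS_roots.
have J0 : \det (jacS t) != 0.
  rewrite -tofrac_eq0 -det_map_mx -jacE; apply/eqP => J0.
  have := det1 F l; rewrite -(dtmx_jac dual) det_mulmx J0 mulr0 => /eqP.
  by rewrite eq_sym oner_eq0.
have E1 : \sum_k (h.+1%:R - (d k)%:R) + \sum_(j < l) 0 = 0 + \sum_(a <- roots) 1%:R :> K.
  apply: (@eigen_uniq K l _ _ (\det (field_mx phi))%:F); first by rewrite tofrac_eq0.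
    rewrite -det_map_mx; apply: eigen_det => k j; rewrite !mxE addr0.
    exact: phi_eigen.
  rewrite Ec tofracM rmorph_prod; apply: eigenM; first exact: eigen_const.
  by apply: eigen_prod => a _ /=; rewrite -[lin a]expr1; apply: eigen_linX.
have E2 : \sum_(i < l) (- 1) + \sum_j (d j)%:R =
    0 + \sum_(a <- roots) (#|fixer rW a|.-1)%:R :> K.
  apply: (@eigen_uniq K l _ _ (\det (jacS t))%:F); first by rewrite tofrac_eq0.
    rewrite -det_map_mx; apply: eigen_det => i j; rewrite !mxE addrC.
    by apply: eigen_mderiv; apply/eigen_tofrac/(t_homog FI).
  rewrite Ec' tofracM rmorph_prod; apply: eigenM; first exact: eigen_const.
  by apply: eigen_prod => a _ /=; apply: eigen_linX.
apply/eqP; rewrite -(eqr_nat K) natr_sum.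
have -> : \sum_(a <- roots) #|fixer rW a|%:R =
    \sum_(a <- roots) 1%:R + \sum_(a <- roots) (#|fixer rW a|.-1)%:R :> K.
  rewrite -big_split; apply: eq_bigr => a _ /=.
  by rewrite -natrD add1n prednK ?cardG_gt0.
rewrite -[X in _ == X + _]add0r -E1 -[X in _ == _ + X]add0r -E2.
rewrite big1_eq addr0 sumrB !sumr_const card_ord.
by rewrite addrACA addNr addr0 -mulrnDl -[h.+1]addn1 natrD addrK -mulrnA mulnC.
Qed.

End CoxeterNumber.

(** * Logarithmic derivations *)

Section HomogeneousBases.
Variables (K : numClosedFieldType) (l : nat).
Notation S := {mpoly K[l]}.
Implicit Types (M : derS K l -> Prop) (b : 'I_l -> derS K l).

Lemma free_basis_eq M b (c c' : 'I_l -> S) : free_basis M b ->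
  M (\sum_i c i *: b i) -> \sum_i c i *: b i = \sum_i c' i *: b i -> c =1 c'.
Proof.
move=> [_ bP] /bP[c0 [_ c0_uniq]] E i.
have Ec (d : 'I_l -> S) : \sum_i d i *: b i = \sum_j (\row_k d k) 0 j *: b j.
  by apply: eq_bigr => k _; rewrite mxE.
have := c0_uniq (\row_j c j) (Ec c); rewrite (c0_uniq (\row_j c' j)) => [/rowP/(_ i)|].
  by rewrite !mxE.
by rewrite E Ec.
Qed.

Lemma euler_mcoeff0 (f : S) : (der_app (eulerS K l) f)@_0%MM = 0.
Proof.
rewrite raddf_sum /= big1 // => i _; rewrite mxE rmorphM /= mcoeffX mnm1_eq0.
by rewrite mul0r.
Qed.

(** The constant terms of a change of basis form an invertible matrix, so some permutation [s] picks
    only non-zero entries of it. A non-zero constant term of [Y i (s i)] forces [p' i = p (s i)]. *)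
Lemma homog_basis_uniq M b b' p p' :
  homog_basis M b p -> homog_basis M b' p' -> perm_eq (codom p) (codom p').
Proof.
move=> [bfree bhom] [b'free b'hom].
have coords b1 b2 : free_basis M b1 -> free_basis M b2 ->
    exists Y : 'M[S]_l, forall i, b2 i = \sum_j Y i j *: b1 j.
  move=> [_ b1P] [b2M _].
  have yP i : exists c : 'rV[S]_l, b2 i = \sum_j c 0 j *: b1 j.
    by have [c [E _]] := b1P _ (b2M i); exists c.
  have [y yE] := fin_all_exists yP.
  by exists (\matrix_(i, j) y i 0 j) => i; rewrite yE; apply: eq_bigr => j _; rewrite mxE.
have [Y YE] := coords _ _ bfree b'free; have [Z ZE] := coords _ _ b'free bfree.
have bE i : \sum_j (Z *m Y) i j *: b j = b i.
  rewrite [RHS]ZE; under [RHS]eq_bigr do rewrite YE scaler_sumr.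
  rewrite exchange_big; apply: eq_bigr => j _; rewrite mxE scaler_suml.
  by apply: eq_bigr => k _; rewrite scalerA.
have ZY : Z *m Y = 1%:M.
  apply/matrixP => i j; move: j.
  apply: (free_basis_eq (M := M) bfree); first by rewrite bE; case: bfree.
  rewrite bE (bigD1 i) //= mxE eqxx scale1r big1 ?addr0 // => j ji.
  by rewrite mxE eq_sym (negPf ji) scale0r.
pose Y0 := map_mx (mcoeff 0%MM) Y.
have detY0 : \det Y0 != 0.
  apply/eqP => Y00; have := congr1 (fun A => \det (map_mx (mcoeff 0%MM) A)) ZY.
  rewrite map_mxM det_mulmx -/Y0 Y00 mulr0 map_mx1 det1 => /eqP.
  by rewrite eq_sym oner_eq0.
have /existsP[s /forallP sP] : [exists s : 'S_l, forall i, Y0 i (s i) != 0].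
  apply: contraNT detY0; rewrite negb_exists => /forallP all0.
  apply/eqP; apply: big1 => s _; have /forallPn[k] := all0 s.
  by rewrite negbK => /eqP E; rewrite (bigD1 k) //= E mul0r mulr0.
have degE i : p' i = p (s i).
  pose L := der_app (eulerS K l).
  (* Euler's identity for [b' i] makes the bracket the coordinates of 0. They are added to the
     coordinates of [b' i] because uniqueness of coordinates is given only at elements known to
     satisfy the predicate [M]. *)
  pose c j := Y i j + (L (Y i j) + (p j)%:R *: Y i j - (p' i)%:R *: Y i j).
  have cY : Y i =1 c.
    apply: (free_basis_eq (M := M) bfree); first by rewrite -YE; case: b'free.
    rewrite /c; under [RHS]eq_bigr do rewrite scalerDl.
    rewrite big_split /= -[LHS]addr0; congr (_ + _); apply/esym/rowP => x.
    rewrite summxE [RHS]mxE; have /euler_homog := b'hom i x.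
    rewrite YE summxE raddf_sum scaler_sumr => /eqP; rewrite -subr_eq0 -sumrB => /eqP E.
    rewrite -[RHS]E; apply: eq_bigr => j _; rewrite !mxE /= -/L /L der_appM.
    have /euler_homog -> := bhom j x; rewrite mulrBl mulrDl -!scalerAl -scalerAr.
    by [].
  have := cY (s i); rewrite /c => /eqP; rewrite -subr_eq0 opprD addrA subrr add0r oppr_eq0.
  move=> /eqP/(congr1 (mcoeff 0%MM)); rewrite mcoeffB mcoeffD euler_mcoeff0 add0r.
  rewrite !mcoeffZ -mulrBl mcoeff0 => /eqP; rewrite mulf_eq0.
  have := sP i; rewrite mxE => /negPf ->; rewrite orbF subr_eq0 eqr_nat.
  by move/eqP.
rewrite perm_sym !codomE (eq_map degE) [X in perm_eq X](map_comp p s).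
apply: perm_map; rewrite perm_sym; apply: uniq_perm; first exact: enum_uniq.
  by rewrite map_inj_uniq ?enum_uniq //; exact: perm_inj.
move=> i; rewrite mem_enum; apply/esym/mapP; exists (s^-1%g i); first by rewrite mem_enum.
by rewrite permKV.
Qed.

End HomogeneousBases.

(** * Raising the multiplicities by [k] through [nabla] *)

Section LogarithmicTransfer.
Variables (K : numClosedFieldType) (l : nat).
Notation S := {mpoly K[l]}.
Implicit Types (a b : 'cV[K]_l) (u : 'rV[K]_l) (f p q : S) (theta eta chi : derS K l).

Lemma mulmx_det_inj (A : idomainType) r k (N : 'M[A]_k) (M M' : 'M[A]_(r, k)) :
  \det N != 0 -> M *m N = M' *m N -> M = M'.
Proof.
move=> detN /(congr1 (mulmx^~ (\adj N))); rewrite -!mulmxA mul_mx_adj !mul_mx_scalar.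
by move=> /matrixP E; apply/matrixP => i j; have := E i j; rewrite !mxE => /(mulfI detN).
Qed.

Lemma der_appXn theta f k :
  der_app theta (f ^+ k.+1) = k.+1%:R *: (f ^+ k * der_app theta f).
Proof.
elim: k => [|k IH]; first by rewrite expr1 expr0 mul1r scale1r.
rewrite exprS der_appM IH -scalerAr mulrA -exprS -[k.+2]addn1 natrD scalerDl scale1r.
by rewrite addrC mulrC.
Qed.

Lemma mdvd_mderiv p k f i : mdvd (p ^+ k.+1) f -> mdvd (p ^+ k) f^`M(i).
Proof.
move=> [q ->]; rewrite mderivM; apply: mdvdD.
  by apply/mdvd_mull/mdvd_exp/leqnSn.
apply: mdvd_mull; elim: k => [|k IH]; first by exists p^`M(i); rewrite expr0 mulr1 expr1.
rewrite [p ^+ k.+2]exprS mderivM; apply: mdvdD; first exact/mdvd_mull/mdvd_refl.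
by have [r ->] := IH; exists r; rewrite mulrCA -exprS.
Qed.

Lemma mdvd_scale c p f : c != 0 -> mdvd p (c *: f) -> mdvd p f.
Proof.
move=> c0 [q E]; exists (c^-1 *: q).
by rewrite -scalerAl -E scalerA mulVf ?scale1r.
Qed.

Definition poly_scale_mx a u f : 'M[S]_l :=
  1%:M + ((f - 1) *: map_mx (@mpolyC l K) a) *m map_mx (@mpolyC l K) u.

(** A row [x] of [M] is [x - a(x) u] plus [a(x) u]. The scaling fixes the first part and maps [u] to
    [f u], so it suffices to divide [a(x)] by [f]. *)
Lemma poly_scale_mx_factor r a u f (M : 'M[S]_(r, l)) : evalv u a = 1 ->
  (forall i, mdvd f ((M *m map_mx (@mpolyC l K) a) i 0)) ->
  exists M', M = M' *m poly_scale_mx a u f.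
Proof.
rewrite /poly_scale_mx; set aS := map_mx _ a; set uS := map_mx _ u => ua /fin_all_exists[q qE].
pose Q : 'cV[S]_r := \col_i q i.
have MaE : M *m aS = f *: Q.
  by apply/colP => i; rewrite qE !mxE mulrC.
have uaS : uS *m aS = 1%:M.
  by apply/matrixP => i j; rewrite !ord1 -map_mxM !mxE -/(evalv u a) ua.
exists (M - M *m aS *m uS + Q *m uS).
rewrite mulmxDr mulmx1 mulmxA -scalemxAr !mulmxDl mulNmx -!(mulmxA _ uS) uaS !mulmx1.
by rewrite subrr add0r MaE -!scalemxAl scalerBl scale1r addrACA subrr addr0 subrK.
Qed.

Lemma det_poly_scale_mx a u f : evalv u a = 1 -> \det (poly_scale_mx a u f) = f.
Proof.
move=> ua; rewrite det_matrix1 -scalemxAr mxE -map_mxM mxE evalvE ua rmorph1 mulr1.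
by rewrite addrC subrK.
Qed.

Lemma nabla_jac theta eta : nabla theta eta = theta *m jac_field eta.
Proof. by apply/rowP => j; rewrite !mxE; apply: eq_bigr => i _; rewrite !mxE. Qed.

Lemma der_app_nabla theta eta a :
  der_app (nabla theta eta) (lin a) = der_app theta (der_app eta (lin a)).
Proof.
rewrite !der_app_lin raddf_sum; apply: eq_bigr => i _ /=.
by rewrite mxE der_appM der_appC mulr0 addr0.
Qed.

Lemma der_app_linE chi a : der_app chi (lin a) = (chi *m map_mx (@mpolyC l K) a) 0 0.
Proof. by rewrite der_app_lin mxE; apply: eq_bigr => i _; rewrite mxE. Qed.

Lemma jac_field_factor eta a u k : evalv u a = 1 ->
  mdvd (lin a ^+ k.+1) (der_app eta (lin a)) ->
  exists V, jac_field eta = V *m poly_scale_mx a u (lin a ^+ k).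
Proof.
move=> ua dv; apply: poly_scale_mx_factor => // i.
rewrite [X in mdvd _ X](_ : _ = (der_app eta (lin a))^`M(i)); first exact: mdvd_mderiv.
rewrite der_app_lin raddf_sum mxE; apply: eq_bigr => j _ /=.
by rewrite !mxE (mulrC (eta 0 j)) mderiv_mulC mulrC.
Qed.

Lemma det_jac_field_dvd eta a k : a != 0 ->
  mdvd (lin a ^+ k.+1) (der_app eta (lin a)) ->
  mdvd (lin a ^+ k) (\det (jac_field eta)).
Proof.
move=> /exists_evalv1[u ua] /(jac_field_factor ua)[V ->].
by rewrite det_mulmx det_poly_scale_mx //; apply/mdvd_mull/mdvd_refl.
Qed.

Variables (roots : seq 'cV[K]_l) (k mu : 'cV[K]_l -> nat) (eta : derS K l) (c : K).
Hypothesis roots_neq0 : forall a, a \in roots -> a != 0.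
Hypothesis roots_uniq : uniq roots.
Hypothesis roots_coprime : forall a b, a \in roots -> b \in roots -> a != b ->
  ~ mdvd (lin a) (lin b).
Hypothesis eta_order : forall a, a \in roots ->
  mdvd (lin a ^+ (k a).+1) (der_app eta (lin a)).
Hypothesis c0 : c != 0.
Hypothesis det_eta : \det (jac_field eta) = c%:MP * \prod_(a <- roots) lin a ^+ k a.
Hypothesis mu_le1 : forall a, a \in roots -> (mu a <= 1)%N.

Definition log_along (nu : 'cV[K]_l -> nat) theta : Prop :=
  forall a, a \in roots -> mdvd (lin a ^+ nu a) (der_app theta (lin a)).

Let nu a := (k a + mu a)%N.

Lemma det_jac_field_neq0 : \det (jac_field eta) != 0.
Proof.
rewrite det_eta mulf_neq0 ?mpolyC_eq0 // prodf_seq_neq0; apply/allP => a ra /=.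
by rewrite expf_neq0 // lin_eq0 roots_neq0.
Qed.

(** Otherwise [eta(alpha)] would be divisible by [alpha^(k+2)] and the Jacobian by [alpha^(k+1)],
    contrary to [det_eta], as the other roots are prime to [alpha]. *)
Lemma order_cofactor a q : a \in roots ->
  der_app eta (lin a) = lin a ^+ (k a).+1 * q -> ~ mdvd (lin a) q.
Proof.
move=> ra E [q' Eq]; have pa := lin_prime (roots_neq0 ra).
have : mdvd (lin a ^+ (k a).+1) (\det (jac_field eta)).
  apply: det_jac_field_dvd; first exact: roots_neq0.
  by exists q'; rewrite E Eq mulrCA -exprSr.
rewrite det_eta (big_rem a) //= mulrCA exprSr => -[r Er].
have [p0 p1 pM] := pa.
have : mdvd (lin a) (c%:MP * \prod_(y <- rem a roots) lin y ^+ k y).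
  exists r; apply: (mulfI (expf_neq0 (k a) p0)).
  by rewrite Er mulrCA mulrC.
case/pM; first by case=> s Es; apply: p1; exists (c^-1%:MP * s);
  rewrite -mulrA -Es -mpolyCM mulVf.
have : {subset rem a roots <= [predD1 roots & a]} by move=> b; rewrite mem_rem_uniq.
elim: (rem a roots) => [|b s IH] sP; first by rewrite big_nil.
rewrite big_cons => /pM[]; last first.
  by apply: IH => b' sb'; apply: sP; rewrite inE sb' orbT.
have /andP[ba rb] := sP b (mem_head _ _).
apply: (nmdvdX pa); apply: roots_coprime => //.
by rewrite eq_sym.
Qed.

(** The Leibniz rule; the second summand is only known to have order [k a + 1], whence the
    restriction to multiplicities [mu a <= 1]. *)
Lemma der_app_order theta a q : der_app eta (lin a) = lin a ^+ (k a).+1 * q ->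
  der_app (nabla theta eta) (lin a) =
  (k a).+1%:R *: (der_app theta (lin a) * q) * lin a ^+ k a
    + der_app theta q * lin a ^+ (k a).+1.
Proof.
move=> E; rewrite der_app_nabla E der_appM der_appXn [_ * der_app theta q]mulrC.
by rewrite -!scalerAl -[_ * q]mulrA [X in _ *: X]mulrC.
Qed.

Lemma log_along_nabla theta : log_along mu theta -> log_along nu (nabla theta eta).
Proof.
move=> theta_mu a ra; have [q Eq] := eta_order ra; rewrite mulrC in Eq.
rewrite (der_app_order theta Eq); apply: mdvdD; last first.
  by apply/mdvd_mull/mdvd_exp; rewrite /nu; move: (mu_le1 ra); lia.
have [r ->] := theta_mu a ra; exists ((k a).+1%:R *: (r * q)).
rewrite /nu exprD -!scalerAl; congr (_ *: _).
by rewrite -[RHS]mulrA [lin a ^+ k a * _]mulrC -!mulrA [q * (_ * _)]mulrCA.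
Qed.

(** Cramer's rule requires [chi adj J] to be divisible by the product [P]. Along each root,
    [J = V T] and [chi = chi' T] with the same scaling [T], so [chi adj J = alpha^k chi' adj V]. *)
Lemma log_along_nablaV chi : log_along nu chi ->
  exists2 theta, log_along mu theta & chi = nabla theta eta.
Proof.
move=> chi_nu; pose J := jac_field eta; pose f := chi *m \adj J.
pose P := \prod_(a <- roots) lin a ^+ k a.
have P0 : P != 0 by move: det_jac_field_neq0; rewrite det_eta mulf_eq0 negb_or => /andP[].
have fJ : f *m J = \det J *: chi by rewrite -mulmxA mul_adj_mx mul_mx_scalar.
have fdvd j : mdvd P (f 0 j).
  apply: lin_product_dvd => // a ra; split; first exact: roots_neq0.
  have [u ua] := exists_evalv1 (roots_neq0 ra).
  have [V EV] := jac_field_factor ua (eta_order ra).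
  have [chi' Echi] : exists chi' : derS K l, chi =
      chi' *m poly_scale_mx a u (lin a ^+ k a).
    apply: poly_scale_mx_factor => // i; rewrite ord1 -der_app_linE.
    by apply: mdvd_trans (chi_nu a ra); apply/mdvd_exp/leq_addr.
  set T := (X in _ = _ *m X) in EV Echi.
  have detT : \det T = lin a ^+ k a by apply: det_poly_scale_mx.
  have detJ : \det J = \det V * lin a ^+ k a by rewrite /J EV det_mulmx detT.
  have [V0 T0] : \det V != 0 /\ \det T != 0.
    by apply/andP; rewrite detT -negb_or -mulf_eq0 -detJ det_jac_field_neq0.
  have fV : f *m V = \det J *: chi'.
    apply: (mulmx_det_inj T0); rewrite -mulmxA -EV fJ Echi.
    by rewrite scalemxAl.
  suff -> : f = lin a ^+ k a *: (chi' *m \adj V).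
    by rewrite mxE; apply/mdvd_mulr/mdvd_refl.
  apply: (mulmx_det_inj V0); rewrite fV -scalemxAl -mulmxA mul_adj_mx mul_mx_scalar.
  by rewrite scalerA detJ mulrC.
have [g gE] := fin_all_exists fdvd.
pose theta : derS K l := c^-1%:MP *: \row_j g j.
have chiE : chi = nabla theta eta.
  rewrite nabla_jac -/J; apply/rowP => j; apply: (mulfI det_jac_field_neq0).
  have := fJ; rewrite (_ : f = \det J *: theta); last first.
    apply/rowP => i; rewrite gE !mxE det_eta -/P mulrACA -mpolyCM divff // mul1r.
    by rewrite mulrC.
  by rewrite -scalemxAl => /rowP/(_ j); rewrite !mxE.
exists theta => // a ra; have [q Eq] := eta_order ra; rewrite mulrC in Eq.
(* For [mu a = 1], the leading term [(k + 1) alpha^k q theta(alpha)] must be divisible by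
   [alpha^(k+1)]; as [q] is prime to [alpha], [theta(alpha)] is divisible by [alpha]. *)
have := chi_nu a ra; rewrite /nu; case: (mu a) (mu_le1 ra) => [|[|//]] _.
  by exists (der_app theta (lin a)); rewrite expr0 mulr1.
rewrite chiE (der_app_order theta Eq) addn1 => -[r Er].
have pa := lin_prime (roots_neq0 ra); have [p0 _ pM] := pa.
suff /pM[|/(order_cofactor ra Eq)] : mdvd (lin a) (der_app theta (lin a) * q) by [].
apply: (@mdvd_scale (k a).+1%:R); first exact: natr_neq0.
exists (r - der_app theta q); apply: (mulIf (expf_neq0 (k a) p0)).
by rewrite -mulrA -exprS mulrBl -Er addrK.
Qed.

Lemma nabla_sum (x : 'I_l -> S) (theta : 'I_l -> derS K l) :
  nabla (\sum_i x i *: theta i) eta = \sum_i x i *: nabla (theta i) eta.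
Proof.
rewrite nabla_jac mulmx_suml; apply: eq_bigr => i _.
by rewrite nabla_jac -scalemxAl.
Qed.

Lemma nabla_inj : injective (fun theta => nabla theta eta).
Proof.
move=> theta theta'; rewrite !nabla_jac.
exact: (mulmx_det_inj det_jac_field_neq0).
Qed.

Lemma free_basis_nabla (b : 'I_l -> derS K l) : free_basis (log_along mu) b ->
  free_basis (log_along nu) (fun i => nabla (b i) eta).
Proof.
move=> [bM bP]; split=> [i|chi /log_along_nablaV[theta /bP[x [E xuniq]] ->]].
  exact: log_along_nabla.
exists x; split=> [|y Ey]; first by rewrite -nabla_sum -E.
by apply: xuniq; apply: nabla_inj; rewrite Ey nabla_sum.
Qed.

Lemma homog_basis_nabla (b : 'I_l -> derS K l) (p : 'I_l -> nat) N :
  pdeg_is N.+1 eta -> homog_basis (log_along mu) b p ->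
  homog_basis (log_along nu) (fun i => nabla (b i) eta) (fun i => (N + p i)%N).
Proof.
move=> etaN [bfree bhom]; split=> [|i j]; first exact: free_basis_nabla.
by rewrite mxE addnC; apply: der_app_homog.
Qed.

End LogarithmicTransfer.

Section LogarithmicDerivations.
Variables (K : numClosedFieldType) (l : nat).
Notation S := {mpoly K[l]}.
Implicit Types (a b : 'cV[K]_l) (H : {vspace 'rV[K]_l}) (theta : derS K l).

(** Turns a multiplicity on hyperplanes into one on roots. *)
Definition form_ker a : {vspace 'rV[K]_l} :=
  lker (linfun (mulmxr a : 'rV[K]_l -> 'rV[K]_1)).

Lemma is_form_ker a : is_form (form_ker a) a.
Proof.
move=> v; rewrite memv_ker lfunE /= -evalvE; apply/eqP/eqP => [->|E]; first by rewrite mxE.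
by apply/matrixP => i j; rewrite !ord1 E mxE.
Qed.

Lemma form_kerE H a : is_form H a -> form_ker a = H.
Proof. by move=> Ha; apply/vspaceP => v; rewrite Ha is_form_ker. Qed.

Lemma is_form_scale H a b : a != 0 -> is_form H a -> is_form H b ->
  exists2 c, c != 0 & b = c *: a.
Proof.
move=> a0 Ha Hb; have [u ua] := exists_evalv1 a0.
exists (evalv u b); first by rewrite -Hb Ha ua oner_eq0.
have /(mdvd_linE ua) := is_form_dvd a0 Ha Hb.
by rewrite restr_lin -(lin0 K l) => /lin_inj/eqP; rewrite subr_eq0 => /eqP.
Qed.

Variables (A : seq {vspace 'rV[K]_l}) (roots : seq 'cV[K]_l).
Hypothesis roots_neq0 : forall a, a \in roots -> a != 0.
Hypothesis roots_form : forall a, a \in roots -> exists2 H, H \in A & is_form H a.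
Hypothesis form_roots : forall H, H \in A -> exists2 a, a \in roots & is_form H a.

Lemma log_derP nu theta :
  log_der A nu theta <-> log_along roots (fun a => nu (form_ker a)) theta.
Proof.
split=> [theta_nu a ra|theta_nu H alpha HA kerH].
  have [H HA Ha] := roots_form ra; have [alpha [kerH E]] := is_form_hom Ha.
  by rewrite (form_kerE Ha) -E; apply: theta_nu.
have [b [-> Hb]] := linear_poly_lin alpha; rewrite kerH in Hb.
have [a ra Ha] := form_roots HA; have [q Eq] := theta_nu a ra.
have [c c0 ->] := is_form_scale (roots_neq0 ra) Ha Hb.
exists ((c / c ^+ nu H) *: q); rewrite linZ der_appZ Eq (form_kerE Ha) exprZn.
by rewrite -scalerAr -scalerAl scalerA [_ * (c / _)]mulrC divfK ?expf_neq0.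
Qed.

End LogarithmicDerivations.

Lemma eq_homog_basis (K : fieldType) l (M M' : derS K l -> Prop) b p :
  (forall theta, M theta <-> M' theta) -> homog_basis M b p -> homog_basis M' b p.
Proof.
move=> MM' [[bM bP] bp]; split=> //; split=> [i|theta]; first exact/MM'.
by move/MM'/bP.
Qed.

(** * The iterates of [nablaDinv] on multiples of the Euler field *)

Section PrimitiveDerivations.
Variables (K : numClosedFieldType) (n : nat) (gT : finGroupType) (W : {group gT}).
Notation l := n.+1.
Variable rW : mx_representation K W l.
Variables (t : 'I_l -> {mpoly K[l]}) (d : 'I_l -> nat) (dt : 'I_l -> derF K l).
Variable nablaDinv : derF K l -> derS K l.
Hypothesis faith : mx_faithful rW.
Hypothesis FI : fundamental_invariants rW t d.
Hypothesis dual : dual_derivations t dt.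
Notation D := (dt ord_max).
Notation h := (d ord_max).
Hypothesis nD : nablaD_inverse rW dt D nablaDinv.
Variable roots : seq 'cV[K]_l.
Hypothesis rs : root_system rW roots.
Notation S := {mpoly K[l]}.

(** The factor [c] is free because [c = 1] is used to identify [coxeter_number] with [h]; only then
    is the inverse of [coxeter_number] known to be a non-zero factor. *)
Definition primitive_iter (c : K) m : derS K l :=
  iter m (fun eta => nablaDinv (to_derF eta)) (c%:MP *: eulerS K l).

Lemma primitive_iter_inv c m : inv_der rW (primitive_iter c m).
Proof.
elim: m => [|m IH]; last by apply: (proj1 (nD.2 _ _)); apply: (derR_inv_der FI dual).
by apply: inv_derZ; [exact: const_invariant | exact: inv_der_euler].
Qed.

Lemma nablaF_primitive_iter c m :
  nablaF D (primitive_iter c m.+1) = to_derF (primitive_iter c m).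
Proof.
by apply: (proj2 (nD.2 _ _)); apply: (derR_inv_der FI dual); apply: primitive_iter_inv.
Qed.

Let Xi_inv c m := primitive_iter_inv c m.+1.
Let XiS c := nablaF_primitive_iter c.

Lemma roots_coxeter : (l * h = \sum_(a <- roots) #|fixer rW a|)%N.
Proof.
have Xi0 : primitive_iter 1 0 = 1%:MP *: eulerS K l by [].
have [phi phiP] := fin_all_exists2 (Xi_nabla_exists faith FI dual nD rs Xi0
  (Xi_inv 1) (XiS 1) 0).
move=> phiE.
apply: (coxeter_sum faith FI dual nD rs phiP) => [k j|].
  have := Xi_nabla_eigen FI dual nD Xi0 (Xi_inv 1) (XiS 1) j (phiE k).
  by rewrite mul1n.
rewrite -tofrac_eq0 -det_map_mx.
rewrite (_ : map_mx _ _ = dtmx dt *m map_mx (@tofrac S) (jac_field (primitive_iter 1 1))).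
  rewrite det_mulmx mulf_neq0 //; last first.
    rewrite det_map_mx tofrac_eq0.
    exact: (det_jac_Xi_neq0 faith FI dual nD rs (oner_neq0 K) Xi0 (Xi_inv 1) (XiS 1)).
  apply/eqP => J0; have := det1 {fraction S} l; rewrite -(dtmx_jac dual) det_mulmx J0 mul0r.
  by move/eqP; rewrite eq_sym oner_eq0.
apply/row_matrixP => k; rewrite row_mul rowK -nabla_jac_field phiE.
by apply/rowP => j; rewrite !mxE.
Qed.

Lemma det_jac_primitive c m : c != 0 -> exists2 c', c' != 0 &
  \det (jac_field (primitive_iter c m)) =
  c'%:MP * \prod_(a <- roots) lin a ^+ (m * #|fixer rW a|).
Proof.
move=> c0; have Xi0 : primitive_iter c 0 = c%:MP *: eulerS K l by [].
have J0 := det_jac_Xi_neq0 faith FI dual nD rs c0 Xi0 (Xi_inv c) (XiS c) m.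
have [v Ev] : mdvd (\prod_(a <- roots) lin a ^+ (m * #|fixer rW a|))
    (\det (jac_field (primitive_iter c m))).
  apply: (lin_product_dvd (k := fun a => (m * #|fixer rW a|)%N) (root_uniq rs) _
    (root_coprime rs)) => a ra.
  split; first exact: (root_neq0 rs ra).
  apply: det_jac_field_dvd; first exact: (root_neq0 rs ra).
  exact: (Xi_order faith FI dual nD rs Xi0 (Xi_inv c) (XiS c)).
rewrite Ev; rewrite Ev mulf_eq0 negb_or in J0; case/andP: J0 => v0 P0.
(* The Jacobian matrix has entries of degree [m h], so its determinant has degree [m l h], as has
   the product by [roots_coxeter]; hence [v] has degree 0. *)
have [c' Ec'] : exists c', v = c'%:MP.
  apply: eigen0_const; apply: (@eigen_cancel K l (m * (l * h))%:R 0
    (\prod_(a <- roots) lin a ^+ (m * #|fixer rW a|))%:F).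
  - by rewrite tofrac_eq0; exact: P0.
  - rewrite rmorph_prod roots_coxeter big_distrr natr_sum /=; apply: eigen_prod => a _.
    exact: eigen_linX.
  rewrite addr0 -tofracM mulrC -Ev -det_map_mx.
  rewrite (_ : _%:R = \sum_(i < l) (- 1) + \sum_(j < l) (m * h).+1%:R :> K).
    apply: eigen_det => i j; rewrite !mxE addrC; apply: eigen_mderiv.
    exact: (Xi_eigen FI dual nD Xi0 (Xi_inv c) (XiS c)).
  rewrite !sumr_const card_ord -mulrnDl -[(m * h).+1]addn1 natrD addrC addrK.
  by rewrite -mulrnA mulnCA mulnC.
exists c'; last by rewrite Ec'.
by apply: contraNneq v0 => c'0; rewrite Ec' c'0 mpolyC0.
Qed.

End PrimitiveDerivations.

Theorem theorem3p22 (R : realType) (n : nat)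
    (gT : finGroupType) (W : {group gT}) (rW : mx_representation R[i] W n.+1)
    (t : 'I_n.+1 -> {mpoly R[i][n.+1]}) (d : 'I_n.+1 -> nat)
    (dt : 'I_n.+1 -> derF R[i] n.+1)
    (nablaDinv : derF R[i] n.+1 -> derS R[i] n.+1)
    (m : nat) (mu : {vspace 'rV[R[i]]_n.+1} -> nat)
    (theta : 'I_n.+1 -> derS R[i] n.+1) (p : 'I_n.+1 -> nat) :
  reflection_group rW -> mx_irreducible rW -> well_generated rW ->
  fundamental_invariants rW t d ->
  dual_derivations t dt ->
  nablaD_inverse rW dt (dt ord_max) nablaDinv ->
  (forall H, H \in refl_arr rW -> (mu H <= 1)%N) ->
  homog_basis (log_der (refl_arr rW) mu) theta p ->
  let nu H := (m * stab_order rW H + mu H)%N in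
  free_basis (log_der (refl_arr rW) nu)
    (fun i => nabla (theta i) (nablaDinv_iter rW nablaDinv m)) /\
  exponents (log_der (refl_arr rW) nu)
    [seq (m * coxeter_number rW + p i)%N | i : 'I_n.+1].
Proof.
move=> [faith _] _ _ FI dual nD mu1 theta_basis nu.
have [roots [rs sumE roots_form form_roots]] := exists_root_system faith.
have h0 := h_gt0 FI.
(* The truncated division in [coxeter_number] is exact by [roots_coxeter]. *)
have coxE : coxeter_number rW = d ord_max.
  by rewrite /coxeter_number -sumE -(roots_coxeter faith FI dual nD rs) mulKn.
pose c : R[i] := (coxeter_number rW)%:R^-1.
have c0 : c != 0 by rewrite invr_eq0 pnatr_eq0 coxE -lt0n.
have -> : nablaDinv_iter rW nablaDinv m = primitive_iter nablaDinv c m.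
  congr iter; apply/rowP => j; rewrite !mxE mul_mpolyC.
  by [].
set Xi := primitive_iter nablaDinv c m.
have Xi0 : primitive_iter nablaDinv c 0 = c%:MP *: eulerS R[i] n.+1 by [].
have Xi_inv k := primitive_iter_inv FI dual nD c k.+1.
have XiS := nablaF_primitive_iter FI dual nD c.
have [c' c'0 det_Xi] := det_jac_primitive faith FI dual nD rs m c0.
have Xi_ord a : a \in roots ->
    mdvd (lin a ^+ (m * #|fixer rW a|).+1) (der_app Xi (lin a)).
  exact: (Xi_order faith FI dual nD rs Xi0 Xi_inv XiS).
have Xi_homog : pdeg_is (m * coxeter_number rW).+1 Xi.
  move=> j; apply/eigen_tofrac; rewrite coxE.
  exact: (Xi_eigen FI dual nD Xi0 Xi_inv XiS).
have mu1' a : a \in roots -> (mu (form_ker a) <= 1)%N.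
  by move=> /roots_form[H HA Ha]; rewrite (form_kerE Ha) mu1.
have logP := log_derP (root_neq0 rs) roots_form form_roots.
have nuE theta' : log_der (refl_arr rW) nu theta' <->
    log_along roots (fun a => m * #|fixer rW a| + mu (form_ker a))%N theta'.
  rewrite logP; split=> H a ra; have := H a ra;
  by rewrite /nu (stab_orderE rW (is_form_ker a)).
have nu_basis := homog_basis_nabla (k := fun a => (m * #|fixer rW a|)%N)
  (root_neq0 rs) (root_uniq rs) (root_coprime rs) Xi_ord c'0 det_Xi mu1' Xi_homog
  (eq_homog_basis (logP mu) theta_basis).
have {}nu_basis := eq_homog_basis (fun x => iff_sym (nuE x)) nu_basis.
split; first by case: nu_basis.
split=> [|b p' /(homog_basis_uniq nu_basis) //].
by exists (fun i => nabla (theta i) Xi), (fun i => m * coxeter_number rW + p i)%N.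
Qed.
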